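(* Let $1\le d<n$, $\mathrm{rch}_{\min}>0$, $R\ge144\,\mathrm{rch}_{\min}$, $0<f_{\min}\le f_{\max}/96$, $L\ge0$, $\tau>0$, $\alpha<1/2$. Assume $$\min_{1\le k\le n}\left(\frac{192\,\mathrm{rch}_{\min}\sqrt k}{R}\right)^k\le 36\cdot8^d\sigma_{d-1}f_{\min}\mathrm{rch}_{\min}^d\le1.$$ Then no randomized SQ algorithm (with any number of queries to $\mathrm{STAT}(\tau)$) estimates $M=\mathrm{Supp}(D)$ over the bounding ball model $\mathcal{D}^{n,d}_{\mathrm{rch}_{\min}}(f_{\min},f_{\max},L;R)$ with respect to $d_H$ with precision $$\varepsilon<\frac{\mathrm{rch}_{\min}}{2^{31}}\min\left\{\frac{1}{2^{10}d^2},\left(\frac{\tau}{\omega_d f_{\min}\mathrm{rch}_{\min}^d}\right)^{2/d}\right\}$$ and probability of success $1-\alpha$.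
   Context: Notation: $\omega_d$ is the volume of the unit ball of $\mathbb{R}^d$, $\sigma_{d-1}$ the $(d-1)$-dimensional volume of the unit sphere of $\mathbb{R}^d$. $\mathrm{B}(x,r)$ closed Euclidean ball, $\mathrm{d}(z,K)=\inf_{p\in K}\|p-z\|$. The reach $\mathrm{rch}_K$ of a closed set $K$ is the infimum of $\mathrm{d}(z,K)$ over the medial axis (points with at least two distinct nearest points in $K$). $\mathcal{M}^{n,d}_{\rho}$ is the set of compact connected $d$-dimensional $C^2$ submanifolds of $\mathbb{R}^n$ without boundary with reach $\ge\rho$. $\mathcal{D}^{n,d}_{\mathrm{rch}_{\min}}(f_{\min},f_{\max},L)$ is the set of Borel probability distributions $D$ on $\mathbb{R}^n$ with support $M\in\mathcal{M}^{n,d}_{\mathrm{rch}_{\min}}$ having a density $f$ w.r.t. the $d$-dimensional Hausdorff measure restricted to $M$ with $f_{\min}\le f\le f_{\max}$ and $f$ $L$-Lipschitz on $M$; the bounding ball model $\mathcal{D}^{n,d}_{\mathrm{rch}_{\min}}(f_{\min},f_{\max},L;R)$ consists of those with support in $\mathrm{B}(0,R)$. $d_H(K,K')=\sup_x|\mathrm{d}(x,K)-\mathrm{d}(x,K')|$. SQ framework: a $\mathrm{STAT}(\tau)$ oracle for $D$ answers each measurable query $r:\mathbb{R}^n\to[-1,1]$ with an arbitrary adversarial real $a$ with $|a-\mathbb{E}_D[r]|\le\tau$. A deterministic SQ algorithm chooses its queries adaptively and outputs a function of all answers; a randomized SQ algorithm is a probability distribution over deterministic ones; it estimates $\mathrm{Supp}(D)$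 with precision $\varepsilon$ and probability of success $1-\alpha$ if for every $D$ in the model and every valid $\mathrm{STAT}(\tau)$ oracle for $D$, with probability at least $1-\alpha$ its output $\hat M$ satisfies $d_H(\mathrm{Supp}(D),\hat M)\le\varepsilon$. *)

(* Defs.v *)
From HB Require Import structures.
From mathcomp Require Import all_boot all_order all_algebra.
From mathcomp Require Import all_classical all_reals all_analysis.
Import Order.TTheory GRing.Theory Num.Theory.
Import numFieldNormedType.Exports.

Set Implicit Arguments.
Unset Strict Implicit.
Unset Printing Implicit Defensive.

Local Open Scope classical_set_scope.
Local Open Scope ring_scope.

Section SQDefs.
Variable R : realType.

(** Euclidean norm (the library norm on 'rV is the max-norm; the topology is
    the same, but metric quantities below use the Euclidean norm). *)
Definition enorm (n : nat) (x : 'rV[R]_n) : R := Num.sqrt (\sum_i (x 0 i) ^+ 2).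

Definition eball (n : nat) (x : 'rV[R]_n) (r : R) : set 'rV[R]_n :=
  [set y | enorm (y - x) <= r].

(** d(z, K) = inf_{p in K} ||p - z||  (= +oo when K is empty) *)
Definition edist (n : nat) (z : 'rV[R]_n) (K : set 'rV[R]_n) : \bar R :=
  ereal_inf [set (enorm (p - z))%:E | p in K].

Definition dH (n : nat) (K K' : set 'rV[R]_n) : \bar R :=
  ereal_sup [set `|(edist x K - edist x K')%E|%E | x in [set: 'rV[R]_n]].

Definition medial_axis (n : nat) (K : set 'rV[R]_n) : set 'rV[R]_n :=
  [set z | exists p q, [/\ K p, K q, p <> q,
     (enorm (p - z))%:E = edist z K & (enorm (q - z))%:E = edist z K]].

(** reach: infimum of d(z, K) over the medial axis (+oo if it is empty) *)
Definition reach (n : nat) (K : set 'rV[R]_n) : \bar R :=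
  ereal_inf [set edist z K | z in medial_axis K].

(** omega_d = volume of the unit ball of R^d, via the classical recursion
    omega_0 = 1, omega_1 = 2, omega_d = (2 pi / d) omega_(d-2). *)
Fixpoint omega (d : nat) : R :=
  match d with
  | 0 => 1
  | 1 => 2
  | S (S k as k1) => (2 * pi / (k1.+1)%:R) * omega k
  end.

(** sigma_{d-1} = (d-1)-dimensional volume of the unit sphere of R^d = d omega_d *)
Definition sigma_sphere (d : nat) : R := d%:R * omega d.

Definition Hdelta (n d : nat) (delta : R) (A : set 'rV[R]_n) : \bar R :=
  ereal_inf [set (\sum_(0 <= i <oo) ((omega d * (r i / 2) ^+ d)%:E))%E
            | r in [set r : nat -> R | exists C : nat -> set 'rV[R]_n,
                 A `<=` \bigcup_i C i /\
                 forall i, 0 <= r i <= delta /\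
                   forall x y, C i x -> C i y -> enorm (x - y) <= r i]].

(** d-dimensional Hausdorff measure H^d(A) = lim_{delta -> 0+} H^d_delta(A)
    (a nonincreasing limit, i.e. the supremum over delta > 0). *)
Definition hausdorff (n d : nat) (A : set 'rV[R]_n) : \bar R :=
  ereal_sup [set Hdelta d delta A | delta in [set delta : R | 0 < delta]].

Definition unitv (d : nat) (i : 'I_d) : 'rV[R]_d := delta_mx 0 i.

Definition partial (d n : nat) (f : 'rV[R]_d -> 'rV[R]_n) (i : 'I_d) :
  'rV[R]_d -> 'rV[R]_n := fun v => 'D_(unitv i) f v.

Definition C2_on (d n : nat) (f : 'rV[R]_d -> 'rV[R]_n) (V : set 'rV[R]_d) :=
  open V /\
  forall v, V v ->
    {for v, continuous f} /\
    forall i j, derivable f v (unitv i) /\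
                derivable (partial f i) v (unitv j) /\
                {for v, continuous (partial (partial f i) j)}.

Definition immersive_at (d n : nat) (f : 'rV[R]_d -> 'rV[R]_n) (v : 'rV[R]_d) :=
  forall c : 'I_d -> R, \sum_i (c i *: partial f i v) = 0 -> forall i, c i = 0.

(** M is a d-dimensional C^2 embedded submanifold of R^n without boundary:
    around each point, M is the image of a C^2 immersion of an open subset of
    R^d which is a homeomorphism onto its image (an open piece of M). *)
Definition C2_submanifold (n d : nat) (M : set 'rV[R]_n) :=
  forall p, M p ->
    exists (U : set 'rV[R]_n) (V : set 'rV[R]_d) (phi : 'rV[R]_d -> 'rV[R]_n),
      [/\ open U, U p, C2_on phi V,
          (forall v, V v -> immersive_at phi v) &
          [/\ (forall v w, V v -> V w -> phi v = phi w -> v = w),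
          phi @` V = M `&` U &
          (forall W, open W -> W `<=` V ->
             exists O, open O /\ phi @` W = M `&` U `&` O)]].

Definition manifold_class (n d : nat) (rho : R) (M : set 'rV[R]_n) :=
  [/\ compact M, connected M, C2_submanifold d M & (rho%:E <= reach M)%E].

Definition borelR (n : nat) := g_sigma_algebraType (@open 'rV[R]_n).

Definition supp (n : nat) (D : probability (borelR n) R) : set 'rV[R]_n :=
  [set x | forall U : set 'rV[R]_n, open U -> U x -> (0 < D U)%E].

Definition model (n d : nat) (rch fmin fmax L Rb : R)
    (D : probability (borelR n) R) :=
  exists (M : set 'rV[R]_n) (f : borelR n -> R),
    [/\ manifold_class d rch M,
        supp D = M,
        M `<=` eball 0 Rb,
        measurable_fun [set: borelR n] f &
      [/\ (forall x, M x -> fmin <= f x <= fmax),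
        (forall x y, M x -> M y -> `|f x - f y| <= L * enorm (x - y)) &
        exists mu : {measure set (borelR n) -> \bar R},
          (forall A, measurable A -> mu A = hausdorff d (A `&` M)) /\
          (forall A, measurable A -> D A = (\int[mu]_(x in A) (f x)%:E)%E)]].

Record query (n : nat) := Query {
  qfun : borelR n -> R;
  qfun_meas : measurable_fun [set: borelR n] qfun;
  qfun_bound : forall x, -1 <= qfun x <= 1 }.

Definition expect (n : nat) (D : probability (borelR n) R) (q : query n) : \bar R :=
  (\int[D]_x (qfun q x)%:E)%E.

Inductive sq_action (n : nat) :=
| Ask of query n
| Output of set 'rV[R]_n.

(** deterministic (adaptive) SQ algorithm: next action as a function of the
    answers received so far *)
Definition det_alg (n : nat) := seq R -> sq_action n.

(** an (adversarial) oracle: answers the last query of the list of queries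
    asked so far *)
Definition oracle (n : nat) := seq (query n) -> R.

Definition valid_oracle (n : nat) (D : probability (borelR n) R) (tau : R)
    (O : oracle n) :=
  forall qs q, (`|(O (rcons qs q))%:E - expect D q| <= tau%:E)%E.

Inductive runs (n : nat) (A : det_alg n) (O : oracle n) :
    seq (query n) -> seq R -> Prop :=
| run_nil : runs A O [::] [::]
| run_cons qs ans q : runs A O qs ans -> A ans = Ask q ->
    runs A O (rcons qs q) (rcons ans (O (rcons qs q))).

Definition outputs (n : nat) (A : det_alg n) (O : oracle n) (K : set 'rV[R]_n) :=
  exists qs ans, runs A O qs ans /\ A ans = Output K.

(** A randomized SQ algorithm is a probability distribution P (on a measurable
    space Om) over deterministic ones (A : Om -> det_alg n).  It estimates
    Supp(D) over the model with precision eps and probability of success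
    1 - alpha using STAT(tau) if for every D in the model and every valid
    oracle, with probability >= 1 - alpha (i.e. on a measurable event of
    P-probability >= 1 - alpha) its output Mhat satisfies
    d_H(Supp D, Mhat) <= eps. *)
Definition sq_estimates (n : nat) (mdl : probability (borelR n) R -> Prop)
    (tau eps alpha : R) (dO : measure_display) (Om : measurableType dO)
    (P : probability Om R) (A : Om -> det_alg n) :=
  forall D, mdl D -> forall O : oracle n, valid_oracle D tau O ->
    exists E : set Om, [/\ measurable E, ((1 - alpha)%:E <= P E)%E &
      forall w, E w -> exists K, outputs (A w) O K /\ (dH (supp D) K <= eps%:E)%E].

End SQDefs.

(* Main.v *)
(* Two-point method.  Let D+ and D- be uniform on two submanifolds M+ and M- which agree outside a small
   ball of mass at most tau.  Every query then has an answer which is valid for both distributions, so that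
   an algorithm cannot distinguish them; a probability of success larger than 1/2 forces 2 eps to be at
   least the distance from M- to some point of M+.

   Write n = d + e.  The manifolds are towers: flat d-dimensional discs in R^d x {y}, one over each vertex
   of a path of step 3 in a lattice of R^e, joined alternately by outer rims and by inner tunnels which are
   rotationally symmetric in the variable of R^d.  On the first disc sits a bump
   +-eta (1 - |x|^2 / delta^2)_+^3.  By symmetry the bound on the reach concerns the generating curve in the
   variables (|x|, y): at two nearest points of the curve the first-order conditions, compared with a Taylor
   expansion of the equation of the curve, are incompatible unless the distance is at least the reach.
   The volume of a tower is comparable with the number of discs times the volume of one disc.  A path
   snaking through a cube of a lattice of dimension k - d, where k realizes the minimum of the hypothesis,
   is long enough for the volume to lie between 1/fmax and 1/fmin after a dilation. *)
Require Import Defs.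
From HB Require Import structures.
From mathcomp Require Import all_boot all_order all_algebra.
From mathcomp Require Import all_classical all_reals all_analysis.
From mathcomp Require Import measurable_realfun.
From mathcomp Require Import ring lra zify.
Import Order.TTheory GRing.Theory Num.Theory.
Import numFieldNormedType.Exports.
Set Implicit Arguments.
Unset Strict Implicit.
Unset Printing Implicit Defensive.
Local Open Scope classical_set_scope.
Local Open Scope ring_scope.
(* MathComp-Analysis has an [edist] of its own, which would shadow the one of [Defs]. *)
Local Notation edist := (@Defs.edist _ _).
Local Arguments omega : simpl never.

(** * Euclidean geometry of row vectors *)

Section Euclid.
Variable R : realType.

(** The towers have reach 1 and are dilated by [s * rch] with [s >= 1]. Before the dilation the bump
    has to respect only the reach [1 / s], so that the final bump does not depend on [s]: its width
    is [rch * t], and its height of order [rch * t ^+ 2] is the most that curvature at most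
    [1 / rch] allows. Its mass is of order [fmin * rch ^+ d * t ^+ d]; keeping it below [tau]
    produces the exponent [2 / d]. Opposite bumps have equal volumes, so both uniform densities
    coincide and the distributions agree off the bump. For two points p, q nearest to z at distance
    D, one has |p - q|^2 = 2 <z - p, q - p>. As z - p is normal at p, the right side is at most 0.94
    D |p - q|^2 on a common rim, which excludes D < 1. The step 3 leaves room for rims of this shape
    and keeps unrelated pieces more than 2 apart. The Hausdorff measure of the unit ball is compared
    with [omega d] up to the factor [2 ^+ d] both ways, which the constants absorb. *)

Definition dot (n : nat) (x y : 'rV[R]_n) : R := \sum_i x 0 i * y 0 i.

Section dot_theory.
Variable n : nat.
Implicit Types (x y z : 'rV[R]_n).

Lemma dotC x y : dot x y = dot y x.
Proof. by apply: eq_bigr => i _; rewrite mulrC. Qed.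

Lemma dotDl x y z : dot (x + y) z = dot x z + dot y z.
Proof. by rewrite -big_split; apply: eq_bigr => i _; rewrite mxE mulrDl. Qed.

Lemma dotZl (a : R) x y : dot (a *: x) y = a * dot x y.
Proof. by rewrite mulr_sumr; apply: eq_bigr => i _; rewrite mxE mulrA. Qed.

Lemma dotNl x y : dot (- x) y = - dot x y.
Proof. by rewrite -scaleN1r dotZl mulN1r. Qed.

Lemma dotDr x y z : dot x (y + z) = dot x y + dot x z.
Proof. by rewrite dotC dotDl !(dotC x). Qed.

Lemma dotZr (a : R) x y : dot x (a *: y) = a * dot x y.
Proof. by rewrite dotC dotZl dotC. Qed.

Lemma dotNr x y : dot x (- y) = - dot x y.
Proof. by rewrite dotC dotNl dotC. Qed.

Lemma dot0l x : dot 0 x = 0.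
Proof. by rewrite -(scale0r x) dotZl mul0r. Qed.

Lemma dot0r x : dot x 0 = 0.
Proof. by rewrite dotC dot0l. Qed.

Definition dotE := (dotDl, dotDr, dotNl, dotNr, dotZl, dotZr, dot0l, dot0r).

Lemma dotxx_ge0 x : 0 <= dot x x.
Proof. by apply: sumr_ge0 => i _; rewrite -expr2 sqr_ge0. Qed.

Lemma enorm_sqr x : enorm x ^+ 2 = dot x x.
Proof. by rewrite sqr_sqrtr//; apply: sumr_ge0 => i _; exact: sqr_ge0. Qed.

Lemma enorm_ge0 x : 0 <= enorm x.
Proof. exact: sqrtr_ge0. Qed.

Lemma enorm_dot x : enorm x = Num.sqrt (dot x x).
Proof. by []. Qed.

Lemma sqr_coord_le x i : x 0 i ^+ 2 <= dot x x.
Proof.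
rewrite /dot (bigD1 i)//= -expr2 lerDl; apply: sumr_ge0 => j _.
by rewrite -expr2 sqr_ge0.
Qed.

Lemma coord_le_enorm x i : `|x 0 i| <= enorm x.
Proof.
by rewrite -(ler_pXn2r (n := 2))// ?nnegrE ?enorm_ge0// enorm_sqr real_normK ?num_real ?sqr_coord_le.
Qed.

Lemma enorm_eq0 x : (enorm x == 0) = (x == 0).
Proof.
apply/eqP/eqP => [x0|->].
  apply/rowP => i; rewrite mxE; apply/eqP; rewrite -normr_le0 -x0.
  exact: coord_le_enorm.
by rewrite enorm_dot dot0l sqrtr0.
Qed.

Lemma dotxx_eq0 x : (dot x x == 0) = (x == 0).
Proof. by rewrite -enorm_sqr sqrf_eq0 enorm_eq0. Qed.

Lemma enorm0 : enorm (0 : 'rV[R]_n) = 0.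
Proof. by apply/eqP; rewrite enorm_eq0. Qed.

Lemma enorm_gt0 x : (0 < enorm x) = (x != 0).
Proof. by rewrite lt0r enorm_ge0 enorm_eq0 andbT. Qed.

Lemma enormN x : enorm (- x) = enorm x.
Proof. by rewrite !enorm_dot !dotE opprK. Qed.

Lemma enormB x y : enorm (x - y) = enorm (y - x).
Proof. by rewrite -enormN opprB. Qed.

Lemma enormZ (a : R) x : enorm (a *: x) = `|a| * enorm x.
Proof. by rewrite !enorm_dot !dotE mulrA -expr2 sqrtrM ?sqr_ge0// sqrtr_sqr. Qed.

Lemma CauchySchwarz x y : dot x y <= enorm x * enorm y.
Proof.
have [->|x0] := eqVneq x 0; first by rewrite dot0l enorm0 mul0r.
have nx : 0 < enorm x by rewrite enorm_gt0.
have := dotxx_ge0 (enorm x ^+ 2 *: y - dot x y *: x).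
rewrite !dotE -!enorm_sqr (dotC y x).
set c := dot x y; set X := enorm x; set Y := enorm y => H.
have {}H : 0 <= X ^+ 2 * ((X * Y) ^+ 2 - c ^+ 2).
  by apply: le_trans H _; rewrite le_eqVlt; apply/orP; left; apply/eqP; ring.
rewrite pmulr_rge0 ?exprn_gt0// subr_ge0 in H.
have XY : 0 <= X * Y by rewrite mulr_ge0// enorm_ge0.
have [c0|c0] := ltP c 0; first exact: le_trans (ltW c0) _.
by rewrite -(ler_pXn2r (n := 2)).
Qed.

Lemma CauchySchwarz_abs x y : `|dot x y| <= enorm x * enorm y.
Proof.
rewrite ler_norml CauchySchwarz andbT lerNl -dotNl.
by rewrite -(enormN x) CauchySchwarz.
Qed.

Lemma enormD x y : enorm (x + y) <= enorm x + enorm y.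
Proof.
rewrite -(ler_pXn2r (n := 2))// ?nnegrE ?addr_ge0 ?enorm_ge0//.
rewrite enorm_sqr !dotE (dotC y x) -!enorm_sqr.
have := CauchySchwarz x y.
set X := enorm x; set Y := enorm y; set c := dot x y; nra.
Qed.

Lemma enorm_triangle z x y : enorm (x - y) <= enorm (x - z) + enorm (z - y).
Proof. by apply: le_trans (enormD _ _); rewrite addrA subrK. Qed.

Lemma enorm_dist x y : `|enorm x - enorm y| <= enorm (x - y).
Proof.
rewrite ler_norml; apply/andP; split.
  rewrite lerBrDl lerBlDr enormB; apply: le_trans (enormD _ _); by rewrite addrC subrK.
by rewrite lerBlDr; apply: le_trans (enormD _ _); rewrite subrK.
Qed.

Lemma dotBB x y : dot (x - y) (x - y) = dot x x + dot y y - 2 * dot x y.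
Proof. by rewrite !dotE (dotC y x); ring. Qed.

Lemma mxnorm_le_enorm x : `|x| <= enorm x.
Proof.
rewrite /Num.Def.normr/= mx_normrE bigmax_le ?enorm_ge0// => -[i j] _ /=.
by rewrite ord1 coord_le_enorm.
Qed.

Lemma enorm_le_mxnorm x : enorm x <= n%:R * `|x|.
Proof.
have cx i : `|x 0 i| <= `|x|.
  by rewrite [leRHS]/Num.Def.normr/= mx_normrE (le_bigmax _ _ (0, i)).
rewrite -(ler_pXn2r (n := 2))// ?nnegrE ?mulr_ge0 ?enorm_ge0//.
rewrite enorm_sqr exprMn.
have -> : (n%:R : R) ^+ 2 * `|x| ^+ 2 = n%:R * (\sum_(i < n) `|x| ^+ 2).
  by rewrite sumr_const card_ord -mulr_natl; ring.
rewrite /dot mulr_sumr; apply: ler_sum => i _.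
rewrite -expr2 -real_normK ?num_real//.
have n1 : 1 <= n%:R :> R by rewrite ler1n; case: i => [[]]; case: (n).
apply: (@le_trans _ _ (`|x| ^+ 2)); first by rewrite ler_pXn2r// nnegrE.
by rewrite ler_peMl// sqr_ge0.
Qed.

(** The topology of row vectors comes from the max-norm, while every metric notion of the statement
    is Euclidean. The two inequalities between the norms make the passage. *)
Lemma nbhs_enorm x (A : set 'rV[R]_n) :
  nbhs x A <-> exists2 r, 0 < r & forall y, enorm (y - x) < r -> A y.
Proof.
split.
- move=> /nbhs_ballP[r /= r0 rA]; exists r => // y yr; apply: rA.
  by rewrite -ball_normE /= (le_lt_trans (mxnorm_le_enorm _))// enormB.
- move=> [r r0 rA]; apply/nbhs_ballP; exists (r / n.+1%:R) => /=; first by rewrite divr_gt0.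
  move=> y; rewrite -ball_normE /= => xy; apply: rA; rewrite enormB (le_lt_trans (enorm_le_mxnorm _))//.
  apply: (@le_lt_trans _ _ (n%:R * (r / n.+1%:R))).
    by rewrite ler_wpM2l// ltW.
  by rewrite mulrCA gtr_pMr// ltr_pdivrMr// mul1r ltr_nat.
Qed.

Lemma continuous_enorm : continuous (@enorm R n).
Proof.
move=> x A /nbhs_ballP[r /= r0 rA]; apply/nbhs_enorm; exists r => // y xy.
by apply: rA; rewrite -ball_normE /= distrC (le_lt_trans (enorm_dist _ _)).
Qed.

Lemma open_enormP (A : set 'rV[R]_n) :
  open A <-> forall x, A x -> exists2 r, 0 < r & forall y, enorm (y - x) < r -> A y.
Proof.
rewrite openE; split => [oA x Ax|H x Ax]; last by apply/nbhs_enorm; exact: H.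
by have := oA x Ax => /nbhs_enorm.
Qed.

End dot_theory.

Lemma lipschitz_continuous (n m : nat) (k : R) (f : 'rV[R]_n -> 'rV[R]_m) :
  (forall x y, enorm (f x - f y) <= k * enorm (x - y)) -> continuous f.
Proof.
move=> fk x A /nbhs_enorm[r r0 rA]; apply/nbhs_enorm.
have k0 : 0 < `|k| + 1 by rewrite ltr_wpDl.
exists (r / (`|k| + 1)); first by rewrite divr_gt0.
move=> y; rewrite ltr_pdivlMr// => xy; apply: rA.
apply: le_lt_trans xy; apply: le_trans (fk _ _) _.
rewrite mulrC ler_wpM2l ?enorm_ge0//; apply: le_trans (ler_norm _) _.
by rewrite lerDl.
Qed.

Lemma lipschitzR_continuous (n : nat) (k : R) (f : 'rV[R]_n -> R) :
  (forall x y, `|f x - f y| <= k * enorm (x - y)) -> continuous f.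
Proof.
move=> fk x A /nbhs_ballP[r /= r0 rA]; apply/nbhs_enorm.
have k0 : 0 < `|k| + 1 by rewrite ltr_wpDl.
exists (r / (`|k| + 1)); first by rewrite divr_gt0.
move=> y; rewrite ltr_pdivlMr// => xy; apply: rA; rewrite -ball_normE /= distrC.
apply: le_lt_trans xy; apply: le_trans (fk _ _) _.
rewrite mulrC ler_wpM2l ?enorm_ge0//; apply: le_trans (ler_norm _) _.
by rewrite lerDl.
Qed.

Lemma continuous_edist (n : nat) (x : 'rV[R]_n) : continuous (fun z : 'rV[R]_n => enorm (z - x)).
Proof.
apply: (@lipschitzR_continuous _ 1) => y z; rewrite mul1r.
by apply: le_trans (enorm_dist _ _) _; rewrite opprB addrA subrK.
Qed.

Lemma dot_row_mx (d e : nat) (x x' : 'rV[R]_d) (y y' : 'rV[R]_e) :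
  dot (row_mx x y) (row_mx x' y') = dot x x' + dot y y'.
Proof.
rewrite /dot big_split_ord /=; congr (_ + _); apply: eq_bigr => i _.
  by rewrite !row_mxEl.
by rewrite !row_mxEr.
Qed.

Lemma enorm_row_mx (d e : nat) (x : 'rV[R]_d) (y : 'rV[R]_e) :
  enorm (row_mx x y) ^+ 2 = enorm x ^+ 2 + enorm y ^+ 2.
Proof. by rewrite !enorm_sqr dot_row_mx. Qed.

Lemma row_mxB (d e : nat) (x x' : 'rV[R]_d) (y y' : 'rV[R]_e) :
  row_mx x y - row_mx x' y' = row_mx (x - x') (y - y').
Proof. by rewrite opp_row_mx add_row_mx. Qed.

Lemma enorm_row_mxl (d e : nat) (x : 'rV[R]_d) (y : 'rV[R]_e) :
  enorm x <= enorm (row_mx x y).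
Proof.
by rewrite -(ler_pXn2r (n := 2))// ?nnegrE ?enorm_ge0// enorm_row_mx lerDl sqr_ge0.
Qed.

Lemma enorm_row_mxr (d e : nat) (x : 'rV[R]_d) (y : 'rV[R]_e) :
  enorm y <= enorm (row_mx x y).
Proof.
by rewrite -(ler_pXn2r (n := 2))// ?nnegrE ?enorm_ge0// enorm_row_mx lerDr sqr_ge0.
Qed.

End Euclid.

(** * Hausdorff measure *)

Section HausdorffMeasure.
Variable R : realType.

Lemma omega_gt0 k : 0 < omega R k.
Proof.
elim/ltn_ind: k => -[|[|k]] IH//=.
by rewrite mulr_gt0 ?IH// divr_gt0// mulr_gt0// pi_gt0.
Qed.

Section fixed_dims.
Variables n d0 : nat.
Local Notation d := d0.+1.
Local Notation E := 'rV[R]_n.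
Implicit Types (A B F : set E) (C : nat -> set E) (r : nat -> R).

(** The dimension is written [d0.+1] because in positive dimension a set of radius 0 costs nothing:
    finite covers are padded, and useless sets of a cover discarded, by giving them radius 0. *)
Definition gauge (x : R) : \bar R := (omega R d * (x / 2) ^+ d)%:E.

Lemma gauge_ge0 x : 0 <= x -> (0 <= gauge x)%E.
Proof. by move=> x0; rewrite lee_fin mulr_ge0 ?(ltW (omega_gt0 _))// exprn_ge0// divr_ge0. Qed.

Lemma gauge0 : gauge 0 = 0%E.
Proof. by rewrite /gauge mul0r expr0n/= mulr0. Qed.

Definition diam_le (D : set E) (s : R) := forall x y, D x -> D y -> enorm (x - y) <= s.

Definition small_cover (delta : R) A C r :=
  A `<=` \bigcup_i C i /\ forall i, 0 <= r i <= delta /\ diam_le (C i) (r i).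

Local Notation Hd := (@Hdelta R n d).
Local Notation H := (@hausdorff R n d).

Lemma Hdelta_le_cover delta A C r : small_cover delta A C r ->
  (Hd delta A <= \sum_(0 <= i <oo) gauge (r i))%E.
Proof. by move=> [AC Cr]; apply: ereal_inf_lbound; exists r => //; exists C. Qed.

Lemma le_Hdelta_covers delta A (x : \bar R) :
  (forall C r, small_cover delta A C r -> (x <= \sum_(0 <= i <oo) gauge (r i))%E) ->
  (x <= Hd delta A)%E.
Proof.
by move=> h; apply: le_ereal_inf_tmp => _ [r [C [AC Cr]] <-]; apply: (h C r).
Qed.

Lemma Hdelta_near_cover delta A (e : R) : 0 < e -> (Hd delta A < +oo)%E ->
  exists C r, small_cover delta A C r /\
    (\sum_(0 <= i <oo) gauge (r i) <= Hd delta A + e%:E)%E.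
Proof.
move=> e0 Afin.
have A0 : (0 <= Hd delta A)%E.
  apply: le_Hdelta_covers => C r [_ Cr]; apply: nneseries_ge0 => i _ _.
  by apply: gauge_ge0; case: (Cr i) => /andP[].
have /(lb_ereal_inf_adherent e0)[_ [r [C [AC Cr]] <-] h] :
    Hd delta A \is a fin_num by rewrite ge0_fin_numE.
by exists C, r; split; [split|apply: ltW].
Qed.

Lemma Hdelta_ge0 delta A : (0 <= Hd delta A)%E.
Proof.
apply: le_Hdelta_covers => C r [_ Cr]; apply: nneseries_ge0 => i _ _.
by apply: gauge_ge0; case: (Cr i) => /andP[].
Qed.

Lemma le_HdeltaS delta A B : A `<=` B -> (Hd delta A <= Hd delta B)%E.
Proof.
move=> AB; apply: le_Hdelta_covers => C r [BC Cr]; apply: (@Hdelta_le_cover _ _ C).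
by split=> //; apply: subset_trans BC.
Qed.

Lemma le_Hdelta delta delta' A : delta <= delta' -> (Hd delta' A <= Hd delta A)%E.
Proof.
move=> dd; apply: le_Hdelta_covers => C r [AC Cr]; apply: (@Hdelta_le_cover _ _ C).
split=> // i; have [/andP[-> ri] ?] := Cr i; split => //=; exact: le_trans dd.
Qed.

Lemma Hdelta0 delta : 0 < delta -> Hd delta set0 = 0%E.
Proof.
move=> dpos; apply/eqP; rewrite eq_le Hdelta_ge0 andbT.
apply: (@le_trans _ _ (\sum_(0 <= i <oo) gauge ((fun=> 0%R) i))%E).
  apply: (@Hdelta_le_cover _ _ (fun=> set0)); split=> [//|i].
  by rewrite lexx (ltW dpos); split=> // x y [].
by rewrite eseries0// => i _ _; rewrite gauge0.
Qed.

(** Covers that are optimal up to [e / 2 ^ k.+1] are merged into a single sequence by an enumeration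
    of [nat * nat]. *)
Lemma Hdelta_sigma_subadditive delta (A : nat -> set E) :
  (Hd delta (\bigcup_k A k) <= \sum_(0 <= k <oo) Hd delta (A k))%E.
Proof.
have [[i ioo]|] := pselect (exists i, Hd delta (A i) = +oo%E).
  by rewrite (eseries_pinfty _ _ ioo) ?leey// => k _; rewrite -ltNye (lt_le_trans _ (Hdelta_ge0 _ _)).
rewrite -forallNE => Aoo.
apply/lee_addgt0Pr => e e0.
rewrite (le_trans _ (epsilon_trick _ _ _))//; last 2 first.
- by move=> k; exact: Hdelta_ge0.
- exact: ltW.
have [G PG] : {G : nat -> (nat -> set E) * (nat -> R) & forall k,
    small_cover delta (A k) (G k).1 (G k).2 /\
    (\sum_(0 <= i <oo) gauge ((G k).2 i) <= Hd delta (A k) + (e / (2 ^ k.+1)%:R)%:E)%E}.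
  apply: (@choice _ _ (fun k (G : (nat -> set E) * (nat -> R)) =>
    small_cover delta (A k) G.1 G.2 /\
    (\sum_(0 <= i <oo) gauge (G.2 i) <= Hd delta (A k) + (e / (2 ^ k.+1)%:R)%:E)%E)) => k.
  have [] := @Hdelta_near_cover delta (A k) (e / (2 ^ k.+1)%:R).
  - by rewrite divr_gt0.
  - by rewrite ltey; apply/eqP.
  - by move=> C [r Cr]; exists (C, r).
pose w (ij : nat * nat) := gauge ((G ij.1).2 ij.2).
have w0 ij : (0 <= w ij)%E.
  by apply: gauge_ge0; have [[_ /(_ ij.2)[/andP[]]]] := PG ij.1.
apply: (@le_trans _ _ (\esum_(i in setT) w i)).
  have /card_esym/ppcard_eqP[f] := card_nat2.
  have -> : \esum_(i in setT) w i = (\sum_(0 <= i <oo) w (f i))%E.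
    by rewrite nneseries_esumT//; apply: reindex_esum; exact: 'bij_f.
  apply: (@Hdelta_le_cover _ _ (fun i => (G (f i).1).1 (f i).2)); split; last first.
    by move=> i; have [[_ /(_ (f i).2)]] := PG (f i).1.
  move=> x [k _ Akx]; have [[/(_ _ Akx)[j _ Cx] _] _] := PG k.
  by exists (f^-1%FUN (k, j)) => //=; rewrite invK ?inE.
rewrite (_ : esum _ _ = \sum_(0 <= i <oo) \sum_(0 <= j <oo ) w (i, j))%E; last first.
  pose J : nat -> set (nat * nat) := fun i => [set (i, j) | j in setT].
  rewrite (_ : setT = \bigcup_k J k); last first.
    by rewrite predeqE => -[a b]; split => // _; exists a => //; exists b.
  rewrite esum_bigcupT /=; last 2 first.
  - apply/trivIsetP => i j _ _ ij; rewrite predeqE => -[k m] /=; split => //=.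
    by move=> [] [_] _ [<-{k} _] [m' _] [] /esym/eqP; rewrite (negbTE ij).
  - by move=> x; exact: w0.
  rewrite nneseries_esumT; last by move=> *; exact: nneseries_ge0.
  apply: eq_esum => j _; rewrite nneseries_esumT//.
  rewrite (@reindex_esum _ _ _ setT (J j) (pair j))//.
  by split=> [i _|i k _ _ [] //|_ [k _ <-]]; [by exists i|by exists k].
apply: lee_nneseries => k _; first by move=> *; exact: nneseries_ge0.
exact: (PG k).2.
Qed.

Lemma hausdorff_ge_Hdelta delta A : 0 < delta -> (Hd delta A <= H A)%E.
Proof. by move=> dpos; apply: ereal_sup_ubound; exists delta. Qed.

Lemma hausdorff_le A (x : \bar R) :
  (forall delta, 0 < delta -> (Hd delta A <= x)%E) -> (H A <= x)%E.
Proof. by move=> h; apply: ge_ereal_sup => _ [delta dpos <-]; apply: h. Qed.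

Lemma hausdorff_ge0 A : (0 <= H A)%E.
Proof. exact: le_trans (Hdelta_ge0 1 A) (hausdorff_ge_Hdelta _ _). Qed.

Lemma hausdorff0 : H set0 = 0%E.
Proof.
apply/eqP; rewrite eq_le hausdorff_ge0 andbT; apply: hausdorff_le => delta dpos.
by rewrite Hdelta0.
Qed.

Lemma le_hausdorff : {homo H : A B / A `<=` B >-> (A <= B)%E}.
Proof.
move=> A B AB; apply: hausdorff_le => delta dpos.
exact: le_trans (le_HdeltaS _ AB) (hausdorff_ge_Hdelta _ _).
Qed.

Lemma hausdorff_sigma_subadditive : sigma_subadditive H.
Proof.
move=> A; apply: hausdorff_le => delta dpos.
apply: le_trans (Hdelta_sigma_subadditive _ _) _; apply: lee_nneseries => k _.
  by move=> *; exact: Hdelta_ge0.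
exact: hausdorff_ge_Hdelta.
Qed.

(** The two measures on the left are suprema over independent scales. Since [Hdelta] decreases in
    [delta], a common scale below both dominates the pair. *)
Lemma hausdorff_limit_add A B (c : \bar R) (s : R) : 0 < s ->
  (forall delta, 0 < delta -> delta <= s -> (Hd delta A + Hd delta B <= c)%E) ->
  (H A + H B <= c)%E.
Proof.
move=> s0 h.
have h2 d1 d2 : 0 < d1 -> 0 < d2 -> (Hd d1 A + Hd d2 B <= c)%E.
  move=> d10 d20; pose dm := Num.min s (Num.min d1 d2).
  have dm0 : 0 < dm by rewrite !lt_min s0 d10.
  apply: le_trans (h dm dm0 _); last by rewrite ge_min lexx.
  by apply: leeD; apply: le_Hdelta; rewrite !ge_min lexx ?orbT.
have [->|coo] := eqVneq c +oo%E; first by rewrite leey.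
have fin1 d1 : 0 < d1 -> Hd d1 A \is a fin_num.
  move=> d10; rewrite ge0_fin_numE ?Hdelta_ge0//.
  apply: le_lt_trans (_ : (c < +oo)%E); last by rewrite ltey.
  by apply: le_trans (h2 _ _ d10 ltr01); rewrite leeDl// Hdelta_ge0.
have hB d1 : 0 < d1 -> (H B <= c - Hd d1 A)%E.
  move=> d10; apply: hausdorff_le => d2 d20.
  by rewrite leeBrDl ?fin1//; apply: h2.
have finB : H B \is a fin_num.
  rewrite ge0_fin_numE ?hausdorff_ge0//; apply: le_lt_trans (hB _ ltr01) _.
  have [x ->] : exists x, Hd 1 A = x%:E by exists (fine (Hd 1 A)); rewrite fineK// fin1.
  by case: (c) coo => //= y _; rewrite ltry.
rewrite -leeBrDr//; apply: hausdorff_le => d1 d10.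
by rewrite leeBrDr// -leeBrDl ?fin1//; apply: hB.
Qed.

(** A set of diameter less than [s] cannot meet both [A] and [B], so a fine cover of the union
    splits into a cover of each. *)
Lemma hausdorff_metric A B (s : R) : 0 < s ->
  (forall x y, A x -> B y -> s <= enorm (x - y)) ->
  (H A + H B <= H (A `|` B))%E.
Proof.
move=> s0 sAB; apply: (@hausdorff_limit_add _ _ _ (s / 2)); first by rewrite divr_gt0.
move=> delta dpos ds; apply: le_trans (hausdorff_ge_Hdelta _ dpos).
apply: le_Hdelta_covers => C r [ABC Cr].
have rge0 i : 0 <= r i by have [/andP[]] := Cr i.
(* The radii of the cover restricted to [D]: a set that misses [D] gets radius 0 and no longer
   counts. *)
pose rr (D : set E) i := if `[< C i `&` D !=set0 >] then r i else 0.
have rr_cover D : D `<=` A `|` B -> small_cover delta D (fun i => C i `&` D) (rr D).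
  move=> DAB; split.
    by move=> x Dx; have [i _ Cx] := ABC _ (DAB _ Dx); exists i.
  move=> i; rewrite /rr; have [CD|nCD] := pselect (C i `&` D !=set0).
    rewrite (asboolT CD); have [? Ci] := Cr i; split=> // x y [Cx _] [Cy _].
    exact: Ci.
  rewrite (asboolF nCD) lexx (ltW dpos); split=> // x y Dx.
  by exfalso; apply: nCD; exists x.
apply: le_trans (leeD (Hdelta_le_cover (rr_cover A _)) (Hdelta_le_cover (rr_cover B _))) _.
- by left.
- by right.
have rr0 D i : 0 <= rr D i by rewrite /rr; case: ifP.
rewrite -nneseriesD; last 2 first.
- by move=> i _ _; apply: gauge_ge0.
- by move=> i _ _; apply: gauge_ge0.
apply: lee_nneseries => i _; first by move=> _; rewrite adde_ge0// gauge_ge0.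
rewrite /rr; case: ifPn => /asboolP hA; case: ifPn => /asboolP hB;
  rewrite ?gauge0 ?adde0 ?add0e ?gauge_ge0//.
exfalso; move: hA hB => [x [Cx Ax]] [y [Cy By]].
have [/andP[_ rd] /(_ _ _ Cx Cy) xy] := Cr i.
have := le_trans (sAB _ _ Ax By) xy; lra.
Qed.

End fixed_dims.

HB.instance Definition _ n d0 := isOuterMeasure.Build R 'rV[R]_n
  (@hausdorff R n d0.+1) (hausdorff0 n d0) (@hausdorff_ge0 n d0)
  (@le_hausdorff n d0) (@hausdorff_sigma_subadditive n d0).

End HausdorffMeasure.

(** * Borel sets are measurable for the Hausdorff measure *)

Section HausdorffBorel.
Variables (R : realType) (n d0 : nat).
Local Notation d := d0.+1.
Local Notation E := 'rV[R]_n.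
Local Notation Hd := (@Hdelta R n d).
Local Notation H := (@hausdorff R n d).
Implicit Types (A B F X : set E).

(** Caratheodory's criterion for metric outer measures. [far k] is at distance at least [1 / k.+1]
    from [F], hence additive with [X] intersected with [F]. What remains of [X] off [F] is a union
    of layers [ring], whose measures form a convergent series with arbitrarily small tails. *)
Lemma closed_caratheodory F : closed F -> H.-caratheodory F.
Proof.
move=> cF; apply: le_caratheodory_measurable => X.
change (H (X `&` F) + H (X `&` ~` F) <= H X)%E.
have [->|Xoo] := eqVneq (H X) +oo%E; first by rewrite leey.
have Xfin : (H X < +oo)%E by rewrite ltey.
pose far k := X `&` [set x | forall y, F y -> k.+1%:R^-1 <= enorm (x - y)].
pose ring k := far k.+1 `\` far k.
have farS k : far k `<=` far k.+1.
  move=> x [Xx xF]; split=> // y Fy; apply: le_trans (xF y Fy).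
  by rewrite lef_pV2 ?posrE// ler_nat.
have subset_farS j i : (j <= i)%N -> far j `<=` far i.
  move=> /subnK <-; elim: (i - j)%N => // k IH.
  exact: subset_trans IH (farS _).
have far_ring k x y : far k x -> ring k.+1 y ->
    k.+1%:R^-1 - k.+2%:R^-1 <= enorm (x - y).
  move=> [_ xF] [[Xy _] ynF].
  have [z Fz yz] : exists2 z, F z & enorm (y - z) < k.+2%:R^-1.
    apply: contrapT => /forall2NP h; apply: ynF; split=> // z Fz.
    by have [//|/negP] := h z; rewrite -leNgt.
  rewrite lerBlDr; apply: le_trans (xF z Fz) _; apply: le_trans (enorm_triangle y _ _) _.
  by rewrite lerD2l ltW.
(* Layers of one parity are at positive distance from each other, so that the sum over them stays
   below [H X]. Both parities together bound the series by [H X + H X]. *)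
have sum_ring q N : (\sum_(i < N) H (ring (i.*2 + q).+1) <= H (far (N.*2 + q)%N))%E.
  elim: N => [|N IH]; first by rewrite big_ord0 hausdorff_ge0.
  rewrite big_ord_recr/=.
  apply: (@le_trans _ _ (H (far (N.*2 + q)%N) + H (ring (N.*2 + q).+1))%E); first exact: leeD.
  set m := (N.*2 + q)%N.
  apply: (@le_trans _ _ (H (far m `|` ring m.+1))).
    apply: (@hausdorff_metric _ _ _ _ _ (m.+1%:R^-1 - m.+2%:R^-1)).
      by rewrite subr_gt0 ltf_pV2 ?posrE// ltr_nat.
    by move=> x y; apply: far_ring.
  apply: le_hausdorff => x [fx|[fx _]]; rewrite doubleS !addSn//.
  by apply: (subset_farS m) => //; lia.
have farX k : (H (far k) <= H X)%E by apply: le_hausdorff => x [].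
have sum_all N : (\sum_(0 <= i < N) H (ring i.+1) <= H X + H X)%E.
  apply: (@le_trans _ _ (\sum_(0 <= i < N.*2) H (ring i.+1))%E).
    apply: lee_sum_nneg_natr => [i _ _|]; first exact: hausdorff_ge0.
    by rewrite -addnn leq_addr.
  apply: le_trans (leeD (le_trans (sum_ring 0%N N) (farX _)) (le_trans (sum_ring 1%N N) (farX _))).
  rewrite le_eqVlt; apply/orP; left; apply/eqP; rewrite -big_split/=.
  elim: N => [|N IH]; first by rewrite big_geq// big_ord0.
  by rewrite doubleS !big_nat_recr//= big_ord_recr/= IH -addeA addn0 addn1.
have sum_fin : (\sum_(0 <= i <oo) H (ring i.+1) < +oo)%E.
  apply: (@le_lt_trans _ _ (H X + H X)%E); last by rewrite lte_add_pinfty.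
  by apply: lime_le; [apply: is_cvg_nneseries => *; exact: hausdorff_ge0|near=> N; exact: sum_all].
have tail := nneseries_tail_cvg sum_fin (fun k _ => hausdorff_ge0 _ _).
apply/lee_addgt0Pr => e e0.
have [k tailk] : exists k, (\sum_(k <= i <oo) H (ring i.+1) <= e%:E)%E.
  have /(_ [set x | (x < e%:E)%E]) := tail.
  case=> [|k _ hk]; last by exists k; apply: ltW; apply: hk => /=.
  by apply: open_nbhs_nbhs; split=> //=; exact: open_ereal_lt_ereal.
(* As [F] is closed, a point off [F] lies in some [far m]; the least such [m] tells in which layer
   it falls. *)
have XF : X `&` ~` F `<=` far k.+1 `|` \bigcup_(j in ~` `I_k) ring j.+1.
  move=> x [Xx nFx].
  have [m fm] : exists m, far m x.
    have /open_enormP/(_ x nFx)[r r0 rF] : open (~` F) by exact: closed_openC.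
    have [m mr] : exists m, m.+1%:R^-1 < r :> R.
      have [m _ hm] := near_infty_natSinv_lt (PosNum r0).
      by exists m; apply: (hm m) => /=.
    exists m; split=> // y Fy; rewrite leNgt; apply/negP => xy.
    by apply: (rF y) => //; rewrite enormB (lt_trans xy).
  have exm : exists m, `[< far m x >] by exists m; apply/asboolP.
  case: (ex_minnP exm) => -[|j] /asboolP fj minj.
    by left; apply: (subset_farS 0%N).
  have [jk|kj] := leqP j k; first by left; apply: subset_farS fj.
  right; case: j => [//|j] in fj minj kj *; exists j => //=.
    by apply/negP; rewrite -leqNgt -ltnS.
  by split=> // fj1; have := minj j.+1; rewrite ltnn => h; have := h (asboolT fj1).
apply: (@le_trans _ _ (H (X `&` F) + (H (far k.+1) + \sum_(k <= i <oo) H (ring i.+1)))%E).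
  apply: leeD => //.
  apply: (@le_trans _ _ (H (far k.+1 `|` \bigcup_(j in ~` `I_k) ring j.+1))).
    exact: le_hausdorff.
  apply: le_trans (outer_measureU2 (@hausdorff R n d) _ _) _; apply: leeD => //.
  exact: (@outer_measure_sigma_subadditive_tail _ _ (@hausdorff R n d) k (fun j => ring j.+1)).
rewrite addeA; apply: leeD => //.
apply: (@le_trans _ _ (H (X `&` F `|` far k.+1))); last first.
  by apply: le_hausdorff => x [[]|[]].
apply: (@hausdorff_metric _ _ _ _ _ k.+2%:R^-1); first by rewrite invr_gt0.
by move=> x y [_ Fx] [_ yF]; rewrite enormB; apply: yF.
Unshelve. all: end_near. Qed.

Lemma borel_caratheodory (A : set (borelR R n)) : measurable A -> H.-caratheodory A.
Proof.
apply: smallest_sub => [|O oO].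
  split=> [|B cB|F cF].
  - exact: (caratheodory_measurable_set0 (@hausdorff R n d)).
  - rewrite setTD; exact: (caratheodory_measurable_setC (mu := @hausdorff R n d)).
  - exact: (caratheodory_measurable_bigcup (mu := @hausdorff R n d)).
rewrite -(setCK O); apply: (caratheodory_measurable_setC (mu := @hausdorff R n d)).
by apply: closed_caratheodory; apply: open_closedC.
Qed.

Definition hmeasure (A : set (borelR R n)) : \bar R := hausdorff d A.

Let hmeasure0 : hmeasure set0 = 0%E. Proof. exact: hausdorff0. Qed.
Let hmeasure_ge0 A : (0 <= hmeasure A)%E. Proof. exact: hausdorff_ge0. Qed.
Let hmeasure_sigma_additive : semi_sigma_additive hmeasure.
Proof.
move=> F mF tF mU.
exact: (@caratheodory_measure_sigma_additive R _ (@hausdorff R n d) F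
  (fun i => borel_caratheodory (mF i)) tF (borel_caratheodory mU)).
Qed.

HB.instance Definition _ := isMeasure.Build _ (borelR R n) R hmeasure
  hmeasure0 hmeasure_ge0 hmeasure_sigma_additive.

End HausdorffBorel.

(** * Comparison of Hausdorff measures through expanding maps and through counting *)

Section HausdorffMaps.
Variable R : realType.

Lemma open_borel n (A : set (borelR R n)) : open (A : set 'rV[R]_n) -> measurable A.
Proof. exact: sub_sigma_algebra. Qed.

Lemma closed_borel n (A : set (borelR R n)) : closed (A : set 'rV[R]_n) -> measurable A.
Proof.
by move=> cA; rewrite -(setCK A); apply: measurableC; apply: open_borel; apply: closed_openC.
Qed.

Lemma gaugeZ d0 (k x : R) : gauge d0 (k * x) = ((k ^+ d0.+1)%:E * gauge d0 x)%E.
Proof. by rewrite /gauge -EFinM -mulrA exprMn mulrCA. Qed.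

(** Pull back a cover of [B] along [T]: the preimages meet [A] in sets whose diameters are at most
    [k] times larger. The volume comparisons of balls, dilations, rims and bumps below use this
    form, with [T] a projection, a lift or an unrolling. *)
Lemma hausdorff_expand n1 n2 d0 (k : R) (T : 'rV[R]_n1 -> 'rV[R]_n2)
    (A : set 'rV[R]_n1) (B : set 'rV[R]_n2) :
  0 < k -> (forall x, A x -> B (T x)) ->
  (forall x y, A x -> A y -> enorm (x - y) <= k * enorm (T x - T y)) ->
  (hausdorff d0.+1 A <= (k ^+ d0.+1)%:E * hausdorff d0.+1 B)%E.
Proof.
move=> k0 TAB kT; apply: hausdorff_le => delta dpos.
have kd0 : 0 < k ^+ d0.+1 by rewrite exprn_gt0.
apply: (@le_trans _ _ ((k ^+ d0.+1)%:E * Hdelta d0.+1 (delta / k) B)%E); last first.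
  by apply: lee_wpmul2l; [rewrite lee_fin ltW|apply: hausdorff_ge_Hdelta; rewrite divr_gt0].
rewrite -lee_pdivrMl//; apply: le_Hdelta_covers => C r [BC Cr].
rewrite lee_pdivrMl// -nneseriesZl//; last first.
  by move=> i _; apply: gauge_ge0; case: (Cr i) => /andP[].
under eq_eseriesr do rewrite -gaugeZ.
apply: (@Hdelta_le_cover _ _ _ _ _ (fun i => A `&` T @^-1` C i) (fun i => k * r i)); split.
  by move=> x Ax; have [i _ Ci] := BC _ (TAB _ Ax); exists i.
move=> i; have [/andP[r0 rd] Ci] := Cr i; split.
  by rewrite mulr_ge0 ?(ltW k0)//= mulrC -ler_pdivlMr.
move=> x y [Ax Cx] [Ay Cy]; apply: le_trans (kT _ _ Ax Ay) _.
by rewrite ler_pM2l//; apply: Ci.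
Qed.

Lemma hausdorff_isometry n1 n2 d0 (T : 'rV[R]_n1 -> 'rV[R]_n2)
    (A : set 'rV[R]_n1) (B : set 'rV[R]_n2) :
  (forall x, A x -> B (T x)) ->
  (forall x y, A x -> A y -> enorm (x - y) <= enorm (T x - T y)) ->
  (hausdorff d0.+1 A <= hausdorff d0.+1 B)%E.
Proof.
move=> TAB kT; have := @hausdorff_expand _ _ d0 1 T A B ltr01 TAB.
by rewrite expr1n mul1e; apply=> x y Ax Ay; rewrite mul1r; exact: kT.
Qed.

Lemma hausdorff_finite_cover n d0 (A : set 'rV[R]_n) (s0 c : R) :
  0 <= c -> 0 < s0 ->
  (forall s, 0 < s -> s <= s0 -> exists (I : finType) (C : I -> set 'rV[R]_n),
     [/\ A `<=` \bigcup_i C i, (forall i, diam_le (C i) s) & #|I|%:R * s ^+ d0.+1 <= c]) ->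
  (hausdorff d0.+1 A <= (omega R d0.+1 / 2 ^+ d0.+1 * c)%:E)%E.
Proof.
move=> c0 s00 h; apply: hausdorff_le => delta' dpos'.
pose delta := Num.min delta' s0.
have dpos : 0 < delta by rewrite lt_min dpos'.
apply: (@le_trans _ _ (Hdelta d0.+1 delta A)); first by rewrite le_Hdelta// ge_min lexx.
have [|I [C [AC Cs Ic]]] := h delta dpos; first by rewrite ge_min lexx orbT.
(* A finite cover becomes a sequence by adding empty sets of radius 0. *)
pose CC k := oapp (fun i : 'I_#|I| => C (enum_val i)) set0 (insub k).
pose r k := if (k < #|I|)%N then delta else 0.
apply: (@le_trans _ _ (\sum_(0 <= k <oo) gauge d0 (r k))%E).
  apply: (@Hdelta_le_cover _ _ _ _ _ CC); split.
    move=> x /AC[i _ Cx]; exists (enum_rank i) => //.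
    by rewrite /CC valK/= enum_rankK.
  move=> k; rewrite /r /CC; case: ltnP => kI.
    by rewrite insubT/= lexx (ltW dpos); split=> //; exact: Cs.
  by rewrite insubF ?lexx ?(ltW dpos)//=; [split|rewrite ltnNge kI].
rewrite (nneseries_split 0 #|I|); last first.
  by move=> k _; apply: gauge_ge0; rewrite /r; case: ifP => // _; exact: ltW.
rewrite add0n [X in (_ + X)%E]eseries0; last first.
  by move=> k kI _; rewrite /r ltnNge kI/= gauge0.
rewrite adde0 big_mkord (eq_bigr (fun=> gauge d0 delta)); last by move=> i _; rewrite /r ltn_ord.
rewrite sumEFin sumr_const card_ord lee_fin -[leLHS]mulr_natl [(delta / 2) ^+ _]expr_div_n.
rewrite [leLHS](_ : _ = omega R d0.+1 / 2 ^+ d0.+1 * (#|I|%:R * delta ^+ d0.+1)); last by ring.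
by rewrite ler_wpM2l// divr_ge0 ?(ltW (omega_gt0 _ _))// exprn_ge0.
Qed.

End HausdorffMaps.

(** * Hausdorff measure of balls *)

Section BallMeasure.
Variables (R : realType) (d0 : nat).
Local Notation d := d0.+1.
Local Notation E := 'rV[R]_d.
Local Notation H := (@hausdorff R d d).
Local Notation kappa := (omega R d / 2 ^+ d).
Implicit Types (s t : R).

Lemma kappa_gt0 : 0 < kappa.
Proof. by rewrite divr_gt0 ?omega_gt0// exprn_gt0. Qed.

Lemma gaugeE s : gauge d0 s = (kappa * s ^+ d)%:E.
Proof. by rewrite /gauge expr_div_n mulrA mulrAC. Qed.

Lemma eball_borel n (x : 'rV[R]_n) s : measurable (eball x s : set (borelR R n)).
Proof.
apply: closed_borel.
have c := @continuous_edist R n x.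
have -> : eball x s = (fun z : 'rV[R]_n => enorm (z - x)) @^-1` [set t | t <= s] by [].
by apply: closed_comp => //; exact: closed_le.
Qed.

Lemma hausdorff_ball_le (x : E) s : 0 < s -> (H (eball x s) <= (s ^+ d)%:E * H (eball (0 : E) 1))%E.
Proof.
move=> s0; apply: (@hausdorff_expand _ _ _ _ s (fun y => s^-1 *: (y - x))) => //.
  move=> y; rewrite /eball/= subr0 enormZ ger0_norm ?invr_ge0 ?(ltW s0)//.
  by rewrite ler_pdivrMl// mulr1.
move=> y z _ _; rewrite -scalerBr enormZ ger0_norm ?invr_ge0 ?(ltW s0)//.
by rewrite mulVKf ?gt_eqF// opprB addrA subrK.
Qed.

Lemma hausdorff_ball_ge (x : E) s : 0 < s -> ((s ^+ d)%:E * H (eball (0 : E) 1) <= H (eball x s))%E.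
Proof.
move=> s0; rewrite -lee_pdivlMl ?exprn_gt0// -exprVn.
apply: (@hausdorff_expand _ _ _ _ s^-1 (fun y => s *: y + x)); first by rewrite invr_gt0.
  move=> y; rewrite /eball/= subr0 addrK enormZ ger0_norm ?(ltW s0)//.
  by move=> y1; rewrite ger_pMr.
move=> y z _ _; rewrite opprD addrACA subrr addr0 -scalerBr enormZ ger0_norm ?(ltW s0)//.
by rewrite mulKf ?gt_eqF.
Qed.

Lemma hausdorff_ballE (x : E) s : 0 < s -> H (eball x s) = ((s ^+ d)%:E * H (eball (0 : E) 1))%E.
Proof. by move=> s0; apply/eqP; rewrite eq_le hausdorff_ball_le ?hausdorff_ball_ge. Qed.

Lemma enorm_le_coords (x : E) t : (forall i, `|x 0 i| <= t) -> enorm x <= d%:R * t.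
Proof.
move=> xt; have t0 : 0 <= t by exact: le_trans (xt 0).
apply: le_trans (enorm_le_mxnorm _) _; rewrite ler_wpM2l//.
by rewrite /Num.Def.normr/= mx_normrE bigmax_le// => -[i j] _; rewrite ord1.
Qed.

Lemma hausdorff_ball_fin : (H (eball (0 : E) 1) < +oo)%E.
Proof.
apply: (@le_lt_trans _ _ (kappa * (3 * d%:R + 2) ^+ d)%:E); last by rewrite ltry.
apply: (@hausdorff_finite_cover _ _ _ _ 1) => // s s0 s1.
pose K := (Num.truncn (2 * d%:R / s)).+1.
have K0 : 0 < K%:R :> R by rewrite ltr0n.
have dpos : 0 < d%:R :> R by rewrite ltr0n.
have Kgt : 2 * d%:R / s < K%:R by exact: truncnS_gt.
have Kle : K%:R <= 2 * d%:R / s + 1.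
  by rewrite /K -natr1 lerD2r truncn_le// divr_ge0// ltW.
pose c (k : nat) : R := -1 + 2 * k%:R / K%:R.
(* The cube of side 2 is cut into cells of side [2 / K], and [K] exceeds [2 d / s] to make their
   diameter at most [s]. There is one extra index per axis: a coordinate equal to 1 falls into the
   cell number [K]. *)
exists {ffun 'I_d -> 'I_K.+1}, (fun f : {ffun 'I_d -> 'I_K.+1} => [set x : E | forall i, c (f i) <= x 0 i <= c (f i).+1]).
split.
- move=> x; rewrite /eball/= subr0 => x1.
  have xi i : -1 <= x 0 i <= 1 by rewrite -ler_norml (le_trans (coord_le_enorm _ _)).
  have k_le (i : 'I_d) : (Num.truncn ((x 0%R i + 1) / 2 * K%:R)%R < K.+1)%N.
    rewrite ltnS -(ler_nat R); apply: (@le_trans _ _ ((x 0 i + 1) / 2 * K%:R)).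
      by rewrite truncn_le mulr_ge0// divr_ge0//; have /andP[] := xi i; lra.
    by rewrite ler_piMl//; have /andP[] := xi i; lra.
  exists [ffun i => Ordinal (k_le i)] => // i; rewrite ffunE/= /c.
  have y0 : 0 <= (x 0 i + 1) / 2 * K%:R.
    by rewrite mulr_ge0// divr_ge0//; have /andP[] := xi i; lra.
  have := truncn_itv y0.
  move: (Num.truncn _) => k /andP[k1 k2]; apply/andP; split.
    by rewrite -lerBrDl opprK ler_pdivrMr//; lra.
  by rewrite addrC -lerBlDr opprK ler_pdivlMr//; lra.
- move=> f x y xf yf; apply: le_trans (enorm_le_coords (t := 2 / K%:R) _) _.
    move=> i; rewrite !mxE ler_norml; have /andP[] := xf i; have /andP[] := yf i.
    have -> : c (f i).+1 = c (f i) + 2 / K%:R by rewrite /c -[(f i).+1%:R]natr1 mulrDr mulr1 mulrDl addrA.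
    by move: (c _) => z; lra.
  rewrite mulrA ler_pdivrMr//; move: Kgt; rewrite ltr_pdivrMr//; nra.
- rewrite card_ffun !card_ord natrX -exprMn lerXn2r ?nnegrE ?mulr_ge0 ?(ltW s0)//.
  rewrite -[K.+1%:R]natr1 mulrDl mul1r.
  have : K%:R * s <= 2 * d%:R + s.
    by apply: le_trans (ler_wpM2r (ltW s0) Kle) _; rewrite mulrDl mul1r mulfVK// gt_eqF.
  have : 1 <= d%:R :> R by rewrite ler1n.
  lra.
Qed.
End BallMeasure.

(** * Positivity of the volume of the unit ball and comparison with [omega] *)

Section BallPositive.
Variables (R : realType) (d0 : nat).
Local Notation d := d0.+1.
Local Notation E := 'rV[R]_d.
Local Notation H := (@hausdorff R d d).
Local Notation kappa := (omega R d / 2 ^+ d).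
Implicit Types (s t : R).

Lemma card_interval (N : nat) (P : {set 'I_N}) (w : R) : 0 <= w ->
  {in P &, forall j k : 'I_N, (k : nat)%:R - (j : nat)%:R <= w} -> #|P|%:R <= w + 1.
Proof.
move=> w0 Pw; have [->|[k0' Pk0']] := set_0Vmem P; first by rewrite cards0 addr_ge0.
have [k0 Pk0 k0min] := arg_minnP (fun k : 'I_N => k : nat) Pk0'.
have bnd k : k \in P -> ((k - k0)%N < (Num.truncn w).+1)%N.
  move=> Pk; rewrite ltnS truncn_ge_nat// natrB ?k0min//; exact: Pw.
pose f (k : 'I_N) : 'I_(Num.truncn w).+1 := inord (k - k0).
have fP : {in P &, injective f}.
  move=> j k Pj Pk /(congr1 val); rewrite /= !inordK ?bnd// => jk.
  by apply: val_inj; have := k0min _ Pj; have := k0min _ Pk; move: jk => /=; lia.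
have : (#|P| <= (Num.truncn w).+1)%N.
  by rewrite -(card_in_imset fP) -[leqRHS]card_ord max_card.
rewrite -(ler_nat R) => /le_trans; apply.
by rewrite -natr1 lerD2r truncn_le.
Qed.

Lemma card_grid_cube (N : nat) (x : E) (t : R) : (0 < N)%N -> 0 <= t -> 1 <= 2 * t * N%:R ->
  #|[set f : {ffun 'I_d -> 'I_N.+1} | [forall i, `|(f i : nat)%:R / N%:R - x 0 i| <= t]]%SET|%:R
   <= (4 * t * N%:R) ^+ d.
Proof.
move=> N0 t0 tN; have N0' : 0 < N%:R :> R by rewrite ltr0n.
pose F i := [set k : 'I_N.+1 | `|(k : nat)%:R / N%:R - x 0 i| <= t]%SET.
have -> : [set f : {ffun 'I_d -> 'I_N.+1} | [forall i, `|(f i : nat)%:R / N%:R - x 0 i| <= t]]%SET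
    = [set f in family F]%SET.
  apply/setP => f; rewrite !inE; apply/forallP/familyP => h i; have := h i; by rewrite inE.
rewrite cardsE card_family.
have FN i : #|F i|%:R <= 4 * t * N%:R.
  apply: le_trans (card_interval (w := 2 * t * N%:R) _ _) _.
  - by rewrite !mulr_ge0.
  - move=> j k; rewrite !inE => Fj Fk.
    rewrite -ler_pdivrMr// mulrBl; move: Fj Fk; rewrite !ler_norml => /andP[] ? ? /andP[] ? ?.
    lra.
  - lra.
have : forall s : seq 'I_d, (foldr muln 1%N [seq #|F i| | i <- s])%:R <= (4 * t * N%:R) ^+ size s.
  elim=> [|i s IH] /=; first by rewrite expr0.
  by rewrite natrM exprS ler_pM.
by move=> /(_ (enum 'I_d)); rewrite size_enum_ord.
Qed.

(** Counting stands for volume. The points [f / N / d] of a fine grid all lie in the unit ball; each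
    covering ball contains at most [(4 d t N) ^ d] of them, while there are [(N + 1) ^ d] in all. *)
Lemma unit_cover_lower (m : nat) (x : nat -> E) (t : nat -> R) :
  (forall i, 0 < t i) ->
  (forall y : E, enorm y <= 1 -> exists2 i, (i < m)%N & enorm (y - x i) < t i) ->
  1 <= \sum_(i < m) (4 * d%:R * t i) ^+ d.
Proof.
move=> t0 cov; have dpos : 0 < d%:R :> R by rewrite ltr0n.
(* The mesh must be fine at the scale of every ball of the cover, that is [1 <= 2 d t N] for each
   radius; a sum over the balls is a simple common bound. *)
pose N := (\sum_(i < m) (Num.truncn (2 * d%:R * t i)^-1%R).+1)%N.+1.
have N0 : (0 < N)%N by [].
have N0' : 0 < N%:R :> R by rewrite ltr0n.
have tN (i : 'I_m) : 1 <= 2 * (d%:R * t i) * N%:R.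
  rewrite mulrA -ler_pdivrMl ?mulr_gt0// mulr1; apply: le_trans (ltW (truncnS_gt _)) _.
  by rewrite ler_nat /N (bigD1 i)//= leqW// leq_addr.
pose G i := [set f : {ffun 'I_d -> 'I_N.+1} |
  [forall j, `|(f j : nat)%:R / N%:R - (d%:R *: x i) 0 j| <= d%:R * t i]]%SET.
have cover (f : {ffun 'I_d -> 'I_N.+1}) : exists i : 'I_m, f \in G i.
  pose y : E := \row_j ((f j : nat)%:R / N%:R / d%:R).
  have [|i im yi] := cov y.
    apply: le_trans (enorm_le_coords (t := d%:R^-1) _) _; last by rewrite mulfV ?gt_eqF.
    move=> j; rewrite mxE ger0_norm ?divr_ge0//.
    rewrite ler_piMl ?invr_ge0// ler_pdivrMr// mul1r ler_nat -ltnS; exact: ltn_ord.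
  exists (Ordinal im); rewrite inE; apply/forallP => j.
  have := le_trans (coord_le_enorm (y - x i) j) (ltW yi); rewrite !mxE => h.
  rewrite -(ler_pM2l (x := d%:R^-1)) ?invr_gt0// mulKf ?gt_eqF//.
  apply: le_trans h; rewrite -[X in X * _]ger0_norm ?invr_ge0// -normrM mulrBr mulKf ?gt_eqF//.
  by rewrite mulrC.
have : (#|{ffun 'I_d -> 'I_N.+1}| <= \sum_(i < m) #|G i|)%N.
  rewrite -sum1_card (eq_bigr (fun i : 'I_m => \sum_(f in G i) 1)%N); last first.
    by move=> i _; rewrite sum1_card.
  rewrite (exchange_big_dep predT)//=; apply: leq_sum => f _.
  by have [i fi] := cover f; rewrite (bigD1 i).
rewrite card_ffun !card_ord -(ler_nat R) natrX natr_sum => hN.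
have : N%:R ^+ d <= \sum_(i < m) (4 * (d%:R * t i) * N%:R) ^+ d.
  apply: (@le_trans _ _ (N.+1%:R ^+ d)); first by rewrite lerXn2r ?nnegrE// ler_nat.
  apply: le_trans hN _; apply: ler_sum => i _; apply: card_grid_cube => //.
  by rewrite mulr_ge0// ltW.
under eq_bigr do rewrite exprMn.
by rewrite -mulr_suml -ler_pdivrMr ?exprn_gt0// divff ?expf_neq0 ?gt_eqF//; under eq_bigr do rewrite mulrA.
Qed.

Lemma exprD_le_max s t k : 0 <= s -> 0 <= t -> (s + t) ^+ k <= 2 ^+ k * (s ^+ k + t ^+ k).
Proof.
move=> s0 t0; wlog st : s t s0 t0 / s <= t.
  move=> h; have [st|ts] := leP s t; first exact: h.
  by rewrite addrC [in leRHS]addrC; apply: h => //; exact: ltW.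
apply: (@le_trans _ _ ((2 * t) ^+ k)).
  by rewrite lerXn2r ?nnegrE ?addr_ge0 ?mulr_ge0//; lra.
by rewrite exprMn ler_wpM2l ?exprn_ge0// lerDr exprn_ge0.
Qed.

Lemma compact_eball n (r : R) : compact (eball (0 : 'rV[R]_n) r).
Proof.
apply: bounded_closed_compact.
  exists r; split; first exact: num_real.
  move=> s rs x; rewrite /eball/= subr0 => xr.
  exact: le_trans (mxnorm_le_enorm _) (le_trans xr (ltW rs)).
have -> : eball (0 : 'rV[R]_n) r = (fun z => enorm (z - 0)) @^-1` [set t | t <= r] by [].
by apply: closed_comp => [x _|]; [exact: continuous_edist|exact: closed_le].
Qed.

(** Each set of the cover is enlarged to an open ball around one of its points. By compactness
    finitely many of these cover, and the counting bound applies to them. *)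
Lemma ball_cover_lower (C : nat -> set E) (r : nat -> R) :
  small_cover 1 (eball 0 1) C r ->
  ((kappa / (2 * (16 * d%:R) ^+ d))%:E <= \sum_(0 <= i <oo) gauge d0 (r i))%E.
Proof.
move=> [covC Cr]; have dpos : 0 < d%:R :> R by rewrite ltr0n.
have rge0 i : 0 <= r i by have [/andP[]] := Cr i.
pose c := (8 * d%:R) ^+ d : R.
have c0 : 0 < c by rewrite exprn_gt0// mulr_gt0.
have d1 : 1 <= d%:R :> R by rewrite ler1n.
have c1 : 1 <= c by rewrite exprn_ege1//; lra.
(* The enlargements sum to at most [1 / (2 c)]. They therefore take away at most half of the lower
   bound 1, which accounts for the 2 in the denominator of the statement. *)
pose e i : R := (2 * c)^-1 / 2 ^+ i.+1.
have e0 i : 0 < e i by rewrite divr_gt0 ?exprn_gt0// invr_gt0 mulr_gt0.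
have e1 i : e i <= 1.
  rewrite /e -invfM invf_le1 ?mulr_gt0 ?exprn_gt0//.
  have : 1 <= 2 ^+ i.+1 :> R by rewrite exprn_ege1// ler1n.
  by move: c1; set u := 2 ^+ _; clearbody c u; nra.
have sum_e m : \sum_(i < m) e i <= (2 * c)^-1.
  suff -> : \sum_(i < m) e i = (2 * c)^-1 * (1 - 1 / 2 ^+ m).
    by rewrite ger_pMr ?invr_gt0 ?mulr_gt0// gerBl divr_ge0// exprn_ge0.
  elim: m => [|m IH]; first by rewrite big_ord0 expr0 divr1 subrr mulr0.
  rewrite big_ord_recr/= IH /e exprS; field.
  by rewrite expf_neq0// gt_eqF.
pose t i := 2 * r i + e i.
have t0 i : 0 < t i by rewrite ltr_wpDl// mulr_ge0.
have [x xC] : {x : nat -> E & forall i, C i !=set0 -> C i (x i)}.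
  apply: (@choice _ _ (fun i y => C i !=set0 -> C i y)) => i.
  by have [[y Cy]|nC] := pselect (C i !=set0); [exists y|exists 0 => /nC].
have [m hm] : exists m, forall y : E, enorm y <= 1 -> exists2 i, (i < m)%N & enorm (y - x i) < t i.
  have := @compact_eball d 1; rewrite compact_cover => /(_ nat setT (fun i => [set y | enorm (y - x i) < t i])).
  case.
  - move=> i _; have -> : [set y | enorm (y - x i) < t i] = (fun z : E => enorm (z - x i)) @^-1` [set u | u < t i] by [].
    by apply: open_comp => [y _|]; [exact: continuous_edist|exact: open_lt].
  - move=> y /covC[i _ Cy]; exists i => //=.
    have [_ /(_ _ _ Cy (xC i (ex_intro _ y Cy)))] := Cr i => /le_lt_trans; apply.
    by rewrite /t; have := e0 i; have := rge0 i; lra.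
  - move=> D _ Dcov; exists (\max_(i <- finmap.enum_fset D) i.+1)%N => y y1.
    have [|i Di yi] := Dcov y; first by rewrite /eball/= subr0.
    by exists i => //; rewrite (big_rem i)//= leq_max leqnn.
have h0 := unit_cover_lower t0 hm.
have tb i : (4 * d%:R * t i) ^+ d <= (16 * d%:R) ^+ d * r i ^+ d + c * e i.
  rewrite exprMn; apply: (@le_trans _ _ ((4 * d%:R) ^+ d * (2 ^+ d * ((2 * r i) ^+ d + e i ^+ d)))).
    rewrite ler_wpM2l ?exprn_ge0 ?mulr_ge0//.
    by apply: exprD_le_max; [exact: mulr_ge0|exact: ltW].
  rewrite mulrA -exprMn mulrDr -!exprMn.
  rewrite (_ : 4 * d%:R * 2 * (2 * r i) = 16 * d%:R * r i); last by ring.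
  rewrite (_ : 4 * d%:R * 2 = 8 * d%:R :> R); last by ring.
  rewrite [in leLHS]exprMn lerD2l ler_wpM2l ?exprn_ge0 ?mulr_ge0//.
  by rewrite exprS ler_piMr ?exprn_ile1// ltW.
have : 1 <= \sum_(i < m) ((16 * d%:R) ^+ d * r i ^+ d + c * e i).
  by apply: le_trans h0 _; apply: ler_sum => i _; exact: tb.
rewrite big_split/= -[X in X + _]mulr_sumr -[X in _ + X]mulr_sumr => h.
have {}h : 1 / 2 <= (16 * d%:R) ^+ d * \sum_(i < m) r i ^+ d.
  have : c * \sum_(i < m) e i <= 1 / 2.
    apply: le_trans (ler_wpM2l (ltW c0) (sum_e m)) _; rewrite invfM mulrCA mulfV ?gt_eqF//.
    by rewrite mulr1 div1r.
  move=> ce; rewrite -(lerD2r (1 / 2)) -splitr; apply: le_trans h _.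
  by rewrite lerD2l.
apply: le_trans (nneseries_lim_ge m _); last by move=> i _ _; exact: gauge_ge0.
rewrite big_mkord; under eq_bigr do rewrite gaugeE.
rewrite sumEFin lee_fin -mulr_sumr ler_wpM2l ?(ltW (kappa_gt0 _ _))//.
rewrite invfM ler_pdivrMr ?exprn_gt0 ?mulr_gt0// mulrC.
by move: h; rewrite div1r.
Qed.

(** The [d]-dimensional Hausdorff measure of the unit ball, normalized as in the statement. It is
    compared with [omega] by [kappa_le_vball] and [vball_le], each losing a factor [2 ^+ d]. *)
Definition vball : R := fine (H (eball 0 1)).

Lemma vballE : H (eball 0 1) = vball%:E.
Proof. by rewrite fineK// ge0_fin_numE ?hausdorff_ball_fin// hausdorff_ge0. Qed.

Lemma vball_gt0 : 0 < vball.
Proof.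
rewrite -lte_fin -vballE; apply: (@lt_le_trans _ _ (Hdelta d 1 (eball (0 : E) 1))); last first.
  exact: hausdorff_ge_Hdelta.
apply: (@lt_le_trans _ _ (kappa / (2 * (16 * d%:R) ^+ d))%:E).
  by rewrite lte_fin divr_gt0 ?kappa_gt0// mulr_gt0// exprn_gt0// mulr_gt0// ltr0n.
exact/le_Hdelta_covers/ball_cover_lower.
Qed.

Lemma hausdorff_eball (x : E) s : 0 < s -> H (eball x s) = (s ^+ d * vball)%:E.
Proof. by move=> s0; rewrite hausdorff_ballE// vballE. Qed.

Lemma hausdorff_point (x : E) : H [set x] = 0%E.
Proof.
apply/eqP; rewrite eq_le hausdorff_ge0 andbT; apply/lee_addgt0Pr => e e0; rewrite add0e.
pose s := Num.min 1 (e / vball).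
have s0 : 0 < s by rewrite lt_min ltr01 divr_gt0// vball_gt0.
apply: (@le_trans _ _ (H (eball x s))).
  by apply: le_hausdorff => _ ->; rewrite /eball/= subrr enorm0 ltW.
rewrite hausdorff_eball// lee_fin -ler_pdivlMr ?vball_gt0//.
apply: (@le_trans _ _ s); last by rewrite ge_min lexx orbT.
by rewrite exprS ler_piMr ?(ltW s0)// exprn_ile1 ?(ltW s0)// ge_min lexx.
Qed.

(** A set of diameter at most [r i] lies in a ball of radius [r i] about one of its points. Covering
    the unit ball thus forces the sum of the [r i ^+ d] to be at least 1. *)
Lemma kappa_le_vball : kappa <= vball.
Proof.
rewrite -lee_fin -vballE; apply: le_trans (hausdorff_ge_Hdelta _ _ ltr01).
apply: le_Hdelta_covers => C r [covC Cr].
have rge0 i : 0 <= r i by have [/andP[]] := Cr i.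
have vk0 : 0 < vball / kappa by rewrite divr_gt0 ?vball_gt0 ?kappa_gt0.
have -> : kappa = (vball / kappa)^-1 * vball.
  by rewrite invf_div mulrVK// unitfE gt_eqF// vball_gt0.
rewrite EFinM lee_pdivrMl// -nneseriesZl; last by move=> i _; exact: gauge_ge0.
rewrite -vballE; apply: (@le_trans _ _ (H (\bigcup_i C i))); first exact: le_hausdorff.
apply: le_trans (hausdorff_sigma_subadditive _ _) _; apply: lee_nneseries => i _.
  by move=> _; exact: hausdorff_ge0.
have -> : ((vball / kappa)%:E * gauge d0 (r i) = (r i ^+ d * vball)%:E)%E.
  by rewrite gaugeE -EFinM mulrA mulfVK ?gt_eqF ?kappa_gt0// mulrC.
have [[x Cx]|nC] := pselect (C i !=set0); last first.
  rewrite (_ : C i = set0) ?hausdorff0 ?lee_fin ?mulr_ge0 ?exprn_ge0 ?(ltW vball_gt0)//.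
  by apply/seteqP; split=> // y Cy; apply: nC; exists y.
have [_ Cd] := Cr i.
(* The scaling law of balls requires a positive radius. A set of radius 0 is a single point, which
   is null. *)
have [ri0|ri0] := eqVneq (r i) 0.
  apply: (@le_trans _ _ (H [set x])); last first.
    by rewrite hausdorff_point lee_fin mulr_ge0 ?exprn_ge0 ?(ltW vball_gt0).
  apply: le_hausdorff => y Cy /=; apply/eqP; rewrite -subr_eq0 -enorm_eq0.
  by rewrite eq_le enorm_ge0 -ri0 Cd.
rewrite -(hausdorff_eball x) ?lt0r ?ri0 ?rge0//.
by apply: le_hausdorff => y Cy; apply: Cd.
Qed.

Lemma packing_bound (m : nat) (f : 'I_m -> E) s : 0 < s -> s <= 1 ->
  (forall i, enorm (f i) <= 1) -> (forall i j, i != j -> s < enorm (f i - f j)) ->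
  m%:R * s ^+ d <= (2 + s) ^+ d.
Proof.
move=> s0 s1 f1 fs; have s20 : 0 < s / 2 by rewrite divr_gt0.
pose F i : set (borelR R d) := eball (f i) (s / 2).
have mF i : measurable (F i) by exact: eball_borel.
have tF : trivIset setT F.
  apply/trivIsetP => i j _ _ ij; apply/seteqP; split=> // y [].
  rewrite /F /eball/= => yi yj; have := fs _ _ ij.
  have := enorm_triangle y (f i) (f j); rewrite (enormB (f i) y).
  by move: yi yj; lra.
have mU : measurable (\big[setU/set0]_(i < m) F i) by exact: bigsetU_measurable.
have := measure_semi_additive_ord (@hmeasure R d d0) mF tF mU.
rewrite (eq_bigr (fun=> ((s / 2) ^+ d * vball)%:E)); last by move=> i _; exact: hausdorff_eball.
have s21 : 0 < 1 + s / 2 by rewrite addr_gt0.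
have sub : (hmeasure d0 (\big[setU/set0]_(i < m) F i) <= ((1 + s / 2) ^+ d * vball)%:E)%E.
  rewrite -(hausdorff_eball 0)//; apply: le_hausdorff => y.
  move=> Uy; have [i] : exists i, F i y.
    elim/big_ind : _ Uy => [[]|A B IA IB [/IA|/IB]|i _ Fi] //; by exists i.
  rewrite /F /eball/= subr0 => yi.
  have := enormD (y - f i) (f i); rewrite subrK; have := f1 i; move: yi; lra.
move=> h; move: sub; rewrite h sumEFin sumr_const card_ord lee_fin -[leLHS]mulr_natl mulrA.
rewrite ler_pM2r ?vball_gt0// => {}h.
have := ler_wpM2l (exprn_ge0 d (ler0n R 2)) h.
rewrite mulrCA -!exprMn (_ : 2 * (s / 2) = s); last by field.
by rewrite (_ : 2 * (1 + s / 2) = 2 + s)//; field.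
Qed.

(** A maximal [s]-separated family is an [s]-net. Its size is bounded since the balls of radius
    [s / 2] around it are disjoint in a ball of radius [1 + s / 2]. *)
Lemma max_packing s : 0 < s -> s <= 1 -> exists (m : nat) (f : 'I_m -> E),
  [/\ m%:R * s ^+ d <= (2 + s) ^+ d &
      eball 0 1 `<=` \bigcup_i eball (f i) s].
Proof.
move=> s0 s1.
pose P m := `[< exists f : 'I_m -> E, (forall i, enorm (f i) <= 1) /\
  (forall i j, i != j -> s < enorm (f i - f j)) >].
have exP : exists m, P m by exists 0%N; apply/asboolP; exists (fun=> 0); split=> -[].
have ubP m : P m -> (m <= Num.truncn ((2 + s) ^+ d / s ^+ d))%N.
  move=> /asboolP[f [f1 fs]]; rewrite truncn_ge_nat; last first.
    by rewrite divr_ge0// exprn_ge0// ?addr_ge0// ltW.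
  by rewrite ler_pdivlMr ?exprn_gt0//; exact: packing_bound fs.
have [m /asboolP[f [f1 fs]] maxm] := ex_maxnP exP ubP.
exists m, f; split; first exact: packing_bound fs.
move=> y; rewrite {1}/eball/= subr0 => y1; apply: contrapT => ny.
have far i : s < enorm (y - f i).
  by rewrite ltNge; apply/negP => yi; apply: ny; exists i.
have : P m.+1.
  apply/asboolP; exists (fun i => oapp f y (unlift ord0 i)); split.
    by move=> i; case: unliftP => [j|] _ /=.
  move=> i j; case: (unliftP ord0 i) => [i'|] ->; case: (unliftP ord0 j) => [j'|] -> //=.
  - by rewrite (inj_eq lift_inj); exact: fs.
  - by rewrite enormB => _; exact: far.
by move=> /maxm; rewrite ltnn.
Qed.

(** A net at scale [t / 2] covers the unit ball by balls of diameter [t]; at most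
    [((2 + t / 2) / (t / 2)) ^ d] are required. As the scale tends to 0 the bound tends to
    [kappa * 4 ^+ d], which is [2 ^+ d * omega R d]. *)
Lemma vball_le_near s : 0 < s -> s <= 1 -> vball <= kappa * (4 + 2 * s) ^+ d.
Proof.
move=> s0 s1; rewrite -lee_fin -vballE.
apply: (@hausdorff_finite_cover _ _ _ _ (2 * s)).
- by rewrite exprn_ge0// addr_ge0// mulr_ge0// ltW.
- by rewrite mulr_gt0.
move=> t t0 ts; have t20 : 0 < t / 2 by rewrite divr_gt0.
have [||m [f [mt cov]]] := @max_packing (t / 2); [by []|lra|].
exists 'I_m, (fun i => eball (f i) (t / 2)); split=> //.
  move=> i x y; rewrite /eball/= => xi yi.
  have := enorm_triangle (f i) x y; rewrite (enormB (f i) y); move: xi yi; lra.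
rewrite card_ord; have := ler_wpM2r (exprn_ge0 d (ler0n R 2)) mt.
rewrite -mulrA -!exprMn mulfVK// => /le_trans; apply.
by rewrite lerXn2r ?nnegrE; lra.
Qed.

Lemma vball_le : vball <= 2 ^+ d * omega R d.
Proof.
have -> : 2 ^+ d * omega R d = kappa * 4 ^+ d.
  rewrite (_ : 4 = 2 * 2) ?exprMn; last by ring.
  by rewrite mulrA mulfVK ?expf_neq0// mulrC.
pose p : {poly R} := kappa%:P * (4%:P + 2%:P * 'X) ^+ d.
have pE s : p.[s] = kappa * (4 + 2 * s) ^+ d by rewrite !hornerE.
have : p.[s] @[s --> 0^'+] --> p.[0] by apply: cvg_at_right_filter; exact: continuous_horner.
rewrite pE mulr0 addr0 => /cvgr_to_ge; apply.
near=> s; rewrite pE; apply: vball_le_near; first by near: s; exact: nbhs_right_gt.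
by near: s; apply: nbhs_right_le.
Unshelve. all: by end_near. Qed.
End BallPositive.

(** * The two-point method *)

Section TwoPoints.
Variables (R : realType) (n : nat).

Lemma runs_take (A : det_alg R n) (O : oracle R n) qs ans : runs A O qs ans ->
  size qs = size ans /\ forall k, (k < size ans)%N -> exists q,
    [/\ A (take k ans) = Ask q, take k.+1 qs = rcons (take k qs) q &
        take k.+1 ans = rcons (take k ans) (O (rcons (take k qs) q))].
Proof.
elim=> [|qs' ans' q _ [sz IH] Aq]; first by split.
split=> [|k]; first by rewrite !size_rcons sz.
rewrite size_rcons ltnS leq_eqVlt => /predU1P[->|kn].
  have ts x : take (size ans') (rcons ans' x) = ans' by rewrite -cats1 take_size_cat.
  have tq : take (size ans') (rcons qs' q) = qs' by rewrite -sz -cats1 take_size_cat.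
  by exists q; rewrite ts tq !take_oversize ?size_rcons ?sz.
have [q' [Aq' tq ta]] := IH _ kn; exists q'.
by rewrite -!cats1 !takel_cat ?cats1 ?(ltnW kn) ?sz ?(ltnW kn)//.
Qed.

(** For a fixed oracle a deterministic algorithm has a single run. This identifies the outputs
    obtained from the success under each of the two distributions. *)
Lemma outputs_inj (A : det_alg R n) (O : oracle R n) K1 K2 :
  outputs A O K1 -> outputs A O K2 -> K1 = K2.
Proof.
move=> [qs1 [ans1 [/runs_take[sz1 r1] out1]]] [qs2 [ans2 [/runs_take[sz2 r2] out2]]].
have same k : (k <= size ans1)%N -> (k <= size ans2)%N ->
    take k qs1 = take k qs2 /\ take k ans1 = take k ans2.
  elim: k => [|k IH] k1 k2; first by rewrite !take0.
  have [eq ea] := IH (ltnW k1) (ltnW k2).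
  have [q1 [A1 -> ->]] := r1 _ k1; have [q2 [A2 -> ->]] := r2 _ k2.
  by move: A1; rewrite ea A2 eq => -[->].
case: (ltngtP (size ans1) (size ans2)) => sz.
- have [_ ea] := same _ (leqnn _) (ltnW sz).
  by have [q [Aq _ _]] := r2 _ sz; move: Aq; rewrite -ea take_size out1.
- have [_ ea] := same _ (ltnW sz) (leqnn _).
  by have [q [Aq _ _]] := r1 _ sz; move: Aq; rewrite ea take_size out2.
- have [_] := same _ (leqnn _) (eq_leq sz); rewrite take_size sz take_size => ea.
  by move: out1; rewrite ea out2 => -[].
Qed.

Lemma dH_edist (K K' : set 'rV[R]_n) (p : 'rV[R]_n) (e : R) :
  (dH K K' <= e%:E -> `|edist p K - edist p K'| <= e%:E)%E.
Proof. by move=> h; apply: le_trans h; rewrite /dH; apply: ereal_sup_ubound => /=; exists p. Qed.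

Lemma two_point_bound (mdl : probability (borelR R n) R -> Prop) (tau eps alpha : R)
    (dO : measure_display) (Om : measurableType dO) (P : probability Om R)
    (A : Om -> det_alg R n) (D1 D2 : probability (borelR R n) R) (p : 'rV[R]_n) :
  alpha < 1 / 2 -> mdl D1 -> mdl D2 ->
  (forall q : query R n, exists a : R, (`|a%:E - expect D1 q| <= tau%:E)%E /\
     (`|a%:E - expect D2 q| <= tau%:E)%E) ->
  edist p (supp D1) = 0%E -> ((2 * eps)%:E < edist p (supp D2))%E ->
  ~ sq_estimates mdl tau eps alpha P A.
Proof.
move=> alpha12 mD1 mD2 common p1 p2 est.
have [f fP] := choice common.
(* The answer depends on the last query only. The value 0 on the empty list is a default: validity
   concerns nonempty lists. *)
pose O : oracle R n := fun qs => if qs is q :: qs' then f (last q qs') else 0.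
have OE qs q : O (rcons qs q) = f q by case: qs => [|q' qs]//=; rewrite last_rcons.
have [E1 [mE1 PE1 out1]] := est D1 mD1 O (fun qs q => ltac:(rewrite OE; exact: (fP q).1)).
have [E2 [mE2 PE2 out2]] := est D2 mD2 O (fun qs q => ltac:(rewrite OE; exact: (fP q).2)).
(* Both success events have probability more than 1/2, hence they meet. *)
have [w [Ew1 Ew2]] : E1 `&` E2 !=set0.
  apply/set0P/negP => /eqP E12.
  have := measureU P mE1 mE2 E12; have := probability_le1 P (measurableU _ _ mE1 mE2).
  move=> le1 eU; move: le1; rewrite eU; apply/negP; rewrite -ltNge.
  apply: (@lt_le_trans _ _ ((1 - alpha)%:E + (1 - alpha)%:E)%E); last exact: leeD.
  by rewrite -EFinD lte_fin; lra.
have [K1 [oK1 d1]] := out1 w Ew1; have [K2 [oK2 d2]] := out2 w Ew2.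
rewrite (outputs_inj oK2 oK1) in d2.
have := dH_edist p d1; have := dH_edist p d2; rewrite p1 sub0e abseN.
(* Infinite distances, such as to an empty output, contradict the bounds at once. The finite case is
   the triangle inequality at [p]. *)
move: p2; case: (edist p _) => [a||]; case: (edist p K1) => [b||] //=.
rewrite lte_fin !lee_fin => h1 h2 h3.
have := ler_norm (a - b); have := ler_norm b; lra.
Qed.

End TwoPoints.

(** * Answers common to two distributions, and the uniform distribution on a manifold *)

Section UniformDistribution.
Variables (R : realType) (n d0 : nat).
Local Notation d := d0.+1.
Local Notation E := 'rV[R]_n.
Local Notation H := (@hausdorff R n d).

(** The common answer is the integral of the query over [S], where the distributions coincide. The
    rest of each expectation is at most the mass off [S], because queries are bounded by 1. *)
Lemma common_answer (D1 D2 : probability (borelR R n) R) (S : set (borelR R n)) (tau : R) :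
  measurable S ->
  (forall A, measurable A -> A `<=` S -> D1 A = D2 A) ->
  (D1 (~` S) <= tau%:E)%E -> (D2 (~` S) <= tau%:E)%E ->
  forall q : query R n, exists a : R, (`|a%:E - expect D1 q| <= tau%:E)%E /\
     (`|a%:E - expect D2 q| <= tau%:E)%E.
Proof.
move=> mS D12 D1S D2S q.
have mSC : measurable (~` S) by exact: measurableC.
have mq (A : set (borelR R n)) : measurable_fun A (EFin \o qfun q).
  by apply/measurable_EFinP; apply: measurable_funTS; exact: qfun_meas.
have bq (D : probability (borelR R n) R) A : measurable A ->
    (`|\int[D]_(x in A) (qfun q x)%:E| <= D A)%E.
  move=> mA; apply: le_trans (le_abse_integral _ _ _) _ => //.
  apply: (@le_trans _ _ (\int[D]_(x in A) cst 1%:E x)%E); last by rewrite integral_cst// mul1e.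
  apply: ge0_le_integral => //.
    by apply: measurableT_comp.
  by move=> x _; rewrite lee_fin ler_norml; exact: qfun_bound.
have finq (D : probability (borelR R n) R) A : measurable A ->
    (\int[D]_(x in A) (qfun q x)%:E)%E \is a fin_num.
  move=> mA; rewrite -abse_fin_num ge0_fin_numE//; apply: le_lt_trans (bq _ _ mA) _.
  by apply: le_lt_trans (probability_le1 _ mA) _; rewrite ltry.
exists (fine (\int[D1]_(x in S) (qfun q x)%:E)%E); rewrite fineK ?finq//.
have h (D : probability (borelR R n) R) : (D (~` S) <= tau%:E)%E ->
    (`|\int[D]_(x in S) (qfun q x)%:E - expect D q| <= tau%:E)%E.
  move=> DS; rewrite /expect -(setUv S) integral_setU//; last by rewrite disj_set2E setICr.
  rewrite oppeD; last by rewrite fin_num_adde_defl// finq.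
  by rewrite addeA subee ?finq// add0e abseN; apply: le_trans (bq _ _ mSC) DS.
split; first exact: h.
by rewrite (@eq_measure_integral _ _ _ _ D2)//; exact: h.
Qed.

Lemma uniform_model (rch fmin fmax L Rb v : R) (M : set E) (x0 : E) :
  manifold_class d rch M -> M `<=` eball 0 Rb -> 0 < v -> H M = v%:E ->
  fmin <= v^-1 <= fmax -> 0 <= L ->
  (forall x, M x -> forall U, open U -> U x -> (0 < H (M `&` U))%E) ->
  exists D : probability (borelR R n) R, [/\ model d rch fmin fmax L Rb D, supp D = M &
    forall A, measurable A -> D A = ((v^-1)%:E * H (A `&` M))%E].
Proof.
move=> mcM MR v0 HM fv L0 Mpos.
have cM : closed M by apply: compact_closed; [exact: norm_hausdorff|case: mcM].
have mM : measurable (M : set (borelR R n)) by exact: closed_borel.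
pose mu : {measure set (borelR R n) -> \bar R} := mrestr (@hmeasure R n d0) mM.
have muE A : mu A = H (A `&` M) by [].
(* The Dirac mass is the default of [mnormalize] for a total mass 0 or infinite; here the mass is
   [v], positive and finite. *)
pose D : probability (borelR R n) R := mnormalize mu (dirac (x0 : borelR R n)).
have DE A : D A = ((v^-1)%:E * H (A `&` M))%E.
  rewrite /D /= /mnormalize muE setTI HM orbF eqe gt_eqF//=.
  by rewrite muE muleC.
have suppD : supp D = M.
  apply/seteqP; split=> x.
    move=> sx; apply: contrapT => nMx.
    have := sx (~` M) (closed_openC cM) nMx.
    by rewrite DE setICl hausdorff0 mule0 ltxx.
  move=> Mx U oU Ux; rewrite DE mule_gt0 ?lte_fin ?invr_gt0//.
  by rewrite setIC; apply: (Mpos x).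
exists D; split=> //; exists M, (cst v^-1); split=> //; split => [x _ //|x y _ _|].
- by rewrite subrr normr0 mulr_ge0// enorm_ge0.
- exists mu; split=> // A mA.
  by rewrite DE -muE -(integral_cst mu mA).
Qed.

End UniformDistribution.

(** * Calculus of class C2 and graph charts *)

Section C2Calculus.
Variable R : realType.

Lemma is_derive_line (V : normedModType R) (f : V -> R) (w e : V) (a : R) :
  is_derive w e f a <-> is_derive (0 : R) (1 : R) (fun h => f (h *: e + w)) a.
Proof.
have E : (fun h : R => h^-1 *: ((f \o shift w) (h *: e) - f w)) =
    (fun h : R => h^-1 *: (((fun h => f (h *: e + w)) \o shift 0) (h *: (1 : R)) -
      (fun h => f (h *: e + w)) 0)).
  by apply/funext => h /=; rewrite addr0 scale0r add0r [h *: 1]mulr1.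
split=> -[fd <-]; (apply: DeriveDef; [|]).
- by move: fd; rewrite /derivable E.
- by rewrite /derive E.
- by move: fd; rewrite /derivable -E.
- by rewrite /derive -E.
Qed.

Lemma is_derive_chain (V : normedModType R) (phi : R -> R) (f : V -> R) (w e : V) (a b : R) :
  is_derive (f w) 1 phi b -> is_derive w e f a -> is_derive w e (phi \o f) (b * a).
Proof.
move=> dphi /is_derive_line df; apply/is_derive_line.
apply: (is_derive1_comp (f := phi) (g := fun h => f (h *: e + w))).
by rewrite scale0r add0r.
Qed.

(** Derivatives of powers of the positive part are obtained from a quadratic remainder, which is
    uniform across the break at 0. *)
Lemma is_derive_quad (f : R -> R) (t a C r : R) : 0 < r ->
  (forall h, `|h| < r -> `|f (t + h) - f t - a * h| <= C * h ^+ 2) ->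
  is_derive t 1 f a.
Proof.
move=> r0 fC; have cv : (fun h : R => h^-1 *: ((f \o shift t) (h *: (1 : R)) - f t)) @ 0^' --> a.
  apply/cvgrPdist_le => e e0.
  have C0 : 0 < `|C| + 1 by rewrite ltr_wpDl.
  near=> h.
  have h0 : h != 0 by near: h; exact: nbhs_dnbhs_neq.
  have hr : `|h| < r by near: h; exact: dnbhs0_lt.
  have hC : `|h| < e / (`|C| + 1) by near: h; apply: dnbhs0_lt; rewrite divr_gt0.
  rewrite /= [h *: 1]mulr1 (addrC h) distrC.
  have -> : h^-1 *: (f (t + h) - f t) - a = (f (t + h) - f t - a * h) / h.
    by rewrite mulrBl mulfK// /GRing.scale/= mulrC.
  rewrite normrM normfV ler_pdivrMr ?normr_gt0//; apply: le_trans (fC _ hr) _.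
  rewrite -real_normK ?num_real// expr2 mulrA ler_wpM2r//.
  move: hC; rewrite ltr_pdivlMr// => hC; apply: le_trans (ltW hC).
  rewrite mulrC ler_wpM2l//; apply: le_trans (ler_norm _) _; by rewrite lerDl.
by apply: DeriveDef; [apply/cvg_ex; exists a|apply/cvg_lim].
Unshelve. all: by end_near. Qed.

Definition pos (t : R) : R := Num.max t 0.

Lemma pos_ge0 t : 0 <= pos t. Proof. by rewrite le_max lexx orbT. Qed.
Lemma pos_id t : 0 <= t -> pos t = t. Proof. by move=> t0; rewrite /pos max_l. Qed.
Lemma pos_0 t : t <= 0 -> pos t = 0. Proof. by move=> t0; rewrite /pos max_r. Qed.

Lemma pos_cases t : (0 <= t /\ pos t = t) \/ (t <= 0 /\ pos t = 0).
Proof. by have [t0|/ltW t0] := leP 0 t; [left; rewrite pos_id|right; rewrite pos_0]. Qed.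

Lemma pos2_taylor t h : `|pos (t + h) ^+ 2 - pos t ^+ 2 - 2 * pos t * h| <= h ^+ 2.
Proof.
rewrite ler_norml; case: (pos_cases t) => -[t0 ->]; case: (pos_cases (t + h)) => -[th0 ->];
  apply/andP; split; nra.
Qed.

Lemma pos3_taylor t h : 0 <= pos (t + h) ^+ 3 - pos t ^+ 3 - 3 * pos t ^+ 2 * h
    <= (2 * pos t + pos (t + h)) * h ^+ 2.
Proof.
case: (pos_cases t) => -[t0 ->]; case: (pos_cases (t + h)) => -[th0 ->].
- have -> : (t + h) ^+ 3 - t ^+ 3 - 3 * t ^+ 2 * h = (2 * t + (t + h)) * h ^+ 2 by ring.
  by rewrite lexx andbT; apply: mulr_ge0; [lra|exact: sqr_ge0].
- have -> : 0 ^+ 3 - t ^+ 3 - 3 * t ^+ 2 * h = t ^+ 2 * (- 3 * h - t) by ring.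
  have -> : (2 * t + 0) * h ^+ 2 = 2 * t * h ^+ 2 by ring.
  apply/andP; split; first by apply: mulr_ge0; [exact: sqr_ge0|lra].
  rewrite -subr_ge0; have -> : 2 * t * h ^+ 2 - t ^+ 2 * (- 3 * h - t) =
     t * ((- h - t) * (- 2 * h - t)) by ring.
  apply: mulr_ge0 => //; apply: mulr_ge0; lra.
- rewrite !expr0n/= !mulr0 !mul0r !subr0 add0r exprn_ge0//= -subr_ge0.
  have -> : (t + h) * h ^+ 2 - (t + h) ^+ 3 = (t + h) * ((- t) * (2 * h + t)) by ring.
  by apply: mulr_ge0 => //; apply: mulr_ge0; lra.
- by rewrite !expr0n/= !mulr0 !mul0r !subr0 add0r mul0r lexx.
Qed.

Lemma is_derive_pos2 (t : R) : is_derive t 1 (fun s => pos s ^+ 2) (2 * pos t).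
Proof. by apply: (@is_derive_quad _ _ _ 1 1) => // h _; rewrite mul1r pos2_taylor. Qed.

Lemma is_derive_pos3 (t : R) : is_derive t 1 (fun s => pos s ^+ 3) (3 * pos t ^+ 2).
Proof.
apply: (@is_derive_quad _ _ _ (3 * pos t + 1) 1) => // h h1.
have /andP[p0 p1] := pos3_taylor t h; rewrite ger0_norm//.
apply: le_trans p1 _; rewrite ler_wpM2r ?sqr_ge0//.
have : pos (t + h) <= pos t + 1.
  move: h1; rewrite ltr_norml => /andP[? ?].
  case: (pos_cases t) => -[t0 ->]; case: (pos_cases (t + h)) => -[th0 ->]; lra.
lra.
Qed.

Lemma continuous_pos : continuous pos.
Proof.
move=> t; apply: (@continuous_max R R id (cst 0)); [exact: cvg_id|exact: cvg_cst].
Qed.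

Definition smooth2_at (phi : R -> R) (t : R) := exists phi1 phi2 : R -> R,
  \forall s \near t, [/\ is_derive (s : R) (1 : R) phi (phi1 s), is_derive (s : R) (1 : R) phi1 (phi2 s) &
    {for s, continuous phi2}].

Lemma smooth2_pos3 (t : R) : smooth2_at (fun s => pos s ^+ 3) t.
Proof.
exists (fun s => 3 * pos s ^+ 2), (fun s => 3 * (2 * pos s)); near=> s; split.
- exact: is_derive_pos3.
- by have := is_deriveZ 3 (is_derive_pos2 s).
- by do 2!(apply: continuousM; first exact: cvg_cst); exact: continuous_pos.
Unshelve. all: by end_near. Qed.

Lemma smooth2_powR (p t : R) : 0 < t -> smooth2_at (fun s => s `^ p) t.
Proof.
move=> t0; exists (fun s => p * s `^ (p - 1)), (fun s => p * ((p - 1) * s `^ (p - 1 - 1))).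
near=> s; have s0 : 0 < s by near: s; exact: lt_nbhsr.
split.
- exact: is_derive1_powR.
- by have := is_deriveZ p (is_derive1_powR (p - 1) s0).
- do 2!(apply: continuousM; first exact: cvg_cst).
  apply: differentiable_continuous; apply/derivable1_diffP.
  by apply: ex_derive; exact: is_derive1_powR.
Unshelve. all: by end_near. Qed.

End C2Calculus.

Section C2Fun.
Variables (R : realType) (d : nat).
Local Notation V := 'rV[R]_d.
Local Notation e_ i := (@unitv R d i).
Implicit Types (f g : V -> R) (v w : V).

(** The first and second partial derivatives are given as witnesses valid in a neighbourhood.
    Closure under sums, products and composition then amounts to writing the formulas, and [C2_onP]
    translates back to [partial]. *)
Definition c2_at f v := exists (f1 : 'I_d -> V -> R) (f2 : 'I_d -> 'I_d -> V -> R),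
  \forall w \near v, [/\ {for w, continuous f},
    forall i, is_derive w (e_ i) f (f1 i w) /\ {for w, continuous (f1 i)} &
    forall i j, is_derive w (e_ j) (f1 i) (f2 i j w) /\ {for w, continuous (f2 i j)}].

Lemma c2_cst (c : R) v : c2_at (cst c) v.
Proof.
exists (fun _ => cst 0), (fun _ _ => cst 0); near=> w; split=> [|i|i j].
- exact: cst_continuous.
- by split; [exact: is_derive_cst|exact: cst_continuous].
- by split; [exact: is_derive_cst|exact: cst_continuous].
Unshelve. all: by end_near. Qed.

Lemma is_derive_coord (k : 'I_d) (w u : V) : is_derive w u (fun x : V => x 0 k) (u 0 k).
Proof.
apply/is_derive_line.
have -> : (fun h : R => (h *: u + w) 0 k) = (fun h : R => h * u 0 k + w 0 k).
  by apply/funext => h; rewrite !mxE.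
apply: (@is_derive_quad _ _ _ _ 0 1) => // h _.
by rewrite add0r mul0r add0r addrK mulrC subrr normr0 mul0r.
Qed.

Lemma c2_coord (k : 'I_d) v : c2_at (fun x => x 0 k) v.
Proof.
exists (fun i => cst (e_ i 0 k)), (fun _ _ => cst 0); near=> w; split=> [|i|i j].
- exact: (@coord_continuous R 1 d 0 k w).
- by split; [exact: is_derive_coord|exact: cst_continuous].
- by split; [exact: is_derive_cst|exact: cst_continuous].
Unshelve. all: by end_near. Qed.

Lemma c2_add f g v : c2_at f v -> c2_at g v -> c2_at (fun x => f x + g x) v.
Proof.
move=> [f1 [f2 hf]] [g1 [g2 hg]].
exists (fun i w => f1 i w + g1 i w), (fun i j w => f2 i j w + g2 i j w).
near=> w.
have [fc fd fdd] : [/\ {for w, continuous f},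
    forall i, is_derive w (e_ i) f (f1 i w) /\ {for w, continuous (f1 i)} &
    forall i j, is_derive w (e_ j) (f1 i) (f2 i j w) /\ {for w, continuous (f2 i j)}].
  by near: w.
have [gc gd gdd] : [/\ {for w, continuous g},
    forall i, is_derive w (e_ i) g (g1 i w) /\ {for w, continuous (g1 i)} &
    forall i j, is_derive w (e_ j) (g1 i) (g2 i j w) /\ {for w, continuous (g2 i j)}].
  by near: w.
split=> [|i|i j].
- exact: continuousD.
- have [? ?] := fd i; have [? ?] := gd i.
  by split; [exact: is_deriveD|exact: continuousD].
- have [? ?] := fdd i j; have [? ?] := gdd i j.
  by split; [exact: is_deriveD|exact: continuousD].
Unshelve. all: by end_near. Qed.

Lemma c2_mul f g v : c2_at f v -> c2_at g v -> c2_at (fun x => f x * g x) v.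
Proof.
move=> [f1 [f2 hf]] [g1 [g2 hg]].
exists (fun i w => f w * g1 i w + g w * f1 i w),
  (fun i j w => (f w * g2 i j w + g1 i w * f1 j w) + (g w * f2 i j w + f1 i w * g1 j w)).
near=> w.
have [fc fd fdd] : [/\ {for w, continuous f},
    forall i, is_derive w (e_ i) f (f1 i w) /\ {for w, continuous (f1 i)} &
    forall i j, is_derive w (e_ j) (f1 i) (f2 i j w) /\ {for w, continuous (f2 i j)}].
  by near: w.
have [gc gd gdd] : [/\ {for w, continuous g},
    forall i, is_derive w (e_ i) g (g1 i w) /\ {for w, continuous (g1 i)} &
    forall i j, is_derive w (e_ j) (g1 i) (g2 i j w) /\ {for w, continuous (g2 i j)}].
  by near: w.
split=> [|i|i j].
- exact: continuousM.
- have [fi fic] := fd i; have [gi gic] := gd i; split.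
    exact: is_deriveM.
  by apply: continuousD; apply: continuousM.
- have [fi fic] := fd i; have [gi gic] := gd i.
  have [fj fjc] := fd j; have [gj gjc] := gd j.
  have [fij fijc] := fdd i j; have [gij gijc] := gdd i j; split.
    by apply: is_deriveD; exact: is_deriveM.
  by apply: continuousD; apply: continuousD; apply: continuousM.
Unshelve. all: by end_near. Qed.

Lemma smooth2_cont (phi : R -> R) (t a : R) : is_derive t (1 : R) phi a -> {for t, continuous phi}.
Proof. by move=> [h _]; apply: differentiable_continuous; apply/derivable1_diffP. Qed.

Lemma c2_comp (phi : R -> R) f v : smooth2_at phi (f v) -> c2_at f v -> c2_at (fun x => phi (f x)) v.
Proof.
move=> [phi1 [phi2 hphi]] [f1 [f2 hf]].
exists (fun i w => phi1 (f w) * f1 i w),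
  (fun i j w => phi1 (f w) * f2 i j w + f1 i w * (phi2 (f w) * f1 j w)).
have fv : {for v, continuous f} by have [] := nbhs_singleton hf.
near=> w.
have [fc fd fdd] : [/\ {for w, continuous f},
    forall i, is_derive w (e_ i) f (f1 i w) /\ {for w, continuous (f1 i)} &
    forall i j, is_derive w (e_ j) (f1 i) (f2 i j w) /\ {for w, continuous (f2 i j)}].
  by near: w.
have [p1 p2 p2c] : [/\ is_derive (f w) (1 : R) phi (phi1 (f w)),
    is_derive (f w) (1 : R) phi1 (phi2 (f w)) & {for (f w), continuous phi2}].
  by near: w; exact: (fv _ hphi).
have c0 := continuous_comp fc (smooth2_cont p1).
have c1 := continuous_comp fc (smooth2_cont p2).
have c2 := continuous_comp fc p2c.
split=> [|i|i j].
- exact: c0.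
- have [fi fic] := fd i; split; first exact: is_derive_chain.
  exact: (continuousM c1 fic).
- have [fi fic] := fd i; have [fj fjc] := fd j; have [fij fijc] := fdd i j; split.
    apply: (@is_deriveM _ _ (phi1 \o f) (f1 i)) => //.
    exact: is_derive_chain.
  apply: (@continuousD _ _ _ (fun w => phi1 (f w) * f2 i j w) (fun w => f1 i w * (phi2 (f w) * f1 j w))).
    exact: (continuousM c1 fijc).
  exact: (continuousM fic (continuousM c2 fjc)).
Unshelve. all: by end_near. Qed.

Lemma c2_near_eq f g v : (\forall w \near v, f w = g w) -> c2_at f v -> c2_at g v.
Proof.
move=> fg [f1 [f2 hf]]; exists f1, f2.
have fg' := (near_join fg).
near=> w.
have [fc fd fdd] : [/\ {for w, continuous f},
    forall i, is_derive w (e_ i) f (f1 i w) /\ {for w, continuous (f1 i)} &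
    forall i j, is_derive w (e_ j) (f1 i) (f2 i j w) /\ {for w, continuous (f2 i j)}].
  by near: w.
have fgw : \forall x \near w, f x = g x by near: w.
split=> [|i|//].
- rewrite /prop_for /continuous_at -(nbhs_singleton fgw).
  exact: (cvg_trans (near_eq_cvg fgw) fc).
- by have [fi fic] := fd i; split=> //; apply: near_eq_is_derive fi.
Unshelve. all: by end_near. Qed.

Lemma c2_sum (I : Type) (r : seq I) (P : pred I) (F : I -> V -> R) v :
  (forall k, P k -> c2_at (F k) v) -> c2_at (fun x => \sum_(k <- r | P k) F k x) v.
Proof.
move=> hF; elim: r => [|k r IH].
  apply: (c2_near_eq (f := cst 0)); last exact: c2_cst.
  by near=> w; rewrite big_nil.
have [Pk|nPk] := boolP (P k).
  apply: (c2_near_eq (f := fun x => F k x + \sum_(k <- r | P k) F k x)).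
    by near=> w; rewrite big_cons Pk.
  by apply: c2_add => //; exact: hF.
apply: (c2_near_eq _ IH); by near=> w; rewrite big_cons (negPf nPk).
Unshelve. all: by end_near. Qed.

Lemma c2_dot (v : V) : c2_at (fun x => dot x x) v.
Proof.
apply: (@c2_sum _ (index_enum 'I_d) predT (fun k x => x 0 k * x 0 k)) => k _.
by apply: (@c2_mul (fun x => x 0 k) (fun x => x 0 k)); exact: c2_coord.
Qed.

Lemma c2_opp f v : c2_at f v -> c2_at (fun x => - f x) v.
Proof.
move=> hf; apply: (c2_near_eq (f := fun x => (-1) * f x)).
  by near=> w; rewrite mulN1r.
by apply: (@c2_mul (cst (-1)) f) => //; exact: c2_cst.
Unshelve. all: by end_near. Qed.

Lemma c2_sqrt f v : 0 < f v -> c2_at f v -> c2_at (fun x => Num.sqrt (f x)) v.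
Proof.
move=> f0 hf.
have fv : {for v, continuous f} by have [? [? /nbhs_singleton[]]] := hf.
apply: (c2_near_eq (f := fun x => (f x) `^ (2^-1))).
  near=> w; rewrite powR12_sqrt// ltW//.
  by near: w; apply: (fv [set t | 0 < t]); exact: lt_nbhsr.
by apply: (@c2_comp (fun t => t `^ 2^-1) f) => //; exact: smooth2_powR.
Unshelve. all: by end_near. Qed.

Lemma c2_enorm (v : V) : v != 0 -> c2_at (@enorm R d) v.
Proof.
move=> v0; apply: (c2_sqrt (f := fun x => dot x x)); last exact: c2_dot.
by rewrite -enorm_sqr exprn_gt0// enorm_gt0.
Qed.

End C2Fun.

Section Charts.
Variables (R : realType) (d n : nat).
Local Notation V := 'rV[R]_d.
Local Notation W := 'rV[R]_n.
Local Notation e_ i := (@unitv R d i).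
Implicit Types (phi : V -> W) (M : set W).

Lemma cvg_rowP (T : topologicalType) (F : set_system T) (FF : Filter F) (f : T -> W) (l : W) :
  (forall k, (fun x => f x 0 k) @ F --> l 0 k) -> f @ F --> l.
Proof.
move=> h; apply/cvgrPdist_lt => eps eps0.
have : \forall x \near F, forall k, `|l 0 k - f x 0 k| < eps.
  by apply: filter_forall => k; move/cvgrPdist_lt: (h k); apply.
apply: filterS => x hx; rewrite /Num.Def.normr/= mx_normrE.
apply/bigmax_ltP; split=> // -[i k] _; rewrite ord1 !mxE; exact: hx.
Qed.

Lemma continuous_rowP (f : V -> W) (v : V) :
  (forall k, {for v, continuous (fun x => f x 0 k)}) -> {for v, continuous f}.
Proof. by move=> h; exact: (@cvg_rowP _ (nbhs v) (nbhs_filter v) f (f v) h). Qed.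

Lemma is_derive_rowP (f : V -> W) (w u : V) (l : W) :
  (forall k, is_derive w u (fun x => f x 0 k) (l 0 k)) -> is_derive w u f l.
Proof.
move=> h; have df : derivable f w u.
  by apply/derivable_mxP => i k; rewrite ord1; have [] := h k.
apply: DeriveDef => //; rewrite derive_mx//; apply/rowP => k; rewrite mxE.
by have [_ ->] := h k.
Qed.

Lemma C2_onP phi (U : set V) : open U ->
  (forall v, U v -> forall k, c2_at (fun x => phi x 0 k) v) -> C2_on phi U.
Proof.
move=> oU hphi; split=> // v Uv.
have [f hf] : {f : 'I_n -> ('I_d -> V -> R) * ('I_d -> 'I_d -> V -> R) & forall k,
    \forall w \near v, [/\ {for w, continuous (fun x => phi x 0 k)},
    forall i, is_derive w (e_ i) (fun x => phi x 0 k) ((f k).1 i w) /\ {for w, continuous ((f k).1 i)} &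
    forall i j, is_derive w (e_ j) ((f k).1 i) ((f k).2 i j w) /\ {for w, continuous ((f k).2 i j)}]}.
  apply: (@choice _ _ (fun k f => \forall w \near v, [/\ {for w, continuous (fun x => phi x 0 k)},
    forall i, is_derive w (e_ i) (fun x => phi x 0 k) (f.1 i w) /\ {for w, continuous (f.1 i)} &
    forall i j, is_derive w (e_ j) (f.1 i) (f.2 i j w) /\ {for w, continuous (f.2 i j)}])) => k.
  by have [f1 [f2 h]] := hphi v Uv k; exists (f1, f2).
have {}hf : \forall w \near v, forall k, [/\ {for w, continuous (fun x => phi x 0 k)},
    forall i, is_derive w (e_ i) (fun x => phi x 0 k) ((f k).1 i w) /\ {for w, continuous ((f k).1 i)} &
    forall i j, is_derive w (e_ j) ((f k).1 i) ((f k).2 i j w) /\ {for w, continuous ((f k).2 i j)}].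
  exact: (filter_forall _ hf).
have d1 : \forall w \near v, forall i, is_derive w (e_ i) phi (\row_k (f k).1 i w).
  apply: filterS hf => w hw i; apply: is_derive_rowP => k; rewrite mxE.
  by have [_ /(_ i)[]] := hw k.
have p1 i : \forall w \near v, partial phi i w = \row_k (f k).1 i w.
  by apply: filterS d1 => w /(_ i)[_ <-].
have d2 i : \forall w \near v, forall j, is_derive w (e_ j) (partial phi i) (\row_k (f k).2 i j w).
  have pp := near_join (p1 i); near=> w => j.
  have pw : \forall x \near w, \row_k (f k).1 i x = partial phi i x.
    have : \forall x \near w, partial phi i x = \row_k (f k).1 i x by near: w.
    by apply: filterS => x ->.
  apply: (near_eq_is_derive pw); apply: is_derive_rowP => k.
  have -> : (fun x => (\row_k0 (f k0).1 i x) 0 k) = (f k).1 i by apply/funext => x; rewrite mxE.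
  rewrite mxE.
  have hk : [/\ {for w, continuous (fun x => phi x 0 k)},
    forall i, is_derive w (e_ i) (fun x => phi x 0 k) ((f k).1 i w) /\ {for w, continuous ((f k).1 i)} &
    forall i j, is_derive w (e_ j) ((f k).1 i) ((f k).2 i j w) /\ {for w, continuous ((f k).2 i j)}].
    by move: k; near: w.
  by have [_ _ /(_ i j)[]] := hk.
have p2 i j : \forall w \near v, partial (partial phi i) j w = \row_k (f k).2 i j w.
  by apply: filterS (d2 i) => w /(_ j)[_ <-].
split.
  apply: continuous_rowP => k; by have [] := nbhs_singleton hf k.
move=> i j; split; first by have [] := nbhs_singleton d1 i.
split; first by have [] := nbhs_singleton (d2 i) j.
rewrite /prop_for /continuous_at (nbhs_singleton (p2 i j)).
have eqp : \forall w \near v, \row_k (f k).2 i j w = partial (partial phi i) j w.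
  by apply: filterS (p2 i j) => w ->.
apply: (cvg_trans (near_eq_cvg eqp)).
apply: (@continuous_rowP (fun w => \row_k (f k).2 i j w)) => k.
have -> : (fun x => (\row_k0 (f k0).2 i j x) 0 k) = (f k).2 i j by apply/funext => x; rewrite mxE.
by have [_ _ /(_ i j)[]] := nbhs_singleton hf k.
Unshelve. all: by end_near. Qed.

Definition has_chart M (p : W) :=
  exists (U : set W) (V0 : set V) (phi : V -> W),
      [/\ open U, U p, C2_on phi V0,
          (forall v, V0 v -> immersive_at phi v) &
          [/\ (forall v w, V0 v -> V0 w -> phi v = phi w -> v = w),
          phi @` V0 = M `&` U &
          (forall V1, open V1 -> V1 `<=` V0 ->
             exists O, open O /\ phi @` V1 = M `&` U `&` O)]].

(** The chart has an affine left inverse, with linear part [b] and constant [c]. This single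
    condition yields injectivity, immersivity and a continuous inverse, hence all that the
    definition of a submanifold asks of a chart of class C2. *)
Definition graph_chart M (p : W) (U : set W) (V0 : set V) phi (b : 'I_d -> W) (c : V) :=
  [/\ open U /\ U p, open V0,
    (forall v, V0 v -> forall k, c2_at (fun x => phi x 0 k) v),
    (forall v k, V0 v -> dot (phi v) (b k) + c 0 k = v 0 k) &
    phi @` V0 = M `&` U].

Definition has_graph M p := exists U V0 phi b c, graph_chart M p U V0 phi b c.

Lemma has_graph_local M N p (O : set W) : open O -> O p -> M `&` O = N `&` O ->
  has_graph N p -> has_graph M p.
Proof.
move=> oO Op MN [U [V0 [phi [b [c [[oU Up] oV0 C2phi sec img]]]]]].
have MNO : M `&` (U `&` O) = N `&` U `&` O.
  by rewrite (setIC U) setIA MN -!setIA (setIC O).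
pose V1 := V0 `&` phi @^-1` O.
have V10 : V1 `<=` V0 by move=> v [].
have oV1 : open V1.
  rewrite openE => v [V0v Ov]; apply: filterI; first exact: open_nbhs_nbhs.
  have [_ /(_ v V0v)[cphi _]] := C2_onP oV0 C2phi.
  by apply: cphi; exact: open_nbhs_nbhs.
exists (U `&` O), V1, phi, b, c; split => //.
- by split; [exact: openI|].
- by move=> v /V10; exact: C2phi.
- by move=> v k /V10; exact: sec.
rewrite MNO; apply/seteqP; split=> [_ [v [V0v Ov] <-]|x [NUx Ox]].
  by split=> //; rewrite -img; exists v.
by move: NUx; rewrite -img => -[v V0v vx]; exists v => //; split=> //=; rewrite vx.
Qed.

Lemma has_graph_scale M p (s : R) : 0 < s -> has_graph M p ->
  has_graph ((fun x => s *: x) @` M) (s *: p).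
Proof.
move=> s0 [U [V0 [phi [b [c [[oU Up] oV0 C2phi sec img]]]]]].
have sK (x : W) : s *: (s^-1 *: x) = x by rewrite scalerA mulfV ?scale1r// gt_eqF.
have sK' (x : W) : s^-1 *: (s *: x) = x by rewrite scalerA mulVf ?scale1r// gt_eqF.
exists ((fun x => s^-1 *: x) @^-1` U), V0, (fun v => s *: phi v), (fun k => s^-1 *: b k), c.
split=> //.
- split; last by rewrite /= sK'.
  apply: open_comp => // x _; apply: (@lipschitz_continuous _ _ _ s^-1) => y z.
  by rewrite -scalerBr enormZ ger0_norm// invr_ge0 ltW.
- move=> v V0v k; apply: (c2_near_eq (f := fun x => cst s x * phi x 0 k)).
    by near=> w; rewrite mxE.
  by apply: (@c2_mul _ _ (cst s)); [exact: c2_cst|exact: C2phi].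
- by move=> v k V0v; rewrite dotZl dotZr mulVKf ?gt_eqF// sec.
apply/seteqP; split=> [_ [v V0v <-]|_ [[x Mx <-]] /=].
  have : (M `&` U) (phi v) by rewrite -img; exists v.
  by move=> [Mv Uv]; split=> /=; [exists (phi v)|rewrite sK'].
rewrite sK' => Ux; have : (M `&` U) x by [].
by rewrite -img => -[v V0v <-]; exists v.
Unshelve. all: by end_near. Qed.

Lemma has_graph_chart M p : has_graph M p -> has_chart M p.
Proof.
move=> [U [V0 [phi [b [c [[oU Up] oV0 C2phi sec img]]]]]]; exists U, V0, phi.
have C2 := C2_onP oV0 C2phi.
pose pr (x : W) : V := \row_k (dot x (b k) + c 0 k).
have prK v : V0 v -> pr (phi v) = v by move=> V0v; apply/rowP => k; rewrite mxE sec.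
have cpr : continuous pr.
  pose K := \sum_k enorm (b k).
  apply: (@lipschitz_continuous _ _ _ (d%:R * K)) => x y.
  apply: le_trans (enorm_le_mxnorm _) _; rewrite -mulrA ler_wpM2l//.
  rewrite /Num.Def.normr/= mx_normrE bigmax_le ?mulr_ge0 ?enorm_ge0 ?sumr_ge0//.
    by move=> k _; exact: enorm_ge0.
  move=> -[i k] _; rewrite ord1 !mxE opprD addrACA subrr addr0 -dotNl -dotDl.
  apply: le_trans (CauchySchwarz_abs _ _) _; rewrite mulrC ler_wpM2r ?enorm_ge0//.
  by rewrite /K (bigD1 k)//= lerDl sumr_ge0// => j _; exact: enorm_ge0.
(* Differentiating the section identity: the partial derivatives of [phi] are dual to the [b k],
   hence linearly independent. *)
have dphi v k i : V0 v -> dot (partial phi i v) (b k) = (k == i)%:R.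
  move=> V0v.
  have dpk l : is_derive v (e_ i) (fun x => phi x 0 l) (partial phi i v 0 l).
    have [_ /(_ v V0v)[_ /(_ i i)[dp _]]] := C2.
    have -> : partial phi i v 0 l = 'D_(e_ i) (fun x => phi x 0 l) v.
      by rewrite /partial derive_mx// mxE.
    by apply: DeriveDef => //; have /derivable_mxP := dp; apply.
  have h1 : is_derive v (e_ i) (fun x => dot (phi x) (b k) + c 0 k) (dot (partial phi i v) (b k) + 0).
    apply: is_deriveD.
    have -> : dot (partial phi i v) (b k) = \sum_l b k 0 l * partial phi i v 0 l.
      by apply: eq_bigr => l _; rewrite mulrC.
    rewrite /dot.
    have -> : (fun x => \sum_l phi x 0 l * b k 0 l) = \sum_l (b k 0 l *: (fun x => phi x 0 l)).
      by apply/funext => x; rewrite fct_sumE; apply: eq_bigr => l _; rewrite mulrC.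
    by apply: is_derive_sum => l; apply: is_deriveZ.
  have h2 : is_derive v (e_ i) (fun x => dot (phi x) (b k) + c 0 k) (e_ i 0 k).
    apply: (near_eq_is_derive (f := fun x : V => x 0 k)); last exact: is_derive_coord.
    have : \forall x \near v, V0 x by exact: open_nbhs_nbhs.
    by apply: filterS => x V0x; rewrite sec.
  have [_ e1] := h1; have [_] := h2; rewrite e1 addr0 => ->.
  by rewrite /unitv mxE eqxx.
split=> //.
- move=> v V0v a sa k; have := congr1 (fun x => dot x (b k)) sa; rewrite dot0l.
  have -> : dot (\sum_i a i *: partial phi i v) (b k) = \sum_i a i * dot (partial phi i v) (b k).
    elim/big_ind2 : _ => [|x1 x2 y1 y2 <- <-|i _]; by rewrite ?dot0l ?dotDl ?dotZl.
  rewrite (eq_bigr (fun i => a i * (k == i)%:R)) => [|i _]; last by rewrite (dphi v k i V0v).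
  rewrite (bigD1 k)//= eqxx mulr1 big1 ?addr0// => i ik.
  by rewrite eq_sym (negPf ik) mulr0.
- split=> //.
    by move=> v w V0v V0w vw; rewrite -(prK v V0v) vw prK.
  move=> V1 oV1 V10; exists (pr @^-1` V1); split.
    by apply: open_comp => // x _; exact: cpr.
  rewrite -img; apply/seteqP; split=> [_ [v V1v <-]|_ [[v V0v <-]] /=].
    by split=> /=; [exists v => //; exact: V10|rewrite prK//; exact: V10].
  by rewrite prK// => V1v; exists v.
Qed.
End Charts.

(** * A criterion for the reach and its behaviour under dilation *)

Section ReachCriterion.
Variables (R : realType) (n : nat).
Local Notation W := 'rV[R]_n.
Implicit Types (M : set W).

(** Only pairs of distinct points nearest to a common centre matter, and the distances are real
    numbers. Dilations are then a direct substitution. *)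
Definition reach_crit (rho : R) M := forall z p q D, M p -> M q -> p <> q ->
  enorm (p - z) = D -> enorm (q - z) = D -> (forall x, M x -> D <= enorm (x - z)) -> rho <= D.

Lemma edistE M z p : M p -> (forall x, M x -> enorm (p - z) <= enorm (x - z)) ->
  edist z M = (enorm (p - z))%:E.
Proof.
move=> Mp pmin; apply/eqP; rewrite eq_le; apply/andP; split.
  by apply: ereal_inf_lbound; exists p.
by apply: le_ereal_inf_tmp => _ [x Mx <-]; rewrite lee_fin pmin.
Qed.

Lemma edist_le_min M z p : (enorm (p - z))%:E = edist z M ->
  forall x, M x -> enorm (p - z) <= enorm (x - z).
Proof. by move=> pz x Mx; rewrite -lee_fin pz; apply: ereal_inf_lbound; exists x. Qed.

Lemma reach_critP rho M : reach_crit rho M -> (rho%:E <= reach M)%E.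
Proof.
move=> crit; apply: le_ereal_inf_tmp => _ [z [p [q [Mp Mq pq pz qz]]] <-].
have pmin := edist_le_min pz; rewrite -pz lee_fin; apply: (crit z p q) => //.
by apply: EFin_inj; rewrite pz qz.
Qed.

Lemma reach_crit_scale rho M (s : R) : 0 < s -> reach_crit rho M ->
  reach_crit (s * rho) ((fun x => s *: x) @` M).
Proof.
move=> s0 crit z _ _ D [p Mp <-] [q Mq <-] pq pD qD Dmin.
have E x : enorm (s *: x - z) = s * enorm (x - s^-1 *: z).
  have -> : s *: x - z = s *: (x - s^-1 *: z).
    by rewrite scalerBr scalerA mulfV ?scale1r// gt_eqF.
  by rewrite enormZ ger0_norm// ltW.
rewrite -ler_pdivlMl// mulrC; apply: (crit (s^-1 *: z) p q) => //.
- by move=> pq'; apply: pq; rewrite pq'.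
- by rewrite -pD E mulrAC mulfV ?mul1r// gt_eqF.
- by rewrite -qD E mulrAC mulfV ?mul1r// gt_eqF.
- by move=> x Mx; rewrite ler_pdivrMr// mulrC -E; apply: Dmin; exists x.
Qed.

Lemma manifold_class_scale (d : nat) rho M (s : R) : 0 < s -> compact M -> connected M ->
  (forall p, M p -> has_graph d M p) -> reach_crit rho M ->
  manifold_class d (s * rho) ((fun x => s *: x) @` M).
Proof.
move=> s0 cM coM gM rM.
have cs : continuous (fun x : W => s *: x).
  apply: (@lipschitz_continuous _ _ _ s) => y z.
  by rewrite -scalerBr enormZ ger0_norm// ltW.
split.
- by apply: continuous_compact => //; exact: continuous_subspaceT.
- by apply: connected_continuous_connected => //; exact: continuous_subspaceT.
- by move=> _ [p Mp <-]; apply: has_graph_chart; apply: has_graph_scale => //; exact: gM.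
- by apply: reach_critP; exact: reach_crit_scale.
Qed.

End ReachCriterion.

(** * Lattice paths *)

Section LatticePath.

(** A boustrophedon: the cube of dimension [j.+1] is swept layer by layer, each layer being run
    through in the direction opposite to that of the previous one. *)
Lemma nat_snake (N j : nat) : (0 < N)%N -> exists p : nat -> nat -> nat,
  [/\ forall i l, (i < N ^ j)%N -> (p i l < N)%N,
      forall i l, (j <= l)%N -> p i l = 0%N,
      forall i i', (i < N ^ j)%N -> (i' < N ^ j)%N -> (forall l, p i l = p i' l) -> i = i' &
      forall i, (i.+1 < N ^ j)%N -> exists l0, (p i.+1 l0 = (p i l0).+1 \/ p i l0 = (p i.+1 l0).+1) /\
        forall l, l <> l0 -> p i.+1 l = p i l].
Proof.
move=> N0; elim: j => [|j [p [pN p0 pinj pS]]].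
  by exists (fun _ _ => 0%N); split=> // -[|i] [|i'].
set K := (N ^ j)%N in pN pinj pS *.
have K0 : (0 < K)%N by rewrite expn_gt0 N0.
have NK : (N ^ j.+1 = N * K)%N by rewrite expnS.
(* In layers of odd number [q] the path of the layer is reversed, so that it starts above the point
   where the previous layer ended. *)
pose rf q r := if odd q then (K.-1 - r)%N else r.
have rfK q r : (r < K)%N -> (rf q r < K)%N by rewrite /rf; case: ifP => _; lia.
have rf_inj q r r' : (r < K)%N -> (r' < K)%N -> rf q r = rf q r' -> r = r'.
  by rewrite /rf; case: ifP => _; lia.
exists (fun i l => if l == j then (i %/ K)%N else p (rf (i %/ K) (i %% K))%N l).
have mK i : (i %% K < K)%N by rewrite ltn_mod.
split=> [i l|i l jl|i i' iN i'N h|i iN].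
- rewrite NK => iN; case: eqP => _; last by apply: pN; exact: rfK.
  by rewrite ltn_divLR.
- by rewrite gtn_eqF ?(ltnW jl)// p0// ltnW.
- have := h j; rewrite eqxx => hq.
  have hr : rf (i %/ K)%N (i %% K)%N = rf (i' %/ K)%N (i' %% K)%N.
    apply: pinj; [exact: rfK|exact: rfK|] => l.
    have [->|lj] := eqVneq l j; first by rewrite !p0.
    by have := h l; rewrite (negPf lj).
  rewrite (divn_eq i K) (divn_eq i' K) hq; congr (_ + _)%N.
  by apply: (rf_inj (i' %/ K)%N) => //; rewrite -hr hq.
- have [lt|ge] := ltnP (i %% K).+1 K.
    have iE : (i.+1 = i %/ K * K + (i %% K).+1)%N by rewrite addnS; congr S; exact: divn_eq.
    have dE : (i.+1 %/ K = i %/ K)%N by rewrite [in LHS]iE divnMDl// (divn_small lt) addn0.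
    have mE : (i.+1 %% K = (i %% K).+1)%N by rewrite [in LHS]iE modnMDl modn_small//.
    rewrite dE mE.
    have [l0 [hl0 hl]] : exists l0, (p (rf (i %/ K) (i %% K).+1)%N l0 = (p (rf (i %/ K) (i %% K))%N l0).+1 \/
        p (rf (i %/ K) (i %% K))%N l0 = (p (rf (i %/ K) (i %% K).+1)%N l0).+1) /\
        forall l, l <> l0 -> p (rf (i %/ K) (i %% K).+1)%N l = p (rf (i %/ K) (i %% K))%N l.
      rewrite /rf; case: ifP => _; last exact: pS.
      have [|l0 [h1 h2]] := pS (K.-1 - (i %% K).+1)%N; first by lia.
      have E : ((K.-1 - (i %% K).+1).+1 = K.-1 - i %% K)%N by lia.
      rewrite E in h1 h2; exists l0; split; first by case: h1; [right|left].
      by move=> l /h2.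
    have l0j : l0 <> j by move=> E; move: hl0; rewrite E !p0// => -[].
    exists l0; split; first by rewrite (negPf (introN eqP l0j)).
    by move=> l ll0; case: ifP => // _; exact: hl.
  (* The end of a layer: the reflection keeps the inner position, and only the coordinate [j]
     moves. *)
  have mE : (i %% K = K.-1)%N by have := mK i; lia.
  have iE : (i.+1 = (i %/ K).+1 * K)%N by rewrite mulSn; have := divn_eq i K; rewrite mE; lia.
  have dE : (i.+1 %/ K = (i %/ K).+1)%N by rewrite iE mulnK.
  have m0 : (i.+1 %% K = 0)%N by rewrite iE modnMl.
  exists j; rewrite dE m0 mE eqxx; split; first by left.
  move=> l /eqP/negPf ->; congr (p _ _); rewrite /rf /=; case: (odd _) => /=; lia.
Qed.

Variable R : realType.

Lemma lattice_snake (e j N : nat) (s : R) : 0 < s -> (0 < N)%N -> (j <= e)%N ->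
  exists h : nat -> 'rV[R]_e,
   [/\ forall i i', (i < N ^ j)%N -> (i' < N ^ j)%N -> i <> i' -> s <= enorm (h i - h i'),
       forall i, (i.+1 < N ^ j)%N -> enorm (h i.+1 - h i) = s &
       forall i, (i < N ^ j)%N -> enorm (h i) <= s * (N%:R * Num.sqrt j%:R)].
Proof.
move=> s0 N0 je; have [p [pN p0 pinj pS]] := nat_snake j N0.
exists (fun i => s *: \row_l (p i l)%:R); split.
- move=> i i' iN i'N ii'; rewrite -scalerBr enormZ gtr0_norm// ler_peMr//; first exact: ltW.
  have [l pl] : exists l, p i l <> p i' l.
    by apply/existsNP => h; apply: ii'; apply: pinj.
  have le : (l < e)%N.
    by rewrite ltnNge; apply/negP => el; apply: pl; rewrite !p0// (leq_trans je).
  apply: le_trans (coord_le_enorm _ (Ordinal le)); rewrite !mxE /=.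
  have [lt|gt|//] := ltngtP (p i l) (p i' l).
    by rewrite distrC -natrB ?(ltnW lt)// normr_nat ler1n subn_gt0.
  by rewrite -natrB ?(ltnW gt)// normr_nat ler1n subn_gt0.
- move=> i iN; rewrite -scalerBr enormZ gtr0_norm//.
  have [l0 [hl0 hl]] := pS i iN.
  have le : (l0 < e)%N.
    rewrite ltnNge; apply/negP => el; have jl := leq_trans je el.
    by move: hl0; rewrite !p0// => -[].
  suff -> : enorm (\row_l (p i.+1 l)%:R - \row_l (p i l)%:R : 'rV[R]_e) = 1 by rewrite mulr1.
  rewrite enorm_dot /dot (bigD1 (Ordinal le))//= big1 => [|l ll].
    rewrite !mxE/= addr0 -expr2; case: hl0 => ->.
      by rewrite -natr1 addrAC subrr add0r expr1n sqrtr1.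
    by rewrite -natr1 opprD addrA subrr add0r sqrrN expr1n sqrtr1.
  rewrite !mxE hl ?subrr ?mul0r// => E; move/eqP: ll; apply; exact: val_inj.
- move=> i iN; rewrite enormZ gtr0_norm// ler_pM2l//.
  rewrite -(ler_pXn2r (n := 2))// ?nnegrE ?mulr_ge0 ?enorm_ge0// enorm_sqr.
  rewrite exprMn sqr_sqrtr// /dot.
  rewrite (bigID (fun l : 'I_e => (l < j)%N))/= [X in _ + X]big1 ?addr0; last first.
    by move=> l; rewrite -leqNgt => jl; rewrite mxE p0// mul0r.
  apply: (@le_trans _ _ (\sum_(l < e | (l < j)%N) (N%:R ^+ 2 : R))).
    apply: ler_sum => l _; rewrite mxE -expr2 lerXn2r ?nnegrE// ler_nat ltnW//.
    exact: pN.
  rewrite (big_ord_narrow je) sumr_const card_ord -[leLHS]mulr_natr; exact: lexx.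
Qed.

End LatticePath.

(** * Towers *)

(* [lra] is much faster on a small context. *)
Ltac clear_props := repeat match goal with H : ?P |- _ => match type of P with Prop => clear H end end.
Tactic Notation "lra_using" ne_hyp_list(hs) := revert hs; clear_props; intros; lra.

(* [height] lists the heights of the flat discs, [half] is half of their number, and [rad] is the
   inner radius of the rims joining the discs [2i] and [2i+1].  The tunnels joining the discs [2i+1]
   and [2i+2] have inner radius [9/4], whence the second alternative of [rad_big]. *)
Record tower (R : realType) (e : nat) := Tower {
  height : nat -> 'rV[R]_e;
  half : nat;
  rad : R;
  half_gt0 : (0 < half)%N;
  rad_ge : 1 / 4 <= rad;
  rad_big : half = 1%N \/ 14 <= rad;
  height_sep : forall i j, (i < half.*2)%N -> (j < half.*2)%N -> i <> j ->
    3 <= enorm (height i - height j);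
  height_step : forall i, (i.+1 < half.*2)%N -> enorm (height i.+1 - height i) = 3 }.

Section Tower.
Variables (R : realType) (e : nat) (tw : tower R e).
Local Notation Y := 'rV[R]_e.
Local Notation h := (height tw).
Local Notation m := (half tw).
Local Notation b := (rad tw).
Implicit Types (i j k : nat) (r s z : R) (y : Y).

Definition mid i : Y := 2^-1 *: (h i + h i.+1).
Definition dir i : Y := 3^-1 *: (h i.+1 - h i).
(** The radius at which rims, beyond it, are cut apart from tunnels, within it. All the discs are
    flat in a neighbourhood of this radius. *)
Definition b0 : R := b / 2.

(** It vanishes on the flat part and equals 1 where the two sheets meet. The passage takes the width
    9/4: from [b] to [b + 9/4] on a rim, from 9/2 down to 9/4 on a tunnel. *)
Definition excess i r : R := pos (if odd i then (9 / 2 - r) * (4 / 9) else (r - b) * (4 / 9)).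

(* The cube of the positive part keeps the junction of a rim with a disc of class C2. *)
Definition profile i r y z := y = mid i + z *: dir i /\ (2 / 3 * z) ^+ 2 + excess i r ^+ 3 = 1.

Definition side i r := if odd i then r <= b0 else b0 <= r.

Definition turn i r y := [/\ (i.+1 < m.*2)%N, side i r & exists z, profile i r y z].

Definition bump (eta delta r : R) : R := eta * pos (1 - (r / delta) ^+ 2) ^+ 3.

Definition cap0 (eta delta r : R) y := r <= b0 /\ y = h 0%N + bump eta delta r *: dir 0%N.

Definition cap1 r y := r <= b0 /\ y = h (m.*2).-1.

Definition curve (eta delta r : R) y := (exists i, turn i r y) \/ cap0 eta delta r y \/ cap1 r y.

Lemma half2_gt1 : (1 < m.*2)%N.
Proof. by have := half_gt0 tw; case: (half tw) => // k _; rewrite doubleS. Qed.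

Lemma rad_gt0 : 0 < b. Proof. by have := rad_ge tw; lra. Qed.
Lemma b0_ge : 1 / 8 <= b0. Proof. by rewrite /b0; have := rad_ge tw; lra. Qed.

Lemma odd_rad i : odd i -> (i.+1 < m.*2)%N -> 14 <= b.
Proof. by case: (rad_big tw) => // ->; case: i => [|[|]]. Qed.

Lemma mid_dirN i : mid i - (3 / 2) *: dir i = h i.
Proof. by apply/rowP => k; rewrite !mxE; field. Qed.

Lemma mid_dirP i : mid i + (3 / 2) *: dir i = h i.+1.
Proof. by apply/rowP => k; rewrite !mxE; field. Qed.

Lemma enorm_dir i : (i.+1 < m.*2)%N -> enorm (dir i) = 1.
Proof. by move=> im; rewrite enormZ height_step// gtr0_norm ?invr_gt0// mulVf. Qed.

Lemma dot_dir i : (i.+1 < m.*2)%N -> dot (dir i) (dir i) = 1.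
Proof. by move=> im; rewrite -enorm_sqr enorm_dir ?expr1n. Qed.

Lemma excess_ge0 i r : 0 <= excess i r. Proof. exact: pos_ge0. Qed.

Lemma profile_bounds i r y z : profile i r y z -> `|z| <= 3 / 2 /\ excess i r <= 1.
Proof.
move=> [_ pz]; have u0 := excess_ge0 i r.
have u30 : 0 <= excess i r ^+ 3 by rewrite exprn_ge0.
split.
  have z2 : z ^+ 2 <= (3 / 2) ^+ 2 by move: pz u30; set u := excess i r ^+ 3; move=> pz u30; lra.
  by rewrite -(ler_pXn2r (n := 2)) ?nnegrE// real_normK ?num_real.
rewrite -(ler_pXn2r (n := 3))// ?nnegrE// expr1n.
by have := sqr_ge0 (2 / 3 * z); lra.
Qed.

Lemma bilinear_dist (P P' Q Q' : Y) (s t : R) :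
  let y := (1 - s) *: P + s *: P' in let y' := (1 - t) *: Q + t *: Q' in
  enorm (y - y') ^+ 2 = (1 - s) * (1 - t) * enorm (P - Q) ^+ 2 + (1 - s) * t * enorm (P - Q') ^+ 2
    + s * (1 - t) * enorm (P' - Q) ^+ 2 + s * t * enorm (P' - Q') ^+ 2
    - s * (1 - s) * enorm (P - P') ^+ 2 - t * (1 - t) * enorm (Q - Q') ^+ 2.
Proof.
move=> y y'; rewrite !enorm_sqr /y /y' !dotE.
rewrite (dotC P' P) (dotC Q P) (dotC Q' P) (dotC Q P') (dotC Q' P') (dotC Q' Q); ring.
Qed.

(** The four weighted distances contribute at least 9, and each of the two edges takes away at most
    9/4. There remains 9/2, more than 4.41. The value 21/10 exceeds 2, the largest distance of two
    points nearest to a centre within the reach, and leaves a margin for the bump. *)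
Lemma edges_far (P P' Q Q' : Y) (s t : R) : 0 <= s <= 1 -> 0 <= t <= 1 ->
  enorm (P - P') <= 3 -> enorm (Q - Q') <= 3 ->
  3 <= enorm (P - Q) -> 3 <= enorm (P - Q') -> 3 <= enorm (P' - Q) -> 3 <= enorm (P' - Q') ->
  (21 / 10) ^+ 2 < enorm (((1 - s) *: P + s *: P') - ((1 - t) *: Q + t *: Q')) ^+ 2.
Proof.
move=> /andP[s0 s1] /andP[t0 t1] pp qq p1 p2 p3 p4; rewrite bilinear_dist.
have sq3 (u : R) : 3 <= u -> 9 <= u ^+ 2 by move=> ?; nra.
have sq3' (u : R) : 0 <= u -> u <= 3 -> u ^+ 2 <= 9 by move=> ? ?; nra.
have s1' : 0 <= 1 - s by rewrite subr_ge0.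
have t1' : 0 <= 1 - t by rewrite subr_ge0.
have h1 := ler_wpM2l (mulr_ge0 s1' t1') (sq3 _ p1).
have h2 := ler_wpM2l (mulr_ge0 s1' t0) (sq3 _ p2).
have h3 := ler_wpM2l (mulr_ge0 s0 t1') (sq3 _ p3).
have h4 := ler_wpM2l (mulr_ge0 s0 t0) (sq3 _ p4).
have h5 := ler_wpM2l (mulr_ge0 s0 s1') (sq3' _ (enorm_ge0 _) pp).
have h6 := ler_wpM2l (mulr_ge0 t0 t1') (sq3' _ (enorm_ge0 _) qq).
have hs : s * (1 - s) <= 1 / 4 by have := sqr_ge0 (s - 1 / 2); nra.
have ht : t * (1 - t) <= 1 / 4 by have := sqr_ge0 (t - 1 / 2); nra.
lra.
Qed.

(* Every point of the curve sits over a vertex or an edge of the chain. *)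
Definition over i j y := exists2 s, 0 <= s <= 1 & y = (1 - s) *: h i + s *: h j.

Definition link i j := [/\ (i < m.*2)%N, (j < m.*2)%N & enorm (h i - h j) <= 3].

Lemma link_edge i : (i.+1 < m.*2)%N -> link i i.+1.
Proof. by move=> im; split=> //; [exact: ltnW|rewrite enormB height_step]. Qed.

Lemma link_vertex i : (i < m.*2)%N -> link i i.
Proof. by move=> im; split=> //; rewrite subrr enorm0. Qed.

Lemma over_vertex i : over i i (h i).
Proof. by exists 0; rewrite ?lexx ?ler01// subr0 scale1r scale0r addr0. Qed.

Lemma over_profile i r y z : profile i r y z -> over i i.+1 y.
Proof.
move=> pz; have [zb _] := profile_bounds pz; case: pz => -> _.
exists ((z + 3 / 2) / 3); first by move: zb; rewrite ler_norml => /andP[z1 z2]; apply/andP; split; lra.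
by apply/rowP => k; rewrite !mxE; field.
Qed.

Lemma over_far i j i' j' y y' : link i j -> link i' j' -> over i j y -> over i' j' y' ->
  i <> i' -> i <> j' -> j <> i' -> j <> j' -> 21 / 10 < enorm (y - y').
Proof.
move=> [im jm ij] [i'm j'm ij'] [s s01 ->] [t t01 ->] n1 n2 n3 n4.
rewrite -(ltr_pXn2r (n := 2)) ?nnegrE ?enorm_ge0//.
by apply: edges_far => //; exact: height_sep.
Qed.

Lemma excess_even i r : ~~ odd i -> r <= b -> excess i r = 0.
Proof. by move=> /negPf oi rb; rewrite /excess oi pos_0//; lra. Qed.

Lemma excess_odd i r : odd i -> 9 / 2 <= r -> excess i r = 0.
Proof. by move=> oi rb; rewrite /excess oi pos_0//; lra. Qed.

Lemma profile_flat i r : excess i r = 0 ->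
  profile i r (h i) (- (3 / 2)) /\ profile i r (h i.+1) (3 / 2).
Proof.
move=> e0; rewrite /profile e0 expr0n/= addr0 -mid_dirN -mid_dirP scaleNr.
by split; split => //; field.
Qed.

Lemma profile_flat_inv i r y z : excess i r = 0 -> profile i r y z ->
  (y = h i /\ z = - (3 / 2)) \/ (y = h i.+1 /\ z = 3 / 2).
Proof.
move=> e0 [-> ]; rewrite e0 expr0n/= addr0 => z2.
have /eqP : (z - 3 / 2) * (z + 3 / 2) = 0 by move: z2; nra.
rewrite mulf_eq0 subr_eq0 addr_eq0 => /orP[/eqP->|/eqP->]; [right|left].
  by rewrite mid_dirP.
by rewrite scaleNr mid_dirN.
Qed.

Definition close r r' y y' := (r - r') ^+ 2 + enorm (y - y') ^+ 2 < (21 / 10) ^+ 2.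

Lemma close_sym r r' y y' : close r r' y y' -> close r' r y' y.
Proof. by rewrite /close enormB -(opprB r) sqrrN. Qed.

Lemma close_r r r' y y' : close r r' y y' -> `|r - r'| < 21 / 10.
Proof.
move=> c; rewrite -(ltr_pXn2r (n := 2)) ?nnegrE// real_normK ?num_real//.
by apply: le_lt_trans c; rewrite lerDl sqr_ge0.
Qed.

Lemma close_y r r' y y' : close r r' y y' -> enorm (y - y') < 21 / 10.
Proof.
move=> c; rewrite -(ltr_pXn2r (n := 2)) ?nnegrE ?enorm_ge0//.
by apply: le_lt_trans c; rewrite lerDr sqr_ge0.
Qed.

Lemma close_vertex i j : (i < m.*2)%N -> (j < m.*2)%N -> enorm (h i - h j) < 21 / 10 -> i = j.
Proof.
move=> im jm c; apply: contrapT => ij; have := height_sep im jm ij; move: c; lra.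
Qed.

(** A rim and a tunnel that follow each other share one disc. Two close points taken on each of them
    must be on the flat part of that disc, and may then be regarded as points of one and the same
    turn. *)
Lemma adjacent_profile i r r' y y' z z' : (i.+2 < m.*2)%N -> side i r -> side i.+1 r' ->
  profile i r y z -> profile i.+1 r' y' z' -> close r r' y y' ->
  [/\ y = h i.+1, y' = h i.+1, excess i r = 0, excess i.+1 r' = 0 & exists k w, [/\ (k.+1 < m.*2)%N,
     profile k r y w, profile k r' y' w, excess k r = 0 & excess k r' = 0]].
Proof.
move=> im si si' pz pz' c; have := close_r c; rewrite ltr_norml => /andP[c1 c2].
have im1 := ltnW im.
(* The constant 14: the radii lie on either side of [b / 2] and differ by less than 21/10. With
   [b >= 14] both are between 9/2 and [b], where tunnels and rims are flat. *)
have [b14 e0 e0'] : [/\ 14 <= b, excess i r = 0 & excess i.+1 r' = 0].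
  move: si si'; rewrite /side /=; case: (boolP (odd i)) => oi /= si si'.
    have b14 := odd_rad oi im1; rewrite /b0 in si si'; split=> //.
      by apply: excess_odd => //; lra.
    by apply: excess_even; rewrite /= ?oi//; lra.
  have b14 : 14 <= b by apply: (@odd_rad i.+1).
  rewrite /b0 in si si'; split=> //; first by apply: excess_even => //; lra.
  by apply: excess_odd => //=; lra.
have [yE y'E] : y = h i.+1 /\ y' = h i.+1.
  have cy := close_y c.
  case: (profile_flat_inv e0 pz) => -[yE _]; case: (profile_flat_inv e0' pz') => -[y'E _];
    move: cy; rewrite yE y'E => cy.
  - have := close_vertex (ltnW im1) im1 cy; lia.
  - have := close_vertex (ltnW im1) im cy; lia.
  - by [].
  - have := close_vertex im1 im cy; lia.
split=> //; rewrite yE y'E.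
move: si si'; rewrite /side /= /b0; case: (boolP (odd i)) => oi /= si si'.
  have e1 : excess i.+1 r = 0 by apply: excess_even; rewrite /= ?oi//; lra.
  exists i.+1, (- (3 / 2)); split=> //; exact: (proj1 (profile_flat _)).
have e1 : excess i r' = 0 by apply: excess_even => //; lra.
by exists i, (3 / 2); split=> //; exact: (proj2 (profile_flat _)).
Qed.

(** Over the first and the last vertex only the edges number 0 and [m.*2.-2] arrive. Both are even,
    hence rims, flat within the radius of the caps; every other edge is far. *)
Lemma cap_edge k i r r' y z : (k = 0 \/ k = (m.*2).-1)%N -> r <= b0 -> (i.+1 < m.*2)%N ->
  profile i r' y z -> enorm (h k - y) < 21 / 10 -> excess i r = 0 /\ exists w, profile i r (h k) w.
Proof.
move=> kE rb im pz c; have m1 := half2_gt1.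
have km : (k < m.*2)%N by case: kE => ->; lia.
have [ki|ki] : (k = i \/ k = i.+1) \/ (k <> i /\ k <> i.+1) by lia.
  have oi : ~~ odd i.
    have [->//|E] : i = 0%N \/ i.+2 = m.*2 by lia.
    by have := congr1 odd E; rewrite odd_double /= negbK => ->.
  have e0 : excess i r = 0.
    by apply: excess_even => //; move: rb; rewrite /b0; have := rad_gt0; lra.
  split=> //; have [p1 p2] := profile_flat e0.
  by case: ki => ->; [exists (- (3 / 2))|exists (3 / 2)].
exfalso; have := over_far (link_vertex km) (link_edge im) (over_vertex k) (over_profile pz).
by case: ki => k1 k2 /(_ k1 k2 k1 k2); move: c; lra.
Qed.

Lemma bump0 delta r : bump 0 delta r = 0. Proof. by rewrite /bump mul0r. Qed.

Lemma curve0_cases delta r y : curve 0 delta r y ->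
  (exists i z, [/\ (i.+1 < m.*2)%N, side i r & profile i r y z]) \/
  (exists k, [/\ (k = 0 \/ k = (m.*2).-1)%N, r <= b0 & y = h k]).
Proof.
case=> [[i [im si [z pz]]]|[[rb ->]|[rb ->]]]; first by left; exists i, z.
  by right; exists 0%N; split=> //; [left|rewrite bump0 scale0r addr0].
by right; exists (m.*2).-1; split=> //; right.
Qed.

(** Moving a point to the turn of its neighbour loses the side on which it really lies. This keeps
    its true position, for which the first-order condition is available. *)
Definition flat_point r y :=
  (exists k, [/\ (k = 0 \/ k = (m.*2).-1)%N, r <= b0 & y = h k]) \/
  (exists i z, [/\ (i.+1 < m.*2)%N, side i r, profile i r y z & excess i r = 0]).

(** It reduces the reach of the tower without bump to a planar question: two close points satisfy
    the equation of one turn, in the variables [r] and [z]. *)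
Lemma common_profile delta r r' y y' : curve 0 delta r y -> curve 0 delta r' y' ->
  close r r' y y' ->
  exists i, (i.+1 < m.*2)%N /\ exists z z', [/\ profile i r y z, profile i r' y' z',
    side i r \/ (excess i r = 0 /\ flat_point r y) &
    side i r' \/ (excess i r' = 0 /\ flat_point r' y')].
Proof.
move=> /curve0_cases[[i [z [im si pz]]]|[k [kE rb ->]]]
       /curve0_cases[[j [z' [jm sj pz']]]|[l [lE rb' ->]]] c.
- have [ij|[ij|[ij|ij]]] : i = j \/ (j = i.+1 \/ (i = j.+1 \/
      (i <> j /\ i <> j.+1 /\ i.+1 <> j /\ i.+1 <> j.+1))) by lia.
  + by rewrite -ij in jm sj pz' *; exists i; split=> //; exists z, z'; split=> //; left.
  + rewrite ij in jm sj pz'.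
    have [_ _ ei ej [k [w [km p1 p2 e1 e2]]]] := adjacent_profile jm si sj pz pz' c.
    exists k; split=> //; exists w, w; split=> //; right; split=> //; right.
      by exists i, z.
    by exists i.+1, z'.
  + rewrite ij in im si pz.
    have [_ _ ei ej [k [w [km p1 p2 e1 e2]]]] := adjacent_profile im sj si pz' pz (close_sym c).
    exists k; split=> //; exists w, w; split=> //; right; split=> //; right.
      by exists j.+1, z.
    by exists j, z'.
  + exfalso; case: ij => n1 [n2 [n3 n4]].
    have := over_far (link_edge im) (link_edge jm) (over_profile pz) (over_profile pz') n1 n2 n3 n4.
    have := close_y c; lra.
- have [|e0 [w pw]] := cap_edge (i := i) (r := r') (r' := r) (z := z) (y := y) lE rb' im pz.
    by have := close_y (close_sym c).
  exists i; split=> //; exists z, w; split=> //; first by left.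
  by right; split=> //; left; exists l.
- have [|e0 [w pw]] := cap_edge (i := j) (r := r) (r' := r') (z := z') (y := y') kE rb jm pz'.
    exact: close_y c.
  exists j; split=> //; exists w, z'; split=> //; last by left.
  by right; split=> //; left; exists k.
have m1 := half2_gt1.
have kl : k = l.
  by apply: close_vertex (close_y c); [case: kE => ->; lia|case: lE => ->; lia].
have bb := rad_gt0; rewrite /b0 in rb rb'.
have [i [im oi ik]] : exists i, [/\ (i.+1 < m.*2)%N, ~~ odd i & k = i \/ k = i.+1].
  case: kE => ->; first by exists 0%N; split=> //; left.
  exists (m.*2).-2; split; [lia| |right; lia].
  have E : (m.*2.-2.+2 = m.*2)%N by lia.
  by have := congr1 odd E; rewrite odd_double /= negbK => ->.
have er : excess i r = 0 by apply: excess_even => //; lra.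
have er' : excess i r' = 0 by apply: excess_even => //; lra.
have [w [p1 p2]] : exists w, profile i r (h k) w /\ profile i r' (h k) w.
  have [p1 p2] := profile_flat er; have [p1' p2'] := profile_flat er'.
  by case: ik => ->; [exists (- (3 / 2))|exists (3 / 2)].
exists i; split=> //; exists w, w; rewrite -kl; split=> //; right; split=> //; left.
  by exists k.
by exists k; split=> //; rewrite kl.
Qed.

End Tower.

(** * Reach of a tower *)

Section Reach.
Variables (R : realType) (e : nat) (tw : tower R e) (eta delta : R).
Local Notation Y := 'rV[R]_e.
Local Notation h := (height tw).
Local Notation m := (half tw).
Local Notation b := (rad tw).
Local Notation b0 := (b0 tw).
Local Notation mid := (mid tw).
Local Notation dir := (dir tw).
Local Notation excess := (excess tw).
Local Notation profile := (profile tw).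
Local Notation side := (side tw).
Local Notation curve := (curve tw eta delta).
Local Notation psi := (bump eta delta).
Implicit Types (i j k : nat) (r s z t : R) (y : Y).

Definition epsi i : R := if odd i then -1 else 1.
(** With [grad_z], the gradient of the function whose level set 1 is the profile. *)
Definition grad_r i r := 4 / 3 * (epsi i * excess i r ^+ 2).
Definition grad_z z : R := 8 / 9 * z.

Lemma excess_affine i r r' : exists t, excess i r = pos t /\
  excess i r' = pos (t + 4 / 9 * epsi i * (r' - r)).
Proof.
rewrite /excess /epsi; case: (odd i).
  by exists ((9 / 2 - r) * (4 / 9)); split=> //; congr pos; lra.
by exists ((r - b) * (4 / 9)); split=> //; congr pos; lra.
Qed.

Lemma epsi_sqr i : epsi i ^+ 2 = 1.
Proof. by rewrite /epsi; case: odd; rewrite ?sqrrN expr1n. Qed.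

(** Both points are on one level set, so the linear term equals minus the remainder. The latter has
    coefficient 4/9 in [z] and at most 3 times 16/81 in [r]; both are at most 16/27. *)
Lemma profile_taylor i r r' y y' z z' : profile i r y z -> profile i r' y' z' ->
  `|grad_r i r * (r' - r) + grad_z z * (z' - z)| <= 16 / 27 * ((r' - r) ^+ 2 + (z' - z) ^+ 2).
Proof.
move=> pz pz'; have [_ u1] := profile_bounds pz; have [_ u1'] := profile_bounds pz'.
case: pz pz' => _ e1 [_ e2]; have [t [E1 E2]] := excess_affine i r r'.
have := epsi_sqr i; rewrite /grad_r /grad_z.
rewrite E1 E2 in u1 u1' e1 e2 *; move: (epsi i) u1' e2 E2 => ep u1' e2 E2 ep2.
have := pos3_taylor t (4 / 9 * ep * (r' - r)).
have := pos_ge0 t; have := pos_ge0 (t + 4 / 9 * ep * (r' - r)).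
move: u1 u1' e1 e2; move: (pos t) (pos (t + _)) => u u' u1 u1' e1 e2 u0' u0.
have -> : (4 / 9 * ep * (r' - r)) ^+ 2 = 16 / 81 * (r' - r) ^+ 2.
  rewrite (_ : _ ^+ 2 = 16 / 81 * ep ^+ 2 * (r' - r) ^+ 2); last by field.
  by rewrite ep2 mulr1.
have hq : (2 * u + u') * (16 / 81 * (r' - r) ^+ 2) <= 3 * (16 / 81 * (r' - r) ^+ 2).
  by apply: ler_wpM2r; [rewrite mulr_ge0 ?sqr_ge0|lra].
move=> /andP[h1 h2]; have dz2 := sqr_ge0 (z' - z); have dr2 := sqr_ge0 (r' - r).
rewrite ler_norml; apply/andP; split; lra.
Qed.

Lemma grad_lower i r y z : profile i r y z ->
  229 / 144 <= grad_r i r ^+ 2 + grad_z z ^+ 2.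
Proof.
move=> pz; have [_ u1] := profile_bounds pz; have u0 := excess_ge0 tw i r; case: pz => _ e1.
rewrite /grad_r /grad_z !exprMn epsi_sqr mul1r; move: (excess i r) u0 u1 e1 => u u0 u1 e1.
have z2 : z ^+ 2 = 9 / 4 * (1 - u ^+ 3) by move: e1; lra.
(* The squared norm is 16/9 (u^4 - u^3 + 1), minimal at u = 3/4: indeed u^4 - u^3 + 27/256 is the
   product of [(u - 3 / 4) ^+ 2] and [u ^+ 2 + u / 2 + 3 / 16]. *)
rewrite z2; have := mulr_ge0 (sqr_ge0 (u - 3 / 4)) (_ : 0 <= u ^+ 2 + u / 2 + 3 / 16).
have u2 := sqr_ge0 u; have pq : 0 <= u ^+ 2 + u / 2 + 3 / 16 by lra.
move=> /(_ pq); lra.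
Qed.

Section FirstOrder.
Variables (A : R) (zeta : Y) (r : R) (y : Y).
Hypothesis min_ry : forall r' y', 0 <= r' -> curve r' y' ->
  (r - A) ^+ 2 + enorm (y - zeta) ^+ 2 <= (r' - A) ^+ 2 + enorm (y' - zeta) ^+ 2.

(** If the curve follows the direction [(alpha, beta)] up to an error of second order, minimality
    forbids a positive scalar product with the vector towards the centre. No parametrization has to
    be differentiated. *)
Lemma first_order (alpha : R) (beta : Y) (C tau : R) : 0 < tau -> 0 <= C ->
  (forall t, 0 < t -> t < tau -> exists r' y', [/\ 0 <= r', curve r' y',
     `|r' - r - t * alpha| <= C * t ^+ 2 & enorm (y' - y - t *: beta) <= C * t ^+ 2]) ->
  (A - r) * alpha + dot (zeta - y) beta <= 0.
Proof.
move=> tau0 C0 near; rewrite leNgt; apply/negP => S0.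
set S := _ + _ in S0.
pose K := 2 * (`|A - r| + enorm (zeta - y)) * C + (`|alpha| + C) ^+ 2 + (enorm beta + C) ^+ 2.
have K0 : 0 <= K.
  apply: addr_ge0; last exact: sqr_ge0.
  apply: addr_ge0; last exact: sqr_ge0.
  by apply: mulr_ge0 => //; apply: mulr_ge0 => //; apply: addr_ge0 => //; exact: enorm_ge0.
(* [K] collects the second-order terms. Minimality gives [2 * S <= t * K], contrary to
   [t * (K + 1) <= S]. *)
pose t := Num.min (tau / 2) (Num.min 1 (S / (K + 1))).
have K1 : 0 < K + 1 by rewrite ltr_wpDl.
have t0 : 0 < t by rewrite !lt_min ltr01 !divr_gt0.
have t1 : t <= 1 by rewrite !ge_min lexx !orbT.
have tK : t * (K + 1) <= S by rewrite -ler_pdivlMr// !ge_min lexx !orbT.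
have ttau : t < tau by apply: (@le_lt_trans _ _ (tau / 2)); [rewrite ge_min lexx|lra].
have [r' [y' [r'0 cr' hr hy]]] := near t t0 ttau.
have := min_ry r'0 cr'.
set e1 := r' - r - t * alpha in hr; set e2 := y' - y - t *: beta in hy.
have -> : r' - A = (r - A) + (t * alpha + e1) by rewrite /e1; ring.
have -> : y' - zeta = (y - zeta) + (t *: beta + e2).
  by rewrite /e2; apply/rowP => k; rewrite !mxE; ring.
have enD (u v : Y) : enorm (u + v) ^+ 2 = enorm u ^+ 2 + 2 * dot u v + enorm v ^+ 2.
  by rewrite !enorm_sqr !dotE (dotC v u); ring.
have enD' : enorm (y - zeta + (t *: beta + e2)) ^+ 2 = enorm (y - zeta) ^+ 2 +
    2 * (t * dot (y - zeta) beta + dot (y - zeta) e2) + enorm (t *: beta + e2) ^+ 2.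
  by rewrite enD dotDr dotZr.
rewrite enD' => ineq.
have n1 : `|t * alpha + e1| <= t * (`|alpha| + C).
  apply: le_trans (ler_normD _ _) _; rewrite normrM gtr0_norm// mulrDr lerD2l.
  apply: le_trans hr _; rewrite expr2 mulrA mulrC ler_pM2l// ler_piMr//.
have n2 : enorm (t *: beta + e2) <= t * (enorm beta + C).
  apply: le_trans (enormD _ _) _; rewrite enormZ gtr0_norm// mulrDr lerD2l.
  apply: le_trans hy _; rewrite expr2 mulrA mulrC ler_pM2l// ler_piMr//.
have q1 : (t * alpha + e1) ^+ 2 <= t ^+ 2 * (`|alpha| + C) ^+ 2.
  by rewrite -real_normK ?num_real// -exprMn lerXn2r ?nnegrE ?mulr_ge0 ?addr_ge0// ltW.
have q2 : enorm (t *: beta + e2) ^+ 2 <= t ^+ 2 * (enorm beta + C) ^+ 2.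
  rewrite -exprMn lerXn2r ?nnegrE ?enorm_ge0//.
  by rewrite mulr_ge0 ?addr_ge0 ?enorm_ge0// ltW.
have q3 : (r - A) * e1 <= `|A - r| * (C * t ^+ 2).
  apply: le_trans (ler_norm _) _; rewrite normrM distrC ler_wpM2l//.
have q4 : dot (y - zeta) e2 <= enorm (zeta - y) * (C * t ^+ 2).
  by apply: le_trans (CauchySchwarz _ _) _; rewrite enormB ler_wpM2l ?enorm_ge0.
have SE : S = - ((r - A) * alpha + dot (y - zeta) beta).
  by rewrite /S -(opprB y) dotNl; ring.
have fin : 2 * t * S <= t ^+ 2 * K.
  rewrite SE /K; move: ineq q1 q2 q3 q4.
  have -> : (r - A + (t * alpha + e1)) ^+ 2 = (r - A) ^+ 2 + 2 * ((r - A) * (t * alpha) + (r - A) * e1)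
    + (t * alpha + e1) ^+ 2 by ring.
  move: (enorm (t *: beta + e2) ^+ 2) ((t * alpha + e1) ^+ 2) (enorm _ ^+ 2) => X1 X2 X3.
  move: ((`|alpha| + C) ^+ 2) ((enorm beta + C) ^+ 2) => X4 X5; lra.
have : 2 * S <= t * K.
  by rewrite -(ler_pM2l t0); move: fin; lra.
by move: tK S0 t0; lra.
Qed.

End FirstOrder.

Definition phi (x : R) := pos (1 - x ^+ 2) ^+ 3.
Definition dphi (x : R) := - 6 * x * pos (1 - x ^+ 2) ^+ 2.
Definition dpsi r := eta * (dphi (r / delta) / delta).

Lemma pos1_bounds (x : R) : 0 <= pos (1 - x ^+ 2) <= 1.
Proof.
rewrite pos_ge0/=; have := sqr_ge0 x; case: (pos_cases (1 - x ^+ 2)) => -[p0 ->]; lra.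
Qed.

Lemma phi_bounds x : 0 <= phi x <= 1.
Proof.
have /andP[v0 v1] := pos1_bounds x.
by rewrite /phi exprn_ge0//= exprn_ile1.
Qed.

Lemma phi_out x : 1 <= x -> phi x = 0.
Proof. by move=> x1; rewrite /phi pos_0 ?expr0n//; nra. Qed.

Lemma dphi_out x : 1 <= x -> dphi x = 0.
Proof. by move=> x1; rewrite /dphi pos_0 ?expr0n ?mulr0//; nra. Qed.

Lemma dphi_le x : 0 <= x -> `|dphi x| <= 6 * x.
Proof.
move=> x0; have /andP[v0 v1] := pos1_bounds x.
rewrite /dphi normrM (ger0_norm (sqr_ge0 (pos _))) normrM normrN (ger0_norm x0) ger0_norm//.
by rewrite ler_piMr ?mulr_ge0// exprn_ile1.
Qed.

Lemma dphi_le6 x : 0 <= x -> `|dphi x| <= 6.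
Proof.
move=> x0; have [x1|/ltW x1] := leP x 1; last by rewrite dphi_out ?normr0.
by apply: le_trans (dphi_le x0) _; lra.
Qed.

(** The remainder of the cube contributes 48, from [(x + x') ^+ 2 <= 16] and three positive parts at
    most 1. Replacing [x ^+ 2 - x' ^+ 2] by its linear part contributes 3. Large arguments are
    separate cases, where [phi] vanishes. *)
Lemma phi_taylor x x' : 0 <= x -> 0 <= x' ->
  `|phi x' - phi x - dphi x * (x' - x)| <= 51 * (x' - x) ^+ 2.
Proof.
move=> x0 x0'; have /andP[p0 p1] := phi_bounds x; have /andP[p0' p1'] := phi_bounds x'.
have d6 := dphi_le6 x0; have s0 := sqr_ge0 (x' - x).
have [x1|x1] := leP 1 x; have [x1'|x1'] := leP 1 x'.
- by rewrite (phi_out x1) (phi_out x1') (dphi_out x1) mul0r !subr0 normr0; lra.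
- rewrite (phi_out x1) (dphi_out x1) mul0r !subr0 ger0_norm//.
  have [x2|x2] := leP 2 x; first by nra.
  have := pos3_taylor (1 - x ^+ 2) (x ^+ 2 - x' ^+ 2).
  rewrite (_ : 1 - x ^+ 2 + (x ^+ 2 - x' ^+ 2) = 1 - x' ^+ 2); last by ring.
  rewrite (@pos_0 _ (1 - x ^+ 2)); last by nra.
  rewrite -/(phi x') !expr0n/= !mulr0 mul0r !subr0 add0r => /andP[_ h].
  apply: le_trans h _; have /andP[v0 v1] := pos1_bounds x'.
  have -> : (x ^+ 2 - x' ^+ 2) ^+ 2 = (x + x') ^+ 2 * (x' - x) ^+ 2 by ring.
  apply: (@le_trans _ _ (1 * (16 * (x' - x) ^+ 2))); last by lra.
  apply: ler_pM => //; first by rewrite mulr_ge0// sqr_ge0.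
  by rewrite ler_wpM2r//; nra.
- rewrite (phi_out x1') sub0r; have [x2|x2] := leP 2 x'.
    have d1 : 1 <= x' - x by lra.
    apply: le_trans (ler_normB _ _) _; rewrite normrN (ger0_norm p0) normrM.
    rewrite (@ger0_norm _ (x' - x)); last by lra.
    have : `|dphi x| * (x' - x) <= 6 * (x' - x) by rewrite ler_wpM2r//; lra.
    nra.
  have := pos3_taylor (1 - x ^+ 2) (x ^+ 2 - x' ^+ 2).
  rewrite (_ : 1 - x ^+ 2 + (x ^+ 2 - x' ^+ 2) = 1 - x' ^+ 2); last by ring.
  rewrite -/(phi x') -/(phi x) (phi_out x1') (@pos_0 _ (1 - x' ^+ 2)); last by nra.
  have /andP[v0 v1] := pos1_bounds x; rewrite /dphi.
  move: (pos _) v0 v1 => v v0 v1 /andP[h1 h2].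
  have v2 : v ^+ 2 <= 1 by rewrite exprn_ile1.
  have v20 := sqr_ge0 v.
  have v2d : v ^+ 2 * (x' - x) ^+ 2 <= (x' - x) ^+ 2 by rewrite ler_piMl.
  have v2d0 : 0 <= v ^+ 2 * (x' - x) ^+ 2 by rewrite mulr_ge0.
  have hb : (2 * v + 0) * (x ^+ 2 - x' ^+ 2) ^+ 2 <= 2 * (16 * (x' - x) ^+ 2).
    have -> : (x ^+ 2 - x' ^+ 2) ^+ 2 = (x + x') ^+ 2 * (x' - x) ^+ 2 by ring.
    apply: ler_pM => //; [lra|by rewrite mulr_ge0// sqr_ge0|lra|].
    by rewrite ler_wpM2r//; nra.
  rewrite ler_norml; apply/andP; split; lra.
- have := pos3_taylor (1 - x ^+ 2) (x ^+ 2 - x' ^+ 2).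
  rewrite (_ : 1 - x ^+ 2 + (x ^+ 2 - x' ^+ 2) = 1 - x' ^+ 2); last by ring.
  rewrite -/(phi x') -/(phi x).
  have /andP[v0 v1] := pos1_bounds x; have /andP[v0' v1'] := pos1_bounds x'; rewrite /dphi.
  move: (pos (1 - x' ^+ 2)) v0' v1' => v' v0' v1'.
  move: (pos _) v0 v1 => v v0 v1 /andP[h1 h2].
  have v2 : v ^+ 2 <= 1 by rewrite exprn_ile1.
  have v20 := sqr_ge0 v.
  have v2d : v ^+ 2 * (x' - x) ^+ 2 <= (x' - x) ^+ 2 by rewrite ler_piMl.
  have v2d0 : 0 <= v ^+ 2 * (x' - x) ^+ 2 by rewrite mulr_ge0.
  have hb : (2 * v + v') * (x ^+ 2 - x' ^+ 2) ^+ 2 <= 3 * (16 * (x' - x) ^+ 2).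
    have -> : (x ^+ 2 - x' ^+ 2) ^+ 2 = (x + x') ^+ 2 * (x' - x) ^+ 2 by ring.
    apply: ler_pM => //; [lra|by rewrite mulr_ge0// sqr_ge0|lra|].
    by rewrite ler_wpM2r//; nra.
  rewrite ler_norml; apply/andP; split; lra.
Qed.

Lemma bumpE r : psi r = eta * phi (r / delta). Proof. by []. Qed.

Variable rho : R.
Hypotheses (rho0 : 0 < rho) (rho1 : rho <= 1) (delta0 : 0 < delta)
  (delta_small : delta <= rho / 12800) (eta_small : 4096 * `|eta| * rho <= delta ^+ 2).

Lemma bump_taylor r r' : 0 <= r -> 0 <= r' ->
  `|psi r' - psi r - dpsi r * (r' - r)| <= 51 * (`|eta| / delta ^+ 2) * (r' - r) ^+ 2.
Proof.
move=> r0 r0'; have := phi_taylor (divr_ge0 r0 (ltW delta0)) (divr_ge0 r0' (ltW delta0)).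
move=> /(ler_wpM2l (normr_ge0 eta)); rewrite -normrM.
rewrite !bumpE /dpsi -mulrBl => h.
have -> : eta * phi (r' / delta) - eta * phi (r / delta) - eta * (dphi (r / delta) / delta) * (r' - r)
  = eta * (phi (r' / delta) - phi (r / delta) - dphi (r / delta) * ((r' - r) / delta)).
  by field; rewrite gt_eqF.
apply: le_trans h _; rewrite le_eqVlt; apply/orP; left; apply/eqP.
by field; rewrite gt_eqF.
Qed.

Lemma eta_le : `|eta| <= 1 / 10 ^+ 7.
Proof.
have /andP[d1 d2] : 0 <= delta <= 1 / 12800.
  by rewrite ltW//=; move: delta_small rho1; lra.
have : 4096 * `|eta| * rho <= delta * (rho / 12800).
  by apply: le_trans eta_small _; rewrite expr2 ler_pM2l.
have -> : 4096 * `|eta| * rho = rho * (4096 * `|eta|) by ring.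
have -> : delta * (rho / 12800) = rho * (delta / 12800) by ring.
rewrite (ler_pM2l rho0) -natrX; move: d1 d2; move: (`|eta|) delta => x y; lra.
Qed.

Lemma psi_le r : `|psi r| <= 1 / 10 ^+ 7.
Proof.
rewrite bumpE normrM; have /andP[p0 p1] := phi_bounds (r / delta).
apply: le_trans eta_le; rewrite (ger0_norm p0) ler_piMr//.
Qed.

Lemma psi_out r : delta <= r -> psi r = 0.
Proof. by move=> dr; rewrite bumpE phi_out ?mulr0// ler_pdivlMr// mul1r. Qed.

Lemma dpsi_out r : delta <= r -> dpsi r = 0.
Proof. by move=> dr; rewrite /dpsi dphi_out ?mul0r ?mulr0// ler_pdivlMr// mul1r. Qed.

Lemma eta_delta : `|eta| / delta ^+ 2 * rho <= 1 / 4096.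
Proof.
rewrite mulrAC ler_pdivrMr ?exprn_gt0//.
by move: eta_small; lra.
Qed.

Lemma dpsi_le_r r : 0 <= r -> `|dpsi r| * rho <= 6 / 4096 * r.
Proof.
move=> r0; rewrite /dpsi normrM (normrM (dphi _)) normfV (gtr0_norm delta0).
have := dphi_le (divr_ge0 r0 (ltW delta0)).
move=> h; have := eta_delta.
have -> : `|eta| * (`|dphi (r / delta)| / delta) * rho =
   `|dphi (r / delta)| * (`|eta| / delta * rho) by ring.
move=> h2; apply: le_trans (ler_wpM2r _ h) _.
  by rewrite mulr_ge0 ?(ltW rho0)// divr_ge0// ltW.
have -> : 6 * (r / delta) * (`|eta| / delta * rho) = 6 * r * (`|eta| / delta ^+ 2 * rho).
  by field; rewrite gt_eqF.
by have := ler_wpM2l (mulr_ge0 (ler0n R 6) r0) h2; lra.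
Qed.

End Reach.

(** * First-order conditions at nearest points of the generating curve *)

Section Reach.
Variables (R : realType) (e : nat) (tw : tower R e) (eta delta rho : R).
Local Notation Y := 'rV[R]_e.
Local Notation h := (height tw).
Local Notation m := (half tw).
Local Notation b := (rad tw).
Local Notation b0 := (b0 tw).
Local Notation mid := (mid tw).
Local Notation dir := (dir tw).
Local Notation excess := (excess tw).
Local Notation profile := (profile tw).
Local Notation side := (side tw).
Local Notation curve := (curve tw eta delta).
Local Notation psi := (bump eta delta).
Local Notation dpsi := (dpsi eta delta).
Local Notation grad_r := (grad_r tw).
Implicit Types (i j k : nat) (r s z t : R) (y : Y).

(** The second derivative of the bump is of order [|eta| / delta ^+ 2], which the last inequality
    makes small against [1 / rho]. The bound on [delta] confines the bump to the flat part of the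
    first disc and makes its height negligible beside the size of the tower. *)
Definition good_bump := [/\ 0 < rho, rho <= 1, 0 < delta,
  delta <= rho / 12800 & 4096 * `|eta| * rho <= delta ^+ 2].

Hypothesis gb : good_bump.
Let rho0 : 0 < rho. Proof. by case: gb. Qed.
Let rho1 : rho <= 1. Proof. by case: gb. Qed.
Let delta0 : 0 < delta. Proof. by case: gb. Qed.

Lemma delta_lt : delta < 1 / 10 ^+ 3.
Proof. rewrite -natrX; case: gb => _ h1 _ h2 _; lra. Qed.

Lemma good_bump_taylor r r' : 0 <= r -> 0 <= r' ->
  `|psi r' - psi r - dpsi r * (r' - r)| <= 51 * (`|eta| / delta ^+ 2) * (r' - r) ^+ 2.
Proof. by move=> *; apply: bump_taylor. Qed.

Lemma good_dpsi_le r : 0 <= r -> `|dpsi r| * rho <= 6 / 4096 * r.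
Proof. by case: gb => *; apply: dpsi_le_r. Qed.

Lemma delta_b0 : delta <= b0 - 1 / 16.
Proof. have := delta_lt; rewrite -natrX; have := b0_ge tw; lra. Qed.

Lemma curve_cap0 r : 0 <= r -> r <= b -> curve r (h 0%N + psi r *: dir 0%N).
Proof.
move=> r0 rb; have [rb0|b0r] := leP r b0; first by right; left.
have db := delta_b0.
rewrite (@psi_out _ _ _ delta0); last by lra.
rewrite scale0r addr0; left; exists 0%N; split; [exact: half2_gt1|exact: ltW|].
by exists (- (3 / 2)); apply: (proj1 (profile_flat _)); exact: excess_even.
Qed.

Lemma even_last : ~~ odd (m.*2).-2 /\ (m.*2.-2.+1 = (m.*2).-1)%N.
Proof.
have m1 := half2_gt1 tw; split; last by lia.
have E : (m.*2.-2.+2 = m.*2)%N by lia.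
by have := congr1 odd E; rewrite odd_double /= negbK => ->.
Qed.

Lemma curve_cap1 r : 0 <= r -> r <= b -> curve r (h (m.*2).-1).
Proof.
move=> r0 rb; have [rb0|b0r] := leP r b0; first by right; right.
have [oi iE] := even_last; have m1 := half2_gt1 tw.
left; exists (m.*2).-2; split; [lia| |].
  by rewrite /side (negPf oi) ltW.
by exists (3 / 2); rewrite -iE; apply: (proj2 (profile_flat _)); exact: excess_even.
Qed.

(** The flat part of a disc extends beyond the side of the turn that carries it: across the radius
    [b0] the same disc belongs to another turn or to a cap. *)
Lemma curve_flat k r : (k < m.*2)%N -> delta <= r -> r <= b -> (m = 1%N \/ 9 / 2 <= r) ->
  curve r (h k).
Proof.
move=> km dr rb mr; have m1 := half2_gt1 tw.
have [b0r|rb0] := leP b0 r.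
  left; have [ok|ok] := boolP (odd k).
    case: k => [//|k] in km ok *; exists k; split=> //.
      by rewrite /side (negPf (ok : ~~ odd k)).
    by exists (3 / 2); apply: (proj2 (profile_flat _)); exact: excess_even.
  exists k; split.
  - rewrite ltn_neqAle km andbT; apply/eqP => E.
    by move: ok; have := congr1 odd E; rewrite odd_double /= => /negbT; rewrite negbK => ->.
  - by rewrite /side (negPf ok).
  by exists (- (3 / 2)); apply: (proj1 (profile_flat _)); exact: excess_even.
have [->|k0] := eqVneq k 0%N.
  have rp : 0 <= r by apply: le_trans dr; exact: ltW.
  by have := curve_cap0 rp rb; rewrite (@psi_out _ _ _ delta0)// scale0r addr0.
have [->|k1] := eqVneq k (m.*2).-1; first by apply: curve_cap1 => //; apply: le_trans dr; exact: ltW.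
have r9 : 9 / 2 <= r.
  by case: mr => // mE; move: km k0 k1; rewrite mE; case: (k) => [|[|]].
left; have [ok|ok] := boolP (odd k).
  exists k; split; [lia|by rewrite /side ok ltW|].
  by exists (- (3 / 2)); apply: (proj1 (profile_flat _)); exact: excess_odd.
case: k => [//|k] in km ok k0 k1 *; rewrite /= negbK in ok; exists k; split=> //.
  by rewrite /side ok ltW.
by exists (3 / 2); apply: (proj2 (profile_flat _)); exact: excess_odd.
Qed.

Lemma profile_sqrt i r (c : R) : c ^+ 2 = 1 -> excess i r <= 1 ->
  profile i r (mid i + (c * (3 / 2 * Num.sqrt (1 - excess i r ^+ 3))) *: dir i)
    (c * (3 / 2 * Num.sqrt (1 - excess i r ^+ 3))).
Proof.
move=> c1 u1; split=> //; have u0 := excess_ge0 tw i r.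
have w0 : 0 <= 1 - excess i r ^+ 3 by rewrite subr_ge0 exprn_ile1.
rewrite (_ : _ ^+ 2 = c ^+ 2 * Num.sqrt (1 - excess i r ^+ 3) ^+ 2); last by field.
by rewrite c1 sqr_sqrtr// mul1r subrK.
Qed.

Lemma excess_lip i r r' : excess i r' <= excess i r + 4 / 9 * `|r' - r|.
Proof.
have [t [-> ->]] := excess_affine tw i r r'.
have n0 : 4 / 9 * epsi R i * (r' - r) <= 4 / 9 * `|r' - r|.
  have e1 : `|epsi R i| = 1 by rewrite /epsi; case: odd; rewrite ?normrN normr1.
  apply: le_trans (ler_norm _) _; rewrite normrM (normrM (4 / 9)) e1 mulr1.
  by rewrite (@gtr0_norm _ (4 / 9)).
have := normr_ge0 (r' - r).
case: (pos_cases t) => -[t0 ->]; case: (pos_cases (t + 4 / 9 * epsi R i * (r' - r))) => -[t1 ->]; lra.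
Qed.

Lemma sqr1_cases s : s ^+ 2 = 1 -> s = 1 \/ s = -1.
Proof. by move=> /eqP; rewrite sqrf_eq1 => /orP[/eqP->|/eqP->]; [left|right]. Qed.

Section FirstOrder.
Variables (A : R) (zeta : Y) (r : R) (y : Y).
Hypothesis A0 : 0 <= A.
Hypothesis r0 : 0 <= r.
Hypothesis min_ry : forall r' y', 0 <= r' -> curve r' y' ->
  (r - A) ^+ 2 + enorm (y - zeta) ^+ 2 <= (r' - A) ^+ 2 + enorm (y' - zeta) ^+ 2.

Lemma fo_cap0 : cap0 tw eta delta r y ->
  (A - r) + dot (zeta - y) (dir 0%N) * dpsi r = 0.
Proof.
move=> [rb yE]; have bb := rad_gt0 tw; have b0E : b0 = b / 2 by [].
have dn : enorm (dir 0%N) = 1 by apply: enorm_dir; exact: half2_gt1.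
have C0 : 0 <= 51 * (`|eta| / delta ^+ 2) by rewrite mulr_ge0// divr_ge0// sqr_ge0.
have step s (tau : R) : s ^+ 2 = 1 -> 0 < tau -> tau <= b / 2 ->
    (forall t, 0 < t -> t < tau -> 0 <= r + s * t) ->
    (A - r) * s + dot (zeta - y) ((s * dpsi r) *: dir 0%N) <= 0.
  move=> s2 tau0 taub pos_r.
  apply: (first_order min_ry (C := 51 * (`|eta| / delta ^+ 2)) tau0 C0) => t t0 tt.
  have st : s * t <= t by case: (sqr1_cases s2) => ->; lra.
  exists (r + s * t), (h 0%N + psi (r + s * t) *: dir 0%N); split.
  - exact: pos_r.
  - by apply: curve_cap0; [exact: pos_r|lra].
  - have -> : r + s * t - r - t * s = 0 by ring.
    by rewrite normr0 mulr_ge0// sqr_ge0.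
  have -> : h 0%N + psi (r + s * t) *: dir 0%N - y - t *: ((s * dpsi r) *: dir 0%N) =
      (psi (r + s * t) - psi r - dpsi r * (r + s * t - r)) *: dir 0%N.
    by rewrite yE; apply/rowP => k; rewrite !mxE; ring.
  rewrite enormZ dn mulr1.
  apply: le_trans (good_bump_taylor r0 (pos_r _ t0 tt)) _.
  have -> : r + s * t - r = s * t by ring.
  by rewrite exprMn s2 mul1r.
have h1 : (A - r) + dot (zeta - y) (dir 0%N) * dpsi r <= 0.
  have p1 t : 0 < t -> t < b / 2 -> 0 <= r + 1 * t by move=> t0 _; rewrite mul1r addr_ge0// ltW.
  have := step 1 (b / 2) (expr1n _ _) (divr_gt0 bb (ltr0n R 2)) (lexx _) p1.
  by rewrite dotZr; lra.
(* On the axis the radius can only increase, which gives one inequality. The other one is the sign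
   of [A], the slope of the bump being zero there. *)
have [r00|rn0] := eqVneq r 0.
  have d0 : dpsi r = 0.
    by have := good_dpsi_le r0; rewrite r00 mulr0 pmulr_lle0// normr_le0 => /eqP.
  by move: h1; rewrite d0 mulr0 addr0 r00 subr0 => h1; apply/eqP; rewrite eq_le h1 A0.
have rpos : 0 < r by rewrite lt0r rn0.
have h2 : (A - r) * -1 + - (dot (zeta - y) (dir 0%N) * dpsi r) <= 0.
  have p1 t : 0 < t -> t < Num.min (b / 2) r -> 0 <= r + -1 * t.
    by move=> t0; rewrite lt_min => /andP[_ tr]; lra.
  have m0 : 0 < Num.min (b / 2) r by rewrite lt_min rpos divr_gt0.
  have m1 : Num.min (b / 2) r <= b / 2 by rewrite ge_min lexx.
  have s1 : (-1) ^+ 2 = 1 :> R by rewrite sqrrN expr1n.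
  by have := step (-1) _ s1 m0 m1 p1; rewrite dotZr; lra.
apply/eqP; rewrite eq_le; apply/andP; split; lra.
Qed.

Lemma fo_cap1 : cap1 tw r y -> A - r = 0.
Proof.
move=> [rb yE]; have bb := rad_gt0 tw; have b0E : b0 = b / 2 by [].
have step s (tau : R) : s ^+ 2 = 1 -> 0 < tau -> tau <= b / 2 ->
   (forall t, 0 < t -> t < tau -> 0 <= r + s * t) -> (A - r) * s <= 0.
  move=> s2 tau0 taub pos_r.
  have := first_order min_ry (alpha := s) (beta := 0) (C := 0) tau0 (lexx 0).
  rewrite dot0r addr0; apply => t t0 tt.
  have st : s * t <= t by case: (sqr1_cases s2) => ->; lra.
  exists (r + s * t), (h (m.*2).-1); split.
  - exact: pos_r.
  - by apply: curve_cap1; [exact: pos_r|lra].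
  - have -> : r + s * t - r - t * s = 0 by ring.
    by rewrite normr0 mul0r.
  by rewrite yE scaler0 subr0 subrr enorm0 mul0r.
have h1 : (A - r) * 1 <= 0.
  apply: (step _ (b / 2)); rewrite ?expr1n ?divr_gt0// => t t0 _.
  by rewrite mul1r addr_ge0// ltW.
have [r00|rn0] := eqVneq r 0.
  by move: h1; rewrite r00 subr0 mulr1 => h1; apply/eqP; rewrite eq_le h1 A0.
have rpos : 0 < r by rewrite lt0r rn0.
have h2 : (A - r) * -1 <= 0.
  apply: (step _ (Num.min (b / 2) r)); rewrite ?sqrrN ?expr1n ?lt_min ?rpos ?divr_gt0// ?ge_min ?lexx//.
  by move=> t t0; rewrite lt_min => /andP[_ tr]; lra.
by apply/eqP; rewrite eq_le; apply/andP; split; lra.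
Qed.

Lemma fo_flat i z : (i.+1 < m.*2)%N -> side i r -> profile i r y z -> excess i r = 0 -> A - r = 0.
Proof.
move=> im si pz e0; have bb := rad_gt0 tw; have b0E : b0 = b / 2 by []; have b0g := b0_ge tw.
have db := delta_b0.
have rpos : 1 / 8 <= r.
  move: si e0; rewrite /side /excess; case: ifP => oi; last by lra.
  have b14 := odd_rad oi im => _; case: (pos_cases ((9 / 2 - r) * (4 / 9))) => -[t0 ->]; lra.
have step s : s ^+ 2 = 1 -> (A - r) * s <= 0.
  move=> s2; have := first_order min_ry (alpha := s) (beta := 0) (C := 1) (tau := 1 / 16) _ ler01.
  rewrite dot0r addr0; apply => // t t0 tt.
  have /andP[st1 st2] : - t <= s * t <= t by case: (sqr1_cases s2) => ->; apply/andP; split; lra.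
  (* The motion is along [r] at constant height, up to an error of second order: within the turn the
     height changes by a term cubic in [t], thanks to the cube of the excess. Past [b0] the disc
     continues on the neighbouring piece. *)
  have [si'|nsi'] := boolP (side i (r + s * t)).
    have dn : enorm (dir i) = 1 by exact: enorm_dir.
    have /eqP : (z - 3 / 2) * (z + 3 / 2) = 0.
      by case: pz => _; rewrite e0 expr0n/= addr0; lra.
    rewrite mulf_eq0 subr_eq0 addr_eq0 => zz.
    have [c [c1 zE]] : exists c : R, c ^+ 2 = 1 /\ z = c * (3 / 2).
      by case/orP: zz => /eqP ->; [exists 1|exists (-1)]; rewrite ?sqrrN expr1n; split=> //; ring.
    have u1 : excess i (r + s * t) <= 4 / 9 * t.
      have := excess_lip i r (r + s * t); rewrite e0 add0r (_ : r + s * t - r = s * t) => [/le_trans|]; [apply|ring].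
      by rewrite ler_wpM2l// ler_norml st1 st2.
    have u0 := excess_ge0 tw i (r + s * t).
    have u1' : excess i (r + s * t) <= 1 by lra.
    have pz' := profile_sqrt c1 u1'.
    set z' := c * _ in pz'; exists (r + s * t), (mid i + z' *: dir i); split.
    - lra.
    - by left; exists i; split=> //; exists z'.
    - have -> : r + s * t - r - t * s = 0 by ring.
    by rewrite normr0 mulr_ge0// sqr_ge0.
    case: pz => -> _; rewrite scaler0 subr0.
    have -> : mid i + z' *: dir i - (mid i + z *: dir i) = (z' - z) *: dir i.
      by apply/rowP => k; rewrite !mxE; ring.
    rewrite enormZ dn mulr1 mul1r zE /z'.
    rewrite -mulrBr (normrM c) -(sqrtr_sqr c) c1 sqrtr1 mul1r -{2}[3 / 2]mulr1 -mulrBr (normrM (3 / 2)) (@gtr0_norm _ (3 / 2))//.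
    have w01 : 0 <= 1 - excess i (r + s * t) ^+ 3 <= 1.
      by rewrite subr_ge0 exprn_ile1//= gerBl exprn_ge0.
    have sw : 1 - excess i (r + s * t) ^+ 3 <= Num.sqrt (1 - excess i (r + s * t) ^+ 3) <= 1.
      case/andP: w01 => w0 w1; rewrite -{1}(sqr_sqrtr w0).
      have q0 := sqrtr_ge0 (1 - excess i (r + s * t) ^+ 3).
      have := ler_wsqrtr w1; rewrite sqrtr1 => q1.
      by rewrite q1 andbT; nra.
    case/andP: sw => sw1 sw2; rewrite distrC ger0_norm ?subr_ge0//.
    have u3 : excess i (r + s * t) ^+ 3 <= (4 / 9 * t) ^+ 3 by rewrite lerXn2r ?nnegrE//; lra.
    have t3 : t ^+ 3 <= t ^+ 2 by rewrite exprS ler_piMl ?sqr_ge0//; lra.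
    by move: u3 sw1 t3; have := sqr_ge0 t; lra.
  have [k [km yE]] : exists k, (k < m.*2)%N /\ y = h k.
    case: (profile_flat_inv e0 pz) => -[-> _]; first by exists i; split=> //; exact: ltnW.
    by exists i.+1.
  exists (r + s * t), y; split.
  - lra.
  - rewrite yE; apply: curve_flat => //.
    + move: si nsi'; rewrite /side; case: ifP => oi; rewrite -?ltNge => si nsi'; lra.
    + move: si nsi'; rewrite /side; case: ifP => oi; rewrite -?ltNge => si nsi'; lra.
    case: (rad_big tw) => [->|b14]; [by left|right].
    by move: si nsi'; rewrite /side; case: ifP => oi; rewrite -?ltNge => si nsi'; lra.
  - have -> : r + s * t - r - t * s = 0 by ring.
    by rewrite normr0 mulr_ge0// sqr_ge0.
  by rewrite subrr scaler0 subrr enorm0 mulr_ge0// sqr_ge0.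
have h1 := step 1 (expr1n _ _); have := step (-1); rewrite sqrrN expr1n => /(_ erefl) h2.
by apply/eqP; rewrite eq_le; apply/andP; split; lra.
Qed.

End FirstOrder.
End Reach.

Section Reach.
Variables (R : realType) (e : nat) (tw : tower R e) (eta delta rho : R).
Local Notation Y := 'rV[R]_e.
Local Notation h := (height tw).
Local Notation m := (half tw).
Local Notation b := (rad tw).
Local Notation b0 := (b0 tw).
Local Notation mid := (mid tw).
Local Notation dir := (dir tw).
Local Notation excess := (excess tw).
Local Notation profile := (profile tw).
Local Notation side := (side tw).
Local Notation curve := (curve tw eta delta).
Local Notation psi := (bump eta delta).
Local Notation dpsi := (dpsi eta delta).
Local Notation grad_r := (grad_r tw).
Implicit Types (i j k : nat) (r s z t : R) (y : Y).

Hypothesis gb : good_bump eta delta rho.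
Let rho0 : 0 < rho. Proof. by case: gb. Qed.
Let rho1 : rho <= 1. Proof. by case: gb. Qed.
Let delta0 : 0 < delta. Proof. by case: gb. Qed.

Lemma grad_flat i r : excess i r = 0 -> grad_r i r = 0.
Proof. by move=> e0; rewrite /grad_r e0 expr0n/= !mulr0. Qed.

Section FirstOrder.
Variables (A : R) (zeta : Y) (r : R) (y : Y).
Hypothesis A0 : 0 <= A.
Hypothesis r0 : 0 <= r.
Hypothesis min_ry : forall r' y', 0 <= r' -> curve r' y' ->
  (r - A) ^+ 2 + enorm (y - zeta) ^+ 2 <= (r' - A) ^+ 2 + enorm (y' - zeta) ^+ 2.

(** Expansion of the excess as a function of the height. The constant blows up as [u] tends to 0,
    which is harmless at a fixed point. *)
Lemma cube_root_taylor (u u' z t s : R) : 0 < u -> u <= 1 -> 0 <= u' -> u' <= 1 ->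
  `|z| <= 3 / 2 -> 0 < t -> t <= 1 -> s ^+ 2 = 1 ->
  u ^+ 3 = 1 - (2 / 3 * z) ^+ 2 -> u' ^+ 3 = 1 - (2 / 3 * (z + s * t)) ^+ 2 ->
  `|u' - u + 8 / 27 * z * s * t * u^-1 ^+ 2| <= 6 * u^-1 ^+ 6 * t ^+ 2.
Proof.
move=> u0 u1 u0' u1' zb t0 t1 s2 e1 e2.
have [k [uk k1]] : exists k : R, u * k = 1 /\ 1 <= k.
  by exists u^-1; rewrite divff ?gt_eqF// invf_ge1.
have -> : u^-1 = k by apply: (mulfI (lt0r_neq0 u0)); rewrite divff ?gt_eqF.
have k0 : 0 <= k by lra.
pose D := u' - u; pose q := 4 / 9 * (2 * (z * s) * t + t ^+ 2).
have zs : `|z * s| <= 3 / 2.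
  by rewrite normrM -(sqrtr_sqr s) s2 sqrtr1 mulr1.
have qb : `|q| <= 2 * t.
  rewrite /q normrM (@gtr0_norm _ (4 / 9))//.
  have := ler_normD (2 * (z * s) * t) (t ^+ 2); rewrite (ger0_norm (sqr_ge0 t)) !normrM.
  rewrite (gtr0_norm t0) (@gtr0_norm _ 2)// -normrM.
  have tt : t ^+ 2 <= t by rewrite expr2 ler_piMl// ltW.
  have := ler_wpM2r (ltW t0) zs; lra.
have eq1 : D * (u' ^+ 2 + u' * u + u ^+ 2) = - q.
  have -> : D * (u' ^+ 2 + u' * u + u ^+ 2) = u' ^+ 3 - u ^+ 3 by rewrite /D; ring.
  rewrite e1 e2 /q (_ : (2 / 3 * (z + s * t)) ^+ 2 = 4 / 9 * (z ^+ 2 + 2 * (z * s) * t + s ^+ 2 * t ^+ 2)); last by field.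
  by rewrite s2; field.
have Db : `|D| <= 2 * t * k ^+ 2.
  have h1 : `|D| * u ^+ 2 <= 2 * t.
    apply: le_trans qb; rewrite -(normrN q) -eq1 normrM ler_wpM2l//.
    by rewrite ger0_norm ?lerDr ?addr_ge0 ?mulr_ge0 ?sqr_ge0// ltW.
  have := ler_wpM2r (sqr_ge0 k) h1.
  have -> : `|D| * u ^+ 2 * k ^+ 2 = `|D| * (u * k) ^+ 2 by ring.
  by rewrite uk expr1n mulr1.
have D1 : `|D| <= 1 by rewrite ler_norml /D; apply/andP; split; lra.
have id1 : D + 8 / 27 * z * s * t * k ^+ 2 = - (4 / 27 * t ^+ 2 * k ^+ 2) - k * D ^+ 2 - k ^+ 2 * D ^+ 3 / 3.
  have e3 : 3 * u ^+ 2 * D = - q - 3 * u * D ^+ 2 - D ^+ 3.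
    by rewrite -eq1 /D; ring.
  transitivity (k ^+ 2 / 3 * (3 * u ^+ 2 * D) + 8 / 27 * z * s * t * k ^+ 2).
    transitivity ((u * k) ^+ 2 * D + 8 / 27 * z * s * t * k ^+ 2); last by field.
    by rewrite uk expr1n mul1r.
  rewrite e3.
  transitivity (- (k ^+ 2 / 3) * (4 / 9 * t ^+ 2) - (u * k) * k * D ^+ 2 - k ^+ 2 / 3 * D ^+ 3).
    by rewrite /q; field.
  by rewrite uk mul1r; field.
rewrite -/D id1.
have k26 : k ^+ 2 <= k ^+ 6 by apply: ler_weXn2l.
have k56 : k ^+ 5 <= k ^+ 6 by apply: ler_weXn2l.
have D2 : D ^+ 2 <= 4 * t ^+ 2 * k ^+ 4.
  rewrite -real_normK ?num_real//.
  have -> : 4 * t ^+ 2 * k ^+ 4 = (2 * t * k ^+ 2) ^+ 2 by ring.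
  by rewrite lerXn2r ?nnegrE// !mulr_ge0 ?sqr_ge0 ?(ltW t0).
have T0 := sqr_ge0 t.
have a1 := ler_wpM2l T0 k26.
have a2 : k * D ^+ 2 <= 4 * (t ^+ 2 * k ^+ 6).
  apply: le_trans (ler_wpM2l k0 D2) _.
  have -> : k * (4 * t ^+ 2 * k ^+ 4) = 4 * (t ^+ 2 * k ^+ 5) by ring.
  by rewrite ler_wpM2l// ler_wpM2l.
have a20 : 0 <= k * D ^+ 2 by rewrite mulr_ge0 ?sqr_ge0.
have a3 : `|k ^+ 2 * D ^+ 3| <= 4 * (t ^+ 2 * k ^+ 6).
  rewrite normrM (ger0_norm (sqr_ge0 k)) normrX.
  have : `|D| ^+ 3 <= D ^+ 2.
    by rewrite exprS real_normK ?num_real// ler_piMl ?sqr_ge0.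
  move=> /(ler_wpM2l (sqr_ge0 k))/le_trans; apply.
  apply: le_trans (ler_wpM2l (sqr_ge0 k) D2) _.
  by rewrite le_eqVlt; apply/orP; left; apply/eqP; ring.
have a10 : 0 <= t ^+ 2 * k ^+ 2 by rewrite mulr_ge0 ?sqr_ge0.
move: a3; rewrite !ler_norml => /andP[a3 a3']; apply/andP; split; lra.
Qed.

(** The vector towards the centre is parallel to the gradient. On the curved part the curve is
    parametrized by [z], which works up to the vertical tangent at [z = 0]; the flat part, where
    this fails, is covered by [fo_flat]. *)
Lemma fo_turn i z : (i.+1 < m.*2)%N -> side i r -> profile i r y z -> 0 < excess i r ->
  (A - r) * grad_z z = dot (zeta - y) (dir i) * grad_r i r.
Proof.
move=> im si pz u0; have bb := rad_gt0 tw; have b0E : b0 = b / 2 by [].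
have [zb u1] := profile_bounds pz; have [yE pE] := pz.
have ep2 := epsi_sqr R i.
pose u := excess i r.
have exE v : 0 <= v -> excess i (r + epsi R i * (9 / 4) * (v - u)) = v.
  move=> v0; have [w [w1 ->]] := excess_affine tw i r (r + epsi R i * (9 / 4) * (v - u)).
  have wu : w = u by rewrite /u; move: u0; rewrite w1; case: (pos_cases w) => -[w0 ->] //; rewrite ltxx.
  rewrite wu (_ : u + _ = v); last first.
    transitivity (u + epsi R i ^+ 2 * (v - u)); first by field.
    by rewrite ep2; ring.
  exact: pos_id.
have rE v : 0 <= v -> v <= 1 -> 0 <= r + epsi R i * (9 / 4) * (v - u) /\ side i (r + epsi R i * (9 / 4) * (v - u)).
  move=> v0 v1; move: u0 si; rewrite /u /excess /side /epsi; case: ifP => oi u0 si.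
    have b14 := odd_rad oi im.
    by move: u0; case: (pos_cases ((9 / 2 - r) * (4 / 9))) => -[w0 ->]; rewrite ?ltxx// => w1; split; lra.
  by move: u0; case: (pos_cases ((r - b) * (4 / 9))) => -[w0 ->]; rewrite ?ltxx// => w1; split; lra.
have k0 : 0 < u^-1 by rewrite invr_gt0.
have u3 : u ^+ 3 = 1 - (2 / 3 * z) ^+ 2 by apply/esym/eqP; rewrite subr_eq addrC; apply/eqP.
have step s : s ^+ 2 = 1 ->
    (A - r) * (- (epsi R i * (2 / 3) * z * s * u^-1 ^+ 2)) + dot (zeta - y) (s *: dir i) <= 0.
  (* For [t] below this bound the new value [w] of the cubed excess is nonnegative, since it differs
     from [u ^+ 3] by at most [16 / 9 * t]. *)
  move=> s2; have tau0 : 0 < u ^+ 3 / 2 by rewrite divr_gt0// exprn_gt0.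
  apply: (first_order min_ry (C := 14 * u^-1 ^+ 6) tau0).
    by rewrite mulr_ge0// exprn_ge0// ltW.
  move=> t t0 tt.
  have u31 : u ^+ 3 <= 1 by rewrite exprn_ile1// ltW.
  have tle1 : t <= 1 by lra.
  pose w := 1 - (2 / 3 * (z + s * t)) ^+ 2.
  have zs : `|z * s| <= 3 / 2 by rewrite normrM -(sqrtr_sqr s) s2 sqrtr1 mulr1.
  have w0 : 0 <= w.
    have : (2 / 3 * (z + s * t)) ^+ 2 = (2 / 3 * z) ^+ 2 + 4 / 9 * (2 * (z * s) * t + s ^+ 2 * t ^+ 2) by field.
    rewrite s2 mul1r /w => ->.
    have -> : 1 - ((2 / 3 * z) ^+ 2 + 4 / 9 * (2 * (z * s) * t + t ^+ 2)) =
       u ^+ 3 - 4 / 9 * (2 * (z * s) * t + t ^+ 2) by rewrite u3; ring.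
    have tt2 : t ^+ 2 <= t by rewrite expr2 ler_piMl// ltW.
    have : z * s * t <= 3 / 2 * t by rewrite ler_wpM2r ?(ltW t0)//; apply: le_trans (ler_norm _) zs.
    lra.
  pose u' := w `^ (3^-1).
  have u0' : 0 <= u' by exact: powR_ge0.
  have u3' : u' ^+ 3 = w by rewrite /u' -powR_mulrn ?powR_ge0// -powRrM mulVf// powRr1.
  have u1' : u' <= 1.
    rewrite -(ler_pXn2r (n := 3))// ?nnegrE// expr1n u3' /w.
    by have := sqr_ge0 (2 / 3 * (z + s * t)); lra.
  have [r0' si'] := rE u' u0' u1'.
  exists (r + epsi R i * (9 / 4) * (u' - u)), (mid i + (z + s * t) *: dir i); split=> //.
  - left; exists i; split=> //; exists (z + s * t); split=> //.
    by rewrite exE// u3' /w addrC subrK.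
  - have := cube_root_taylor u0 u1 u0' u1' zb t0 tle1 s2 u3 u3'.
    have -> : r + epsi R i * (9 / 4) * (u' - u) - r - t * - (epsi R i * (2 / 3) * z * s * u^-1 ^+ 2) =
      epsi R i * (9 / 4) * (u' - u + 8 / 27 * z * s * t * u^-1 ^+ 2) by move: (u^-1) => k; field.
    have e1 : `|epsi R i| = 1 by rewrite -(sqrtr_sqr (epsi R i)) ep2 sqrtr1.
    rewrite normrM (normrM (epsi R i)) e1 mul1r (@gtr0_norm _ (9 / 4))// -/u.
    have := mulr_ge0 (exprn_ge0 6 (ltW k0)) (sqr_ge0 t); move: (`| _ |) => X; lra.
  have -> : mid i + (z + s * t) *: dir i - y - t *: (s *: dir i) = 0.
    by rewrite yE; apply/rowP => k; rewrite !mxE; ring.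
  by rewrite enorm0 mulr_ge0 ?sqr_ge0// mulr_ge0// exprn_ge0// ltW.
have h1 := step 1 (expr1n _ _); have s1 : (-1) ^+ 2 = 1 :> R by rewrite sqrrN expr1n.
have h2 := step (-1) s1; have dz s : dot (zeta - y) (s *: dir i) = s * dot (zeta - y) (dir i) by exact: dotZr.
move: h1 h2; rewrite !dz.
have uk : u * u^-1 = 1 by rewrite divff// gt_eqF.
move: (u^-1) k0 uk => k k0 uk h1 h2.
have h3 : (A - r) * (epsi R i * (2 / 3) * z * k ^+ 2) = dot (zeta - y) (dir i) by lra.
rewrite -h3 /grad_r /grad_z -/u.
transitivity ((A - r) * (8 / 9 * z) * ((u * k) ^+ 2 * epsi R i ^+ 2)); last by field.
by rewrite uk ep2 expr1n !mulr1.
Qed.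

End FirstOrder.
End Reach.

(** * Uniqueness of the nearest point within the reach *)

Section Reach.
Variables (R : realType) (e : nat) (tw : tower R e) (eta delta rho : R).
Local Notation Y := 'rV[R]_e.
Local Notation h := (height tw).
Local Notation m := (half tw).
Local Notation b := (rad tw).
Local Notation b0 := (b0 tw).
Local Notation mid := (mid tw).
Local Notation dir := (dir tw).
Local Notation excess := (excess tw).
Local Notation profile := (profile tw).
Local Notation side := (side tw).
Local Notation curve0 := (curve tw 0 delta).
Local Notation curve := (curve tw eta delta).
Local Notation psi := (bump eta delta).
Local Notation dpsi := (dpsi eta delta).
Local Notation grad_r := (grad_r tw).
Implicit Types (i j k : nat) (r s z t : R) (y : Y).

Hypothesis gb : good_bump eta delta rho.
Let rho0 : 0 < rho. Proof. by case: gb. Qed.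
Let rho1 : rho <= 1. Proof. by case: gb. Qed.
Let delta0 : 0 < delta. Proof. by case: gb. Qed.

Lemma psi_dpsi0 r : psi r = 0 -> 0 <= r -> dpsi r = 0.
Proof.
move=> p0 r0; have [dr|rd] := leP delta r; first by rewrite (@dpsi_out _ _ _ delta0).
move/eqP: p0; rewrite /bump mulf_eq0 => /orP[/eqP e0|]; first by rewrite /dpsi e0 mul0r.
have x1 : r / delta < 1 by rewrite ltr_pdivrMr// mul1r.
have x0 : 0 <= r / delta by rewrite divr_ge0// ltW.
have x2 : (r / delta) ^+ 2 < 1 by rewrite expr_lt1.
rewrite expf_eq0/= pos_id; last by rewrite subr_ge0 ltW.
by rewrite subr_eq0 => /eqP E; move: x2; rewrite -E ltxx.
Qed.

Lemma turn_far i r y : turn tw i r y -> 1 / 8 <= r.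
Proof.
move=> [im si [z pz]]; have [_ u1] := profile_bounds pz; have b0g := b0_ge tw.
move: si u1; rewrite /side /excess; case: ifP => oi; last by lra.
by move=> _; case: (pos_cases ((9 / 2 - r) * (4 / 9))) => -[w0 ->]; lra.
Qed.

(** It treats the bump as a small vertical displacement [p] of the tower without bump. *)
Lemma bumped r y : curve r y -> exists y0 p, [/\ curve0 r y0,
  y = y0 + p *: dir 0%N, `|p| <= 1 / 10 ^+ 7 &
  (p = 0 \/ [/\ r < delta, y0 = h 0%N & p = psi r])].
Proof.
have t0 : (0 : R) <= 1 / 10 ^+ 7 by rewrite divr_ge0// exprn_ge0.
case=> [tu|[[rb ->]|ca]].
- by exists y, 0; rewrite scale0r addr0 normr0; split=> //; [left|left].
- exists (h 0%N), (psi r); split=> //.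
  + by right; left; split=> //; rewrite bump0 scale0r addr0.
  + by case: gb => *; apply: (@psi_le _ eta delta rho).
  + by have [dr|rd] := leP delta r; [left; apply: (@psi_out _ _ _ delta0)|right].
by exists y, 0; rewrite scale0r addr0 normr0; split=> //; [right; right|left].
Qed.

Lemma height0_last : 3 <= enorm (h 0%N - h (m.*2).-1).
Proof. by have m1 := half2_gt1 tw; apply: height_sep; lia. Qed.

Lemma dot_comb (u v : Y) (c p : R) : dot (c *: u + p *: v) (c *: u + p *: v) =
  c ^+ 2 * dot u u + 2 * (c * p * dot u v) + p ^+ 2 * dot v v.
Proof. by rewrite !dotE (dotC v u); ring. Qed.

Lemma dot_comb_r (w u v : Y) (c p : R) : dot w (c *: u + p *: v) = c * dot w u + p * dot w v.
Proof. by rewrite !dotE. Qed.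

Section FirstOrder.
Variables (A : R) (zeta : Y).
Hypothesis A0 : 0 <= A.

Definition nearest r y := [/\ 0 <= r, curve r y & forall r' y', 0 <= r' -> curve r' y' ->
  (r - A) ^+ 2 + enorm (y - zeta) ^+ 2 <= (r' - A) ^+ 2 + enorm (y' - zeta) ^+ 2].

(** On a flat part the gradient is vertical and the condition becomes [A = r]. It is taken from the
    piece on which the point really lies. *)
Lemma fo_plain i r y z : nearest r y -> (i.+1 < m.*2)%N -> profile i r y z ->
  side i r \/ (excess i r = 0 /\ flat_point tw r y) ->
  (A - r) * grad_z z = dot (zeta - y) (dir i) * grad_r i r.
Proof.
move=> [r0 cy mn] im pz; have := excess_ge0 tw i r; rewrite le_eqVlt => /orP[/eqP/esym e0|u0]; last first.
  case=> [si|[e0 _]]; last by rewrite e0 ltxx in u0.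
  exact: (fo_turn mn im si pz u0).
move=> sf; rewrite grad_flat// mulr0; suff -> : A - r = 0 by rewrite mul0r.
case: sf => [si|[_ [[k [kE rb yE]]|[j [z' [jm sj pz' ej]]]]]].
- exact: (fo_flat gb mn im si pz e0).
- case: kE => kE; last by apply: (fo_cap1 gb A0 r0 mn); split=> //; rewrite -kE.
  have p0 : psi r = 0.
    have [dr|rd] := leP delta r; first exact: (@psi_out _ _ _ delta0).
    case: cy => [[j tj]|[[_ yE']|[_ yE']]].
    + by have := turn_far tj; have := delta_lt gb; rewrite -natrX; lra.
    + have : psi r *: dir 0%N = 0 by apply: (addrI (h 0%N)); rewrite -yE' yE kE addr0.
      move/eqP; rewrite scaler_eq0 => /orP[/eqP//|/eqP d0].
      by have := enorm_dir (tw := tw) (half2_gt1 tw); rewrite d0 enorm0 => /eqP; rewrite eq_sym oner_eq0.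
    + by exfalso; have := height0_last; rewrite -yE' yE kE subrr enorm0; lra.
  have := fo_cap0 gb A0 r0 mn; rewrite (psi_dpsi0 p0 r0) mulr0 addr0; apply.
  by split=> //; rewrite p0 scale0r addr0 yE kE.
exact: (fo_flat gb mn jm sj pz' ej).
Qed.

(** A vector parallel to the gradient, of length at most [D], is tested on a displacement along the
    profile. The bound is [D] times 16/27 divided by the square root of 229/144, which is just under
    0.47. That it is below 1/2 is the crux of the reach estimate. *)
Lemma tangent_bound i r r' y y' z z' (D : R) : 0 <= D ->
  (r - A) ^+ 2 + enorm (y - zeta) ^+ 2 = D ^+ 2 -> (i.+1 < m.*2)%N ->
  profile i r y z -> profile i r' y' z' ->
  (A - r) * grad_z z = dot (zeta - y) (dir i) * grad_r i r ->
  `|(A - r) * (r' - r) + dot (zeta - y) (dir i) * (z' - z)|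
    <= 47 / 100 * D * ((r' - r) ^+ 2 + (z' - z) ^+ 2).
Proof.
move=> D0 DE im pz pz' par.
have w2 : dot (zeta - y) (dir i) ^+ 2 <= enorm (y - zeta) ^+ 2.
  have := CauchySchwarz_abs (zeta - y) (dir i); rewrite enorm_dir// mulr1 enormB => cs.
  by rewrite -real_normK ?num_real// lerXn2r ?nnegrE ?enorm_ge0.
have tay := profile_taylor pz pz'; have low := grad_lower pz.
set a := r' - r in tay *; set c := z' - z in tay *.
set w := dot _ _ in par w2 *; set X := A - r in par *.
set gr := grad_r i r in par tay low; set gz := grad_z z in par tay low.
have X2 : X ^+ 2 + w ^+ 2 <= D ^+ 2 by rewrite -DE /X -(opprB r A) sqrrN; lra.
have N0 : 0 <= a ^+ 2 + c ^+ 2 by rewrite addr_ge0 ?sqr_ge0.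
rewrite -(ler_pXn2r (n := 2)) ?nnegrE ?mulr_ge0// real_normK ?num_real//.
have e1' : (X * a + w * c) * gr = X * (gr * a + gz * c).
  transitivity (X * a * gr + (w * gr) * c); first by ring.
  by rewrite -par; ring.
have e2 : (X * a + w * c) * gz = w * (gr * a + gz * c).
  transitivity ((X * gz) * a + w * c * gz); first by ring.
  by rewrite par; ring.
have sq : (X * a + w * c) ^+ 2 * (gr ^+ 2 + gz ^+ 2) = (X ^+ 2 + w ^+ 2) * (gr * a + gz * c) ^+ 2.
  rewrite mulrDr -!exprMn e1' e2; ring.
have t2 : (gr * a + gz * c) ^+ 2 <= (16 / 27 * (a ^+ 2 + c ^+ 2)) ^+ 2.
  by rewrite -real_normK ?num_real// lerXn2r ?nnegrE// mulr_ge0.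
have h1 : (X * a + w * c) ^+ 2 * (229 / 144) <= D ^+ 2 * (16 / 27 * (a ^+ 2 + c ^+ 2)) ^+ 2.
  apply: (@le_trans _ _ ((X * a + w * c) ^+ 2 * (gr ^+ 2 + gz ^+ 2))).
    by rewrite ler_wpM2l ?sqr_ge0.
  by rewrite sq ler_pM ?sqr_ge0// addr_ge0 ?sqr_ge0.
have := mulr_ge0 (sqr_ge0 D) (sqr_ge0 (a ^+ 2 + c ^+ 2)).
move: h1; rewrite !exprMn; move: (D ^+ 2) ((a ^+ 2 + c ^+ 2) ^+ 2) => u v; lra.
Qed.

Lemma nearest_eq r y r' y' : nearest r y -> nearest r' y' ->
  (r - A) ^+ 2 + enorm (y - zeta) ^+ 2 = (r' - A) ^+ 2 + enorm (y' - zeta) ^+ 2.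
Proof.
by move=> [r0 c mn] [r0' c' mn']; apply/eqP; rewrite eq_le; apply/andP; split; [apply: mn|apply: mn'].
Qed.

(* A point of the bump and a nearest point off the initial cap are at distance more than [1 / 9],
   which absorbs the height of the bump. *)
Lemma reach_plain r y r' y' (D : R) : 0 <= D -> D < rho ->
  (r - A) ^+ 2 + enorm (y - zeta) ^+ 2 = D ^+ 2 ->
  nearest r y -> nearest r' y' -> ~ cap0 tw eta delta r' y' -> r = r' /\ y = y'.
Proof.
move=> D0 Dr DE near near' nc.
have DE' : (r' - A) ^+ 2 + enorm (y' - zeta) ^+ 2 = D ^+ 2 by rewrite -DE (nearest_eq near near').
have [r0 cr mn] := near; have [r0' cr' mn'] := near'.
have D1 : D < 1 by apply: lt_le_trans Dr rho1.
have D2 : D ^+ 2 < 1 by rewrite expr_lt1.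
have [y0 [p [c0 yE pb pc]]] := bumped cr.
have c0' : curve0 r' y'.
  by case: cr' => [t|[c|c]]; [left|by []|right; right].
have d0 : enorm (dir 0%N) = 1 by apply: enorm_dir; exact: half2_gt1.
have yy2 : (r - r') ^+ 2 + enorm (y - y') ^+ 2 < 4.
  have sq (a c : R) : (a - c) ^+ 2 <= 2 * (a ^+ 2 + c ^+ 2).
    by have := sqr_ge0 (a + c); lra.
  have h1 := sq (r - A) (r' - A).
  have h2 : enorm (y - y') <= enorm (y - zeta) + enorm (y' - zeta).
    by rewrite (enormB y'); exact: enorm_triangle.
  have h3 : enorm (y - y') ^+ 2 <= (enorm (y - zeta) + enorm (y' - zeta)) ^+ 2.
    by rewrite lerXn2r ?nnegrE ?addr_ge0 ?enorm_ge0.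
  have h4 := sqr_ge0 (enorm (y - zeta) - enorm (y' - zeta)).
  have rr : r - A - (r' - A) = r - r' by ring.
  move: h1 h3 h4; rewrite rr.
  move: (enorm _) (enorm (y' - zeta)) (enorm (y - zeta)) DE DE' => a1 a2 a3 DE DE'; lra.
have y2 : enorm (y - y') <= 2.
  have := sqr_ge0 (r - r'); move=> s0; rewrite -(ler_pXn2r (n := 2)) ?nnegrE ?enorm_ge0//.
  by move: yy2; rewrite -natrX; lra.
have pb' : `|p| <= 1 / 100 by move: pb; rewrite -natrX; lra.
have pb2 : `|p| <= 1 / 100 * (1 / 100 * (1 / 2)) by move: pb; rewrite -natrX; lra.
clear pb.
have y0y : enorm (y0 - y') <= enorm (y - y') + `|p|.
  have -> : y0 - y' = (y - y') - p *: dir 0%N by rewrite yE; apply/rowP => k; rewrite !mxE; ring.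
  by apply: le_trans (enormD _ _) _; rewrite enormN enormZ d0 mulr1.
have cl : close r r' y0 y'.
  have q2 : enorm (y0 - y') ^+ 2 <= (enorm (y - y') + `|p|) ^+ 2.
    by rewrite lerXn2r ?nnegrE ?addr_ge0 ?enorm_ge0.
  have p0 := normr_ge0 p; have e0 := enorm_ge0 (y - y').
  have q3 : `|p| ^+ 2 <= `|p| by rewrite expr2 ler_piMl//; lra_using pb'.
  have q4 : enorm (y - y') * `|p| <= 2 * `|p| by rewrite ler_wpM2r.
  have e21 : (21 / 10) ^+ 2 = 441 / 100 :> R by field.
  rewrite /close e21; move: (`|p|) (enorm (y0 - y')) (enorm (y - y')) yy2 pb' q2 q3 q4.
  by move=> a0 a1 a2 yy2 pb' q2 q3 q4; lra_using yy2 pb' q2 q3 q4.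
have [i [im [z [z' [pz pz' sf sf']]]]] := common_profile c0 c0' cl.
have par := fo_plain near' im pz' sf'.
have tb := tangent_bound D0 DE' im pz' pz par.
have dz : y0 - y' = (z - z') *: dir i.
  by rewrite (proj1 pz) (proj1 pz'); apply/rowP => k; rewrite !mxE; ring.
have di : enorm (dir i) = 1 by exact: enorm_dir.
have dd : dot (dir i) (dir i) = 1 by exact: dot_dir.
have dd0 : dot (dir 0%N) (dir 0%N) = 1 by apply: dot_dir; exact: half2_gt1.
have d0i : `|dot (dir i) (dir 0%N)| <= 1.
  by have := CauchySchwarz_abs (dir i) (dir 0%N); rewrite di d0 mulr1.
have wb : `|dot (zeta - y') (dir 0%N)| <= 1.
  apply: le_trans (CauchySchwarz_abs _ _) _; rewrite d0 mulr1 enormB.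
  rewrite -(ler_pXn2r (n := 2)) ?nnegrE ?enorm_ge0// expr1n.
  by have s0 := sqr_ge0 (r' - A); lra_using s0 DE' D2.
have yy' : y - y' = (z - z') *: dir i + p *: dir 0%N.
  by rewrite -dz yE; apply/rowP => k; rewrite !mxE; ring.
pose c := z - z'; pose a := r - r'.
have n1 : enorm (y - y') ^+ 2 = c ^+ 2 + 2 * (c * p * dot (dir i) (dir 0%N)) + p ^+ 2.
  by rewrite enorm_sqr yy' dot_comb dd dd0 -/c; ring.
have n2 : enorm (y - zeta) ^+ 2 = enorm (y' - zeta) ^+ 2
    - 2 * (c * dot (zeta - y') (dir i) + p * dot (zeta - y') (dir 0%N)) + enorm (y - y') ^+ 2.
  have -> : y - zeta = (y' - zeta) + (y - y') by apply/rowP => k; rewrite !mxE; ring.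
  have := dot_comb (y' - zeta) (y - y') 1 1; rewrite !scale1r !enorm_sqr => ->.
  have -> : dot (y' - zeta) (y - y') = - (c * dot (zeta - y') (dir i) + p * dot (zeta - y') (dir 0%N)).
    by rewrite -(opprB zeta) dotNl yy' dot_comb_r.
  ring.
set w := dot (zeta - y') (dir i) in n2 tb par.
set w0 := dot (zeta - y') (dir 0%N) in n2 wb; set q := dot (dir i) (dir 0%N) in n1 d0i.
(* Equality of the two distances to the centre: the squared displacement is twice its scalar product
   with the normal vector at [y']. *)
have key : a ^+ 2 + (c ^+ 2 + 2 * (c * p * q) + p ^+ 2) = 2 * ((A - r') * a + w * c) + 2 * (p * w0).
  rewrite -n1; have rE : (r - A) ^+ 2 = (r' - A) ^+ 2 - 2 * ((A - r') * a) + a ^+ 2 by rewrite /a; ring.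
  by move: DE DE' n2; rewrite rE => E1 E2 E3; lra_using E1 E2 E3.
rewrite -/a -/c in tb.
have N0 : 0 <= a ^+ 2 + c ^+ 2 by rewrite addr_ge0 ?sqr_ge0.
have tb' : (A - r') * a + w * c <= 47 / 100 * (a ^+ 2 + c ^+ 2).
  apply: le_trans (ler_norm _) _; apply: le_trans tb _.
  by rewrite ler_wpM2r//; lra_using D1.
have c2 : `|c| <= 3.
  have -> : `|c| = enorm (y0 - y') by rewrite dz enormZ di mulr1.
  lra_using y0y y2 pb'.
have pw : p * w0 <= `|p|.
  by apply: le_trans (ler_norm _) _; rewrite normrM ler_piMr.
have cpq : - (3 * `|p|) <= c * p * q.
  suff : `|c * p * q| <= 3 * `|p| by rewrite ler_norml => /andP[].
  rewrite (normrM _ q) (normrM c); apply: le_trans (ler_piMr _ d0i) _; first exact: mulr_ge0.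
  by rewrite ler_wpM2r.
(* The coefficient 6/100 is 1 minus 94/100. Without a bump displacement this forces equality of the
   points. Otherwise the displacement squared is at least 1/81, against [|p| <= 1 / 20000]. *)
have fin : 6 / 100 * (a ^+ 2 + c ^+ 2) <= 8 * `|p|.
  by have p2 := sqr_ge0 p; lra_using key tb' pw cpq p2.
clear tb tb' n1 n2 key pw cpq c2 wb d0i par cl y0y yy2 y2 pb' DE DE' D1 D2.
case: pc => [p0|[rd y0E pE]].
  move: fin; rewrite p0 normr0 mulr0 => fin.
  have a2 := sqr_ge0 a; have c22 := sqr_ge0 c.
  have : a ^+ 2 + c ^+ 2 = 0 by apply/eqP; rewrite eq_le N0 andbT; lra_using fin.
  move/eqP; rewrite paddr_eq0// !sqrf_eq0 => /andP[/eqP az /eqP cz].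
  split; first by apply/eqP; rewrite -subr_eq0; apply/eqP.
  by apply/eqP; rewrite -subr_eq0 yy' -/c cz p0 !scale0r addr0.
exfalso.
have far : 1 / 81 <= a ^+ 2 + c ^+ 2.
  case: cr' => [[j t]|[//|[rb yE']]].
    have r8 := turn_far t; have := delta_lt gb; rewrite -natrX => dl.
    have a9 : 1 / 9 <= r' - r by lra_using r8 dl rd.
    have : (1 / 9) ^+ 2 <= (r' - r) ^+ 2 by rewrite lerXn2r ?nnegrE//; lra_using a9.
    by rewrite (_ : (r' - r) ^+ 2 = a ^+ 2); [move=> h9; have c2' := sqr_ge0 c; lra_using h9 c2'|rewrite /a; ring].
  have : `|c| = enorm (y0 - y') by rewrite dz enormZ di mulr1.
  have := height0_last; rewrite -y0E -yE' => h3 h4.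
  have : 3 ^+ 2 <= c ^+ 2 by rewrite -(real_normK (num_real c)) h4 lerXn2r ?nnegrE ?enorm_ge0.
  by move=> c9; have a2 := sqr_ge0 a; lra_using c9 a2.
lra_using fin far pb2.
Qed.

(** Both points are on the graph of the bump. The Taylor remainder has coefficient
    [51 * |eta| / delta ^+ 2], at most 51/4096 once multiplied by the distance, far below 1/2. *)
Lemma reach_cap0 r y r' y' (D : R) : 0 <= D -> D < rho ->
  (r - A) ^+ 2 + enorm (y - zeta) ^+ 2 = D ^+ 2 ->
  nearest r y -> nearest r' y' -> cap0 tw eta delta r y -> cap0 tw eta delta r' y' ->
  r = r' /\ y = y'.
Proof.
move=> D0 Dr DE near near' [rb yE] [rb' yE'].
have DE' := nearest_eq near near'; have [r0 cr mn] := near; have [r0' cr' mn'] := near'.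
have fo := fo_cap0 gb A0 r0 mn (conj rb yE).
have tay := good_bump_taylor gb r0 r0'.
have dn : enorm (dir 0%N) = 1 by apply: enorm_dir; exact: half2_gt1.
have dd0 : dot (dir 0%N) (dir 0%N) = 1 by apply: dot_dir; exact: half2_gt1.
set q := psi r' - psi r; have yy : y' - y = q *: dir 0%N.
  by rewrite yE yE'; apply/rowP => k; rewrite !mxE /q; ring.
set w := dot (zeta - y) (dir 0%N) in fo.
have wD : `|w| <= D.
  apply: le_trans (CauchySchwarz_abs _ _) _; rewrite dn mulr1 enormB.
  rewrite -(ler_pXn2r (n := 2)) ?nnegrE ?enorm_ge0// -DE.
  by have s0 := sqr_ge0 (r - A); lra_using s0.
have n2 : enorm (y' - zeta) ^+ 2 = enorm (y - zeta) ^+ 2 - 2 * (q * w) + q ^+ 2.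
  have -> : y' - zeta = (y - zeta) + q *: dir 0%N.
    by rewrite -yy; apply/rowP => k; rewrite !mxE; ring.
  have wN : dot (y - zeta) (dir 0%N) = - w by rewrite -(opprB zeta) dotNl.
  rewrite !enorm_sqr; have := dot_comb (y - zeta) (dir 0%N) 1 q.
  by rewrite scale1r dd0 wN => ->; ring.
set a := r' - r in tay; set T := psi r' - psi r - dpsi r * a in tay.
have key : a ^+ 2 + q ^+ 2 = 2 * (w * T).
  have rE : (r' - A) ^+ 2 = (r - A) ^+ 2 - 2 * ((A - r) * a) + a ^+ 2 by rewrite /a; ring.
  move: DE'; rewrite n2 rE => E.
  have AE : A - r = - (w * dpsi r) by move: fo; lra.
  rewrite AE in E; have qE : q = T + dpsi r * a by rewrite /q /T subrK.
  by move: E; rewrite {1}qE => E; lra.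
have wT : w * T <= 51 / 4096 * a ^+ 2.
  apply: le_trans (ler_norm _) _; rewrite normrM.
  have ed : `|eta| / delta ^+ 2 * rho <= 1 / 4096 by case: gb => *; apply: eta_delta.
  have e0 : 0 <= `|eta| / delta ^+ 2 by rewrite divr_ge0// sqr_ge0.
  have a2 := sqr_ge0 a.
  apply: (@le_trans _ _ (rho * (51 * (`|eta| / delta ^+ 2) * a ^+ 2))).
    by apply: ler_pM => //; exact: le_trans wD (ltW Dr).
  have h1 := ler_wpM2r a2 ed; lra_using h1 a2.
have a2 := sqr_ge0 a; have q2 := sqr_ge0 q.
have N0 : 0 <= a ^+ 2 + q ^+ 2 by rewrite addr_ge0.
have : a ^+ 2 + q ^+ 2 = 0.
  by apply/eqP; rewrite eq_le N0 andbT; lra_using key wT q2 a2.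
move/eqP; rewrite paddr_eq0// !sqrf_eq0 subr_eq0 => /andP[/eqP -> /eqP q0]; split=> //.
by apply/esym/eqP; rewrite -subr_eq0 yy q0 scale0r.
Qed.

Lemma curve_reach r y r' y' (D : R) : 0 <= D -> D < rho ->
  (r - A) ^+ 2 + enorm (y - zeta) ^+ 2 = D ^+ 2 ->
  nearest r y -> nearest r' y' -> r = r' /\ y = y'.
Proof.
move=> D0 Dr DE near near'.
have [c'|c'] := pselect (cap0 tw eta delta r' y'); last exact: reach_plain DE near near' c'.
have [c|c] := pselect (cap0 tw eta delta r y); first exact: reach_cap0 DE near near' c c'.
have DE' := nearest_eq near near'; rewrite DE in DE'.
by have [-> ->] := reach_plain D0 Dr (esym DE') near' near c.
Qed.

(** For a centre on the axis the nearest points could form a whole orbit of rotations. They are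
    shown to lie on the axis too. *)
Lemma curve_axis r y (D : R) : A = 0 -> 0 <= D -> D < rho ->
  (r - A) ^+ 2 + enorm (y - zeta) ^+ 2 = D ^+ 2 -> nearest r y -> r = 0.
Proof.
move=> AE D0 Dr DE near; have [r0 cr mn] := near.
have D1 : D < 1 by apply: lt_le_trans Dr rho1.
have D2 : D ^+ 2 < 1 by rewrite expr_lt1.
have wD (i : nat) : (i.+1 < m.*2)%N -> `|dot (zeta - y) (dir i)| <= D.
  move=> im; apply: le_trans (CauchySchwarz_abs _ _) _; rewrite enorm_dir// mulr1 enormB.
  rewrite -(ler_pXn2r (n := 2)) ?nnegrE ?enorm_ge0// -DE.
  by have s0 := sqr_ge0 (r - A); lra_using s0.
case: (cr) => [[i [im si [z pz]]]|[c|c]]; last first.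
- by have := fo_cap1 gb A0 r0 mn c; lra.
- have := fo_cap0 gb A0 r0 mn c; rewrite AE sub0r => /eqP; rewrite addrC subr_eq0 => /eqP rE.
  have h1 := good_dpsi_le gb r0; have h2 := wD _ (half2_gt1 tw).
  have h3 : r <= rho * `|dpsi r|.
    rewrite -[leLHS]rE; apply: le_trans (ler_norm _) _; rewrite normrM ler_wpM2r//.
    by apply: le_trans h2 _; exact: ltW.
  have p := rho1; by apply/eqP; rewrite eq_le r0 andbT; lra_using h1 h3 p r0.
have := excess_ge0 tw i r; rewrite le_eqVlt => /orP[/eqP/esym e0|u0].
  by have := fo_flat gb mn im si pz e0; lra.
exfalso; have fo := fo_turn mn im si pz u0.
have [zb u1] := profile_bounds pz; have [_ pE] := pz.
have r1 : r < 1.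
  rewrite -(ltr_pXn2r (n := 2)) ?nnegrE// expr1n; apply: le_lt_trans D2.
  by rewrite -DE AE subr0 lerDl sqr_ge0.
have w1 := wD i im; set w := dot _ _ in fo w1.
have bg := rad_ge tw.
(* A radius below 1 excludes tunnels. On a rim [rad >= 1 / 4] gives [r >= 1 / 4] and an excess at
   most 1/3: there the normal is almost vertical, too steep to reach the axis within distance 1. *)
have [u [uE r4 u3]] : exists u : R, [/\ excess i r = u, 1 / 4 <= r & u <= 1 / 3].
  exists (excess i r); split=> //; move: (u0) (si) (u1); rewrite /excess /side; (case: ifP => oi;
    [case: (pos_cases ((9 / 2 - r) * (4 / 9)))|case: (pos_cases ((r - b) * (4 / 9)))]) => -[w0 ->];
    rewrite ?ltxx// => v0 si' v1; lra_using v0 si' v1 w0 bg r1.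
rewrite uE in u0 pE fo.
have fo2 : (8 / 9) ^+ 2 * (r ^+ 2 * z ^+ 2) = w ^+ 2 * ((4 / 3) ^+ 2 * u ^+ 4).
  transitivity (((A - r) * grad_z z) ^+ 2); first by rewrite AE /grad_z; field.
  rewrite fo /grad_r uE.
  transitivity (w ^+ 2 * ((4 / 3) ^+ 2 * (epsi R i ^+ 2 * u ^+ 4))); first by ring.
  by rewrite epsi_sqr mul1r.
have w2 : w ^+ 2 <= 1.
  by rewrite -(real_normK (num_real w)) exprn_ile1//; lra_using w1 D1.
have u4 : u ^+ 4 <= (1 / 3) ^+ 4 by rewrite lerXn2r ?nnegrE//; lra_using u0 u3.
have u33 : u ^+ 3 <= (1 / 3) ^+ 3 by rewrite lerXn2r ?nnegrE//; lra_using u0 u3.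
have r2 : (1 / 4) ^+ 2 <= r ^+ 2 by rewrite lerXn2r ?nnegrE//; lra_using r4.
have z2 : 2 <= z ^+ 2 by lra_using pE u33.
have rz : (1 / 4) ^+ 2 * 2 <= r ^+ 2 * z ^+ 2 by apply: ler_pM.
have wu : w ^+ 2 * ((4 / 3) ^+ 2 * u ^+ 4) <= 1 * ((4 / 3) ^+ 2 * (1 / 3) ^+ 4).
  apply: ler_pM; rewrite ?sqr_ge0//; last by rewrite ler_wpM2l// sqr_ge0.
  by rewrite mulr_ge0 ?sqr_ge0// exprn_ge0// ltW.
by move: wu rz; rewrite -fo2 => h1 h2; lra_using h1 h2.
Qed.

End FirstOrder.
End Reach.

(** * Topology and charts of a tower *)

Section Manifold.
Variables (R : realType) (d0 e : nat) (tw : tower R e) (eta delta : R).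
Local Notation d := d0.+1.
Local Notation X := 'rV[R]_d.
Local Notation Y := 'rV[R]_e.
Local Notation W := 'rV[R]_(d + e).
Local Notation h := (height tw).
Local Notation m := (half tw).
Local Notation b := (rad tw).
Local Notation b0 := (b0 tw).
Local Notation mid := (mid tw).
Local Notation dir := (dir tw).
Local Notation excess := (excess tw).
Local Notation profile := (profile tw).
Local Notation side := (side tw).
Local Notation curve := (curve tw eta delta).
Local Notation psi := (bump eta delta).
Implicit Types (i j k : nat) (r s t : R) (x : X) (y : Y) (p q : W).

Definition tower_set : set W := [set p | curve (enorm (lsubmx p)) (rsubmx p)].
Local Notation M := tower_set.

Lemma tower_row x y : M (row_mx x y) = curve (enorm x) y.
Proof. by rewrite /tower_set/= row_mxKl row_mxKr. Qed.

Definition unit0 : X := delta_mx 0 ord0.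

Lemma enorm_unit0 : enorm unit0 = 1.
Proof.
apply/eqP; rewrite -(@eqrXn2 _ 2)// ?enorm_ge0// expr1n enorm_sqr /dot (bigD1 ord0)//=.
rewrite big1 ?addr0 ?mxE ?eqxx ?mulr1// => i i0.
by rewrite mxE (negPf i0) andbF mul0r.
Qed.

Lemma unit_direction x : exists th : X, enorm th = 1 /\ x = enorm x *: th.
Proof.
have [->|x0] := eqVneq x 0; first by exists unit0; rewrite enorm_unit0 enorm0 scale0r.
have n0 : 0 < enorm x by rewrite enorm_gt0.
exists ((enorm x)^-1 *: x); rewrite enormZ gtr0_norm ?invr_gt0// mulVf ?gt_eqF//.
by rewrite scalerA mulfV ?gt_eqF// scale1r.
Qed.

(** The case of equality in the reverse triangle inequality: [x] lies on the ray of [xi]. *)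
Lemma subrow_eq (x xi : X) : 0 < enorm xi -> enorm (x - xi) = `|enorm x - enorm xi| ->
  x = (enorm x / enorm xi) *: xi.
Proof.
move=> A0 E; have := congr1 (fun t => t ^+ 2) E; rewrite real_normK ?num_real// enorm_sqr dotBB -!enorm_sqr => E2.
have E3 : dot x xi = enorm x * enorm xi by move: E2; lra.
have : dot (enorm xi *: x - enorm x *: xi) (enorm xi *: x - enorm x *: xi) = 0.
  rewrite dotBB !dotZl !dotZr E3 -!enorm_sqr; ring.
move/eqP; rewrite dotxx_eq0 subr_eq0 => /eqP E4.
by rewrite mulrC -scalerA -E4 scalerA mulVf ?scale1r// gt_eqF.
Qed.

(** Rotating a point of the curve onto the ray of the centre attains the distance of the meridian
    half-plane. Hence nearest points lie on this ray, and [curve_reach] identifies them; for a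
    centre on the axis [curve_axis] does. *)
Lemma tower_reach rho : good_bump eta delta rho -> reach_crit rho M.
Proof.
move=> gb z p q D; rewrite -(hsubmxK p) -(hsubmxK q) -(hsubmxK z) !tower_row.
move: (lsubmx p) (rsubmx p) (lsubmx q) (rsubmx q) (lsubmx z) (rsubmx z) => x y x' y' xi zeta.
move=> cp cq pq pD qD Dmin; rewrite leNgt; apply/negP => Drho.
have D0 : 0 <= D by rewrite -pD enorm_ge0.
have pD2 : enorm (x - xi) ^+ 2 + enorm (y - zeta) ^+ 2 = D ^+ 2 by rewrite -pD row_mxB enorm_row_mx.
have qD2 : enorm (x' - xi) ^+ 2 + enorm (y' - zeta) ^+ 2 = D ^+ 2 by rewrite -qD row_mxB enorm_row_mx.
set A := enorm xi; have A0 : 0 <= A by exact: enorm_ge0.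
have slice r y1 : 0 <= r -> curve r y1 -> D ^+ 2 <= (r - A) ^+ 2 + enorm (y1 - zeta) ^+ 2.
  move=> r0 cr; have [th [th1 xiE]] := unit_direction xi.
  have := Dmin (row_mx (r *: th) y1); rewrite tower_row enormZ th1 mulr1 ger0_norm// => /(_ cr).
  rewrite row_mxB => le; have := lerXn2r 2 D0 (enorm_ge0 _) le.
  by rewrite enorm_row_mx {1}xiE -scalerBl enormZ th1 mulr1 real_normK ?num_real.
have radial (u : X) (v : Y) : curve (enorm u) v -> enorm (u - xi) ^+ 2 + enorm (v - zeta) ^+ 2 = D ^+ 2 ->
    [/\ nearest tw eta delta A zeta (enorm u) v, enorm (u - xi) = `|enorm u - A| &
        (enorm u - A) ^+ 2 + enorm (v - zeta) ^+ 2 = D ^+ 2].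
  move=> cu uD; have h1 := slice _ _ (enorm_ge0 u) cu.
  have h2 : (enorm u - A) ^+ 2 <= enorm (u - xi) ^+ 2.
    by rewrite -real_normK ?num_real// lerXn2r ?nnegrE ?enorm_ge0// enorm_dist.
  have h3 : enorm (u - xi) ^+ 2 = (enorm u - A) ^+ 2 by move: h1 h2 uD; lra.
  split; [|by apply/eqP; rewrite -(@eqrXn2 _ 2)// ?enorm_ge0// real_normK ?num_real// h3|by rewrite -h3].
  by split=> [||r' y1 r'0 cr]; rewrite ?enorm_ge0// -h3 uD slice.
have [np xE pE] := radial x y cp pD2; have [nq x'E qE] := radial x' y' cq qD2.
have [xx yy] := curve_reach gb A0 D0 Drho pE np nq.
apply: pq; congr row_mx => //.
have [A00|An0] := eqVneq A 0.
  have x0 := curve_axis gb A0 A00 D0 Drho pE np; have x'0 := curve_axis gb A0 A00 D0 Drho qE nq.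
  by move/eqP: x0; move/eqP: x'0; rewrite !enorm_eq0 => /eqP -> /eqP ->.
have Ap : 0 < enorm xi by rewrite lt0r An0.
by rewrite (subrow_eq Ap xE) (subrow_eq Ap x'E) xx.
Qed.

Lemma lsubmxB p q : lsubmx p - lsubmx q = lsubmx (p - q).
Proof. by apply/rowP => k; rewrite !mxE. Qed.
Lemma rsubmxB p q : rsubmx p - rsubmx q = rsubmx (p - q).
Proof. by apply/rowP => k; rewrite !mxE. Qed.

Lemma enorm_lsub p : enorm (lsubmx p) <= enorm p.
Proof. by rewrite -{2}(hsubmxK p) enorm_row_mxl. Qed.
Lemma enorm_rsub p : enorm (rsubmx p) <= enorm p.
Proof. by rewrite -{2}(hsubmxK p) enorm_row_mxr. Qed.

Lemma continuous_lsub : continuous (fun p => lsubmx p).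
Proof. by apply: (@lipschitz_continuous _ _ _ 1) => p q; rewrite lsubmxB mul1r enorm_lsub. Qed.
Lemma continuous_radius : continuous (fun p => enorm (lsubmx p)).
Proof.
apply: (@lipschitzR_continuous _ _ 1) => p q; rewrite mul1r.
by apply: le_trans (enorm_dist _ _) _; rewrite lsubmxB enorm_lsub.
Qed.
Lemma continuous_offset (w : Y) : continuous (fun p => enorm (rsubmx p - w)).
Proof.
apply: (@lipschitzR_continuous _ _ 1) => p q; rewrite mul1r.
apply: le_trans (enorm_dist _ _) _; rewrite (_ : _ - _ - _ = rsubmx p - rsubmx q).
  by rewrite rsubmxB enorm_rsub.
by apply/rowP => k; rewrite !mxE; ring.
Qed.
Lemma continuous_along (w u : Y) : continuous (fun p => dot (rsubmx p - w) u).
Proof.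
apply: (@lipschitzR_continuous _ _ (enorm u)) => p q; rewrite -dotNl -dotDl.
rewrite (_ : _ - _ - _ = rsubmx p - rsubmx q); last by apply/rowP => k; rewrite !mxE; ring.
apply: le_trans (CauchySchwarz_abs _ _) _; rewrite mulrC ler_wpM2l ?enorm_ge0//.
by rewrite rsubmxB enorm_rsub.
Qed.

Lemma continuous_expr (T : topologicalType) (f : T -> R) k (v : T) :
  {for v, continuous f} -> {for v, continuous (fun w => f w ^+ k)}.
Proof.
by move=> cf; apply: (@continuous_comp _ _ _ f (fun t : R => t ^+ k)) => //; exact: exprn_continuous.
Qed.

Lemma continuous_excess i : continuous (excess i : R -> R).
Proof.
have aff (a c : R) : continuous (fun r : R => pos (c * r + a)).
  move=> r; apply: (@continuous_comp _ _ _ (fun r : R => c * r + a) (@pos R)); last exact: continuous_pos.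
  by apply: cvgD; [apply: cvgM; [exact: cvg_cst|exact: cvg_id]|exact: cvg_cst].
rewrite /excess; case: (odd i).
  have -> : (fun r => pos ((9 / 2 - r) * (4 / 9))) = (fun r => pos (- (4 / 9) * r + 2)).
    by apply/funext => r; congr pos; field.
  exact: aff.
have -> : (fun r => pos ((r - b) * (4 / 9))) = (fun r => pos (4 / 9 * r + - (4 / 9 * b))).
  by apply/funext => r; congr pos; field.
exact: aff.
Qed.

Lemma continuous_psi : continuous (psi : R -> R).
Proof.
move=> r; rewrite /bump; apply: cvgM; first exact: cvg_cst.
have c1 : {for r, continuous (fun r : R => pos (1 - (r / delta) ^+ 2))}.
  apply: (@continuous_comp _ _ _ (fun r : R => 1 - (r / delta) ^+ 2) (@pos R)); last exact: continuous_pos.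
  have c2 : {for r, continuous (fun r : R => r / delta)} by apply: cvgM; [exact: cvg_id|exact: cvg_cst].
  by apply: continuousB; [exact: cst_continuous|exact: continuous_expr].
exact: (continuous_expr c1).
Qed.

Lemma closed_leC (f : W -> R) c : continuous f -> closed [set p | f p <= c].
Proof. by move=> cf; apply: (@closed_comp _ _ f [set t | t <= c]) => [p _|]; [exact: cf|exact: closed_le]. Qed.
Lemma closed_geC (f : W -> R) c : continuous f -> closed [set p | c <= f p].
Proof. by move=> cf; apply: (@closed_comp _ _ f [set t | c <= t]) => [p _|]; [exact: cf|exact: closed_ge]. Qed.
Lemma closed_eqC (f : W -> R) c : continuous f -> closed [set p | f p = c].
Proof. by move=> cf; apply: (@closed_comp _ _ f [set t | t = c]) => [p _|]; [exact: cf|exact: closed_eq]. Qed.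
Lemma closed_yE (w u : Y) (f : W -> R) : continuous f -> closed [set p | rsubmx p = w + f p *: u].
Proof.
move=> cf; have -> : [set p | rsubmx p = w + f p *: u] =
    (fun p => enorm (rsubmx p - w - f p *: u)) @^-1` [set t | t <= 0].
  apply/seteqP; split=> p /=.
    by move=> ->; rewrite (_ : _ - _ - _ = 0) ?enorm0//; apply/rowP => k; rewrite !mxE; ring.
  move=> E0; have /eqP : enorm (rsubmx p - w - f p *: u) = 0.
    by apply/eqP; rewrite eq_le E0 enorm_ge0.
  rewrite enorm_eq0 => /eqP E; rewrite -[RHS](addr0) -E; apply/rowP => k; rewrite !mxE; ring.
apply: closed_leC => p; apply: (@continuous_comp _ _ _ (fun p => rsubmx p - w - f p *: u) (@enorm R e)).
  have c1 : {for p, continuous (fun p => rsubmx p - w)}.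
    apply: (@lipschitz_continuous _ _ _ 1) => q q'; rewrite mul1r (_ : _ - _ - _ = rsubmx q - rsubmx q').
      by rewrite rsubmxB enorm_rsub.
    by apply/rowP => k; rewrite !mxE; ring.
  have c2 : {for p, continuous (fun p => f p *: u)} by exact: (cvgZr_tmp (cf p)).
  exact: (continuousB c1 c2).
exact: continuous_enorm.
Qed.

Lemma turn_dot i r y : (i.+1 < m.*2)%N -> side i r ->
  turn tw i r y <-> (y = mid i + dot (y - mid i) (dir i) *: dir i /\
    (2 / 3 * dot (y - mid i) (dir i)) ^+ 2 + excess i r ^+ 3 = 1).
Proof.
move=> im si; split=> [[_ _ [z [yE zE]]]|[yE zE]].
  have -> : dot (y - mid i) (dir i) = z by rewrite yE addrC addKr dotZl dot_dir// mulr1.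
  by split.
by split=> //; exists (dot (y - mid i) (dir i)).
Qed.

Lemma tower_closed : closed M.
Proof.
have -> : M = (\bigcup_(i in [set i | (i < (m.*2).-1)%N]) [set p | turn tw i (enorm (lsubmx p)) (rsubmx p)])
    `|` ([set p | cap0 tw eta delta (enorm (lsubmx p)) (rsubmx p)] `|`
         [set p | cap1 tw (enorm (lsubmx p)) (rsubmx p)]).
  apply/seteqP; split=> p; last by case=> [[i im ti]|[c|c]]; [left; exists i|right; left|right; right].
  by case=> [[i ti]|[c|c]]; [left; exists i => //=; case: ti => + _ _; have := half2_gt1 tw; lia|right; left|right; right].
apply: closedU; [apply: closed_bigcup|apply: closedU].
- exact: finite_II.
- move=> i /= im; have im' : (i.+1 < m.*2)%N by have := half2_gt1 tw; lia.
  have -> : [set p | turn tw i (enorm (lsubmx p)) (rsubmx p)] = [set p : W | side i (enorm (lsubmx p))] `&`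
     ([set p : W | rsubmx p = mid i + dot (rsubmx p - mid i) (dir i) *: dir i] `&`
      [set p : W | (2 / 3 * dot (rsubmx p - mid i) (dir i)) ^+ 2 + excess i (enorm (lsubmx p)) ^+ 3 = 1]).
    rewrite eqEsubset; split=> p.
      by move=> /= tp; have [_ sp _] := tp; split=> //; apply/turn_dot.
    by move=> [sp tp] /=; apply/turn_dot.
  apply: closedI; last apply: closedI.
  + rewrite /side; case: (odd i).
      by apply: (closed_leC (f := fun p => enorm (lsubmx p))); exact: continuous_radius.
    by apply: (closed_geC (f := fun p => enorm (lsubmx p))); exact: continuous_radius.
  + by apply: (closed_yE (f := fun p => dot (rsubmx p - mid i) (dir i))); exact: continuous_along.
  + apply: (closed_eqC (f := fun p => (2 / 3 * dot (rsubmx p - mid i) (dir i)) ^+ 2 + excess i (enorm (lsubmx p)) ^+ 3)).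
    move=> p; have c1 : {for p, continuous (fun p => 2 / 3 * dot (rsubmx p - mid i) (dir i))}.
      have -> : (fun p => 2 / 3 * dot (rsubmx p - mid i) (dir i)) =
                (fun p => dot (rsubmx p - mid i) ((2 / 3) *: dir i)).
        by apply/funext => q; exact/esym/dotZr.
      exact: continuous_along.
    have c2 : {for p, continuous (fun p => excess i (enorm (lsubmx p)))}.
      apply: (@continuous_comp _ _ _ (fun p => enorm (lsubmx p)) (excess i)); first exact: continuous_radius.
      exact: continuous_excess.
    exact: (continuousD (continuous_expr c1) (continuous_expr c2)).
- apply: closedI.
    by apply: (closed_leC (f := fun p => enorm (lsubmx p))); exact: continuous_radius.
  apply: (closed_yE (f := fun p => psi (enorm (lsubmx p)))) => p.
  by apply: (@continuous_comp _ _ _ (fun p => enorm (lsubmx p)) psi); [exact: continuous_radius|exact: continuous_psi].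
- apply: closedI.
    by apply: (closed_leC (f := fun p => enorm (lsubmx p))); exact: continuous_radius.
  have cl : closed [set p : W | rsubmx p = h (m.*2).-1 + cst 0 p *: (0 : Y)].
    by apply: closed_yE; exact: cst_continuous.
  have E : [set p : W | rsubmx p = h (m.*2).-1 + cst 0 p *: (0 : Y)] = (fun p => rsubmx p = h (m.*2).-1).
    by apply/funext => p; rewrite /= scaler0 addr0.
  by rewrite E in cl; exact: cl.
Qed.

Lemma over_norm i j y (Hb : R) : (forall k, (k < m.*2)%N -> enorm (h k) <= Hb) ->
  (i < m.*2)%N -> (j < m.*2)%N -> over tw i j y -> enorm y <= Hb.
Proof.
move=> hb im jm [s /andP[s0 s1] ->]; apply: le_trans (enormD _ _) _.
rewrite !enormZ !ger0_norm ?subr_ge0//.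
have h1 := ler_wpM2l (_ : 0 <= 1 - s) (hb _ im); have h2 := ler_wpM2l s0 (hb _ jm).
by move: h1 h2; rewrite subr_ge0 => /(_ s1); lra.
Qed.

Lemma turn_bounds i r y : turn tw i r y -> r <= b + 9 / 4 /\ 1 / 8 <= r.
Proof.
move=> t; split; last exact: turn_far t.
case: t => im si [z pz]; have [_ u1] := profile_bounds pz; have bb := rad_gt0 tw.
move: si u1; rewrite /side /excess /b0; case: ifP => oi; first by lra.
by move=> _; case: (pos_cases ((r - b) * (4 / 9))) => -[w0 ->]; lra.
Qed.

Lemma curve_bounds (Hb : R) r y : `|eta| <= 1 -> (forall k, (k < m.*2)%N -> enorm (h k) <= Hb) ->
  curve r y -> r <= b + 9 / 4 /\ enorm y <= Hb + 1.
Proof.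
move=> eta1 hb; have bb := rad_gt0 tw; have m1 := half2_gt1 tw.
case=> [[i ti]|[[rb ->]|[rb ->]]]; rewrite /b0 in hb m1 bb *.
- split; first by have [] := turn_bounds ti.
  case: ti => im si [z pz]; have := over_norm hb (ltnW im) im (over_profile pz); lra.
- split; first by move: rb; rewrite /b0; lra.
  apply: le_trans (enormD _ _) _; apply: lerD; first by apply: hb; exact: ltnW.
  rewrite enormZ enorm_dir// mulr1 /bump normrM.
  apply: le_trans (ler_piMr (normr_ge0 _) _) eta1.
  have /andP[p0 p1] := pos1_bounds (r / delta).
  by rewrite ger0_norm ?exprn_ge0// exprn_ile1.
- split; first by move: rb; rewrite /b0; lra.
  have lm : (m.*2.-1 < m.*2)%N by lia.
  by have := hb _ lm; lra.
Qed.

Lemma tower_compact : `|eta| <= 1 -> compact M.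
Proof.
move=> eta1; pose Hb := \sum_(k < m.*2) enorm (h k).
have hb k : (k < m.*2)%N -> enorm (h k) <= Hb.
  move=> km; rewrite /Hb (bigD1 (Ordinal km))//= lerDl sumr_ge0// => i _; exact: enorm_ge0.
apply: (subclosed_compact tower_closed (@compact_eball R (d + e) (b + 9 / 4 + (Hb + 1)))) => p Mp.
have [rb yb] := curve_bounds eta1 hb Mp; rewrite /eball/= subr0.
have b90 : 0 <= b + 9 / 4 by have := rad_gt0 tw; lra.
have E : enorm p ^+ 2 = enorm (lsubmx p) ^+ 2 + enorm (rsubmx p) ^+ 2 by rewrite -{1}(hsubmxK p) enorm_row_mx.
have := enorm_ge0 (lsubmx p); have := enorm_ge0 (rsubmx p) => y0 x0.
apply: (@le_trans _ _ (enorm (lsubmx p) + enorm (rsubmx p))); last exact: lerD.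
rewrite -(ler_pXn2r (n := 2)) ?nnegrE ?enorm_ge0 ?addr_ge0// E sqrrD.
by rewrite addrAC lerDl mulrn_wge0// mulr_ge0.
Qed.

(** Membership in a common connected part of the tower; transitivity takes a union of two sets, with
    no concatenation of paths. *)
Definition linked p q := exists2 C : set W, connected C & [/\ C `<=` M, C p & C q].

Lemma linked_trans q p p' : linked p q -> linked q p' -> linked p p'.
Proof.
move=> [C cC [CM Cp Cq]] [C' cC' [CM' Cq' Cp']]; exists (C `|` C').
  by apply: connectedU => //; exists q.
by split; [move=> u [/CM|/CM']|left|right].
Qed.

Lemma linked_path (f : R -> W) (a c s t : R) : continuous f ->
  (forall r, a <= r -> r <= c -> M (f r)) -> a <= s -> s <= c -> a <= t -> t <= c -> linked (f s) (f t).
Proof.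
move=> cf fM as_ sc at_ tc; exists (f @` `[a, c]).
  apply: connected_continuous_connected; first exact: segment_connected.
  exact: continuous_subspaceT.
split; last 2 first.
- by exists s => //=; rewrite in_itv/= as_.
- by exists t => //=; rewrite in_itv/= at_.
by move=> _ [r /= + <-]; rewrite in_itv/= => /andP[r1 r2]; exact: fM.
Qed.

Lemma continuous_ray (th : X) (w u : Y) (g : R -> R) : continuous g ->
  continuous (fun r => row_mx (r *: th) (w + g r *: u) : W).
Proof.
move=> cg r; have -> : (fun r : R => row_mx (r *: th) (w + g r *: u) : W) =
    (fun r => (r *: (row_mx th 0 : W)) + (row_mx 0 w + g r *: row_mx 0 u)).
  apply/funext => s; rewrite !scale_row_mx !scaler0 !add_row_mx !add0r addr0 //.
apply: cvgD; first by apply: cvgZr_tmp; exact: cvg_id.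
apply: cvgD; first exact: cvg_cst.
by apply: cvgZr_tmp; exact: cg.
Qed.

Hypothesis delta_b0 : 0 < delta /\ delta <= b0.

Lemma psi_b0 : psi b0 = 0.
Proof. by case: delta_b0 => h1 h2; apply: psi_out. Qed.

Lemma linked_cap0 (th : X) r s : enorm th = 1 -> 0 <= r -> r <= b0 -> 0 <= s -> s <= b0 ->
  linked (row_mx (r *: th) (h 0%N + psi r *: dir 0%N)) (row_mx (s *: th) (h 0%N + psi s *: dir 0%N)).
Proof.
move=> th1 r0 rb s0 sb.
apply: (@linked_path (fun r => row_mx (r *: th) (h 0%N + psi r *: dir 0%N)) 0 b0) => //.
  by apply: continuous_ray; exact: continuous_psi.
move=> t t0 tb; rewrite tower_row enormZ th1 mulr1 ger0_norm//.
by right; left.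
Qed.

Lemma linked_cap1 (th : X) r s : enorm th = 1 -> 0 <= r -> r <= b0 -> 0 <= s -> s <= b0 ->
  linked (row_mx (r *: th) (h (m.*2).-1)) (row_mx (s *: th) (h (m.*2).-1)).
Proof.
move=> th1 r0 rb s0 sb.
apply: (@linked_path (fun r => row_mx (r *: th) (h (m.*2).-1)) 0 b0) => //.
  have -> : (fun r => row_mx (r *: th) (h (m.*2).-1)) =
      (fun r => row_mx (r *: th) (h (m.*2).-1 + cst 0 r *: (0 : Y))).
    by apply/funext => t; rewrite scaler0 addr0.
  by apply: (continuous_ray (g := cst 0)); exact: cst_continuous.
move=> t t0 tb; rewrite tower_row enormZ th1 mulr1 ger0_norm//.
by right; right.
Qed.

Lemma turn_range i : (i.+1 < m.*2)%N -> exists a c, [/\ 0 <= a, a <= b0, b0 <= c,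
  (forall r, a <= r -> r <= c -> side i r /\ excess i r <= 1) &
  (forall r, side i r -> excess i r <= 1 -> a <= r /\ r <= c) /\
  exists2 r1, a <= r1 <= c & excess i r1 = 1].
Proof.
move=> im; have b0p := b0_ge tw; have bE : b = 2 * b0 by rewrite /b0; field.
have [oi|oi] := boolP (odd i).
  have b14 := odd_rad oi im; exists (9 / 4), b0; split=> //; [lra| |].
    move=> r r1 r2; rewrite /side /excess oi; split=> //.
    by case: (pos_cases ((9 / 2 - r) * (4 / 9))) => -[w0 ->]; lra.
  split.
    move=> r; rewrite /side /excess oi => rb.
    by case: (pos_cases ((9 / 2 - r) * (4 / 9))) => -[w0 ->]; lra.
  exists (9 / 4); first by apply/andP; split; lra.
  by rewrite /excess oi pos_id; lra.
exists b0, (b + 9 / 4); split=> //; [lra|lra| |].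
  move=> r r1 r2; rewrite /side /excess (negPf oi); split=> //.
  by case: (pos_cases ((r - b) * (4 / 9))) => -[w0 ->]; lra.
split.
  move=> r; rewrite /side /excess (negPf oi) => rb.
  by case: (pos_cases ((r - b) * (4 / 9))) => -[w0 ->]; lra.
exists (b + 9 / 4); first by apply/andP; split; lra.
by rewrite /excess (negPf oi) pos_id; lra.
Qed.

Definition arc i (c : R) (th : X) r : W :=
  row_mx (r *: th) (mid i + (c * (3 / 2 * Num.sqrt (1 - excess i r ^+ 3))) *: dir i).

Lemma linked_arc i c th : enorm th = 1 -> (i.+1 < m.*2)%N -> c ^+ 2 = 1 ->
  exists a1 a2 r1, [/\ 0 <= a1, a1 <= b0 <= a2, a1 <= r1 <= a2, excess i r1 = 1 /\ side i r1 &
   (forall r, side i r -> excess i r <= 1 -> a1 <= r /\ r <= a2) /\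
   forall r s, a1 <= r -> r <= a2 -> a1 <= s -> s <= a2 -> linked (arc i c th r) (arc i c th s)].
Proof.
move=> th1 im c1; have [a1 [a2 [h1 h2 h3 h4 [h5 [r1 h6 h7]]]]] := turn_range im.
have side1 : side i r1 by case/andP: (h6) => r11 r12; exact: (h4 r1 r11 r12).1.
exists a1, a2, r1; split=> //; first by rewrite h2.
split=> // r s ar ra as_ sa; apply: (@linked_path (arc i c th) a1 a2) => //.
  apply: continuous_ray => t; apply: cvgM; first exact: cvg_cst.
  apply: cvgM; first exact: cvg_cst.
  apply: (@continuous_comp _ _ _ (fun r => 1 - excess i r ^+ 3) (@Num.sqrt R)); last exact: sqrt_continuous.
  by apply: cvgB; [exact: cvg_cst|apply: continuous_expr; exact: continuous_excess].
move=> t at_ ta; have [st e1] := h4 t at_ ta.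
rewrite tower_row enormZ th1 mulr1 ger0_norm; last by apply: le_trans at_.
left; exists i; split=> //; exists (c * (3 / 2 * Num.sqrt (1 - excess i t ^+ 3))).
exact: profile_sqrt.
Qed.

Lemma excess_b0 i : (i.+1 < m.*2)%N -> excess i b0 = 0.
Proof.
move=> im; have [oi|oi] := boolP (odd i).
  by apply: excess_odd => //; have := odd_rad oi im; rewrite /b0; lra.
by apply: excess_even => //; rewrite /b0; have := rad_gt0 tw; lra.
Qed.

Lemma arc_b0 i th : (i.+1 < m.*2)%N ->
  arc i (-1) th b0 = row_mx (b0 *: th) (h i) /\ arc i 1 th b0 = row_mx (b0 *: th) (h i.+1).
Proof.
move=> im; rewrite /arc excess_b0// expr0n/= subr0 sqrtr1 mulr1 mul1r mulN1r.
by rewrite scaleNr mid_dirN mid_dirP.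
Qed.

(** The upper and lower sheets are arcs parametrized by [r], which meet at the radius of excess 1,
    where both have height 0. *)
Lemma linked_turn i th r y : enorm th = 1 -> turn tw i r y ->
  linked (row_mx (r *: th) y) (row_mx (b0 *: th) (h i)) /\
  linked (row_mx (b0 *: th) (h i)) (row_mx (b0 *: th) (h i.+1)).
Proof.
move=> th1 [im si [z pz]]; have [zb e1] := profile_bounds pz.
have s1 : (-1) ^+ 2 = 1 :> R by rewrite sqrrN expr1n.
have [a1 [a2 [r1 [h1 /andP[h2 h3] /andP[h4 h5] [h6 _] [h7 lo]]]]] := linked_arc th1 im s1.
have [a1' [a2' [r1' [h1' /andP[h2' h3'] /andP[h4' h5'] [h6' side1] [h7' up]]]]] := linked_arc th1 im (expr1n _ 2).
have top (t : R) : excess i t = 1 -> arc i 1 th t = arc i (-1) th t.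
  by move=> et; rewrite /arc et expr1n subrr sqrtr0 !mulr0.
have [E1 E2] := arc_b0 th im.
have [ar ra] := h7 _ si e1; have [ar' ra'] := h7' _ si e1.

have lk : linked (row_mx (b0 *: th) (h i.+1)) (row_mx (b0 *: th) (h i)).
  rewrite -E1 -E2; apply: (@linked_trans (arc i 1 th r1')); first exact: up.
  rewrite (top _ h6'); apply: lo => //; by have [] := h7 r1' side1; rewrite ?h6'.
split; last first.
  by case: lk => C cC [CM C1 C2]; exists C.
have [|] := leP 0 z => z0.
  apply: linked_trans lk; rewrite -E2.
  have -> : row_mx (r *: th) y = arc i 1 th r.
    rewrite /arc mul1r; case: pz => -> pE; congr (row_mx _ (_ + _ *: _)).
    have -> : 1 - excess i r ^+ 3 = (2 / 3 * z) ^+ 2 by apply/eqP; rewrite subr_eq pE.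
    by rewrite sqrtr_sqr ger0_norm ?mulr_ge0//; field.
  exact: up.
rewrite -E1; have -> : row_mx (r *: th) y = arc i (-1) th r.
  rewrite /arc mulN1r; case: pz => -> pE; congr (row_mx _ (_ + _ *: _)).
  have -> : 1 - excess i r ^+ 3 = (2 / 3 * z) ^+ 2 by apply/eqP; rewrite subr_eq pE.
  by rewrite sqrtr_sqr ler0_norm ?pmulr_rle0 ?(ltW z0)//; field.
exact: lo.
Qed.

Lemma linked_height th k : enorm th = 1 -> (k < m.*2)%N ->
  linked (row_mx (b0 *: th) (h k)) (row_mx 0 (h 0%N + psi 0 *: dir 0%N)).
Proof.
move=> th1; elim: k => [_|k IH km].
  have b0p := b0_ge tw.
  have := @linked_cap0 th b0 0 th1; rewrite psi_b0 !scale0r addr0; apply=> //; lra.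
have tk : turn tw k b0 (h k).
  split=> //; first by rewrite /side; case: ifP.
  by exists (- (3 / 2)); apply: (profile_flat (excess_b0 km)).1.
have [_ lk] := linked_turn th1 tk; apply: linked_trans (IH (ltnW km)).
by case: lk => C cC [CM C1 C2]; exists C.
Qed.

(** In a fixed direction every point is led down the tower to the first disc, then to its centre,
    which is common to all directions. *)
Lemma tower_connected : connected M.
Proof.
pose p0 : W := row_mx 0 (h 0%N + psi 0 *: dir 0%N).
have lk p : M p -> linked p p0.
  rewrite -(hsubmxK p) tower_row; move: (lsubmx p) (rsubmx p) => x y.
  have [th [th1 ->]] := unit_direction x; rewrite enormZ th1 mulr1 ger0_norm ?enorm_ge0//.
  have := enorm_ge0 x; move: (enorm x) => r r0; have m1 := half2_gt1 tw; have b0p := b0_ge tw.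
  case=> [[i ti]|[[rb ->]|[rb ->]]].
  - have im : (i.+1 < m.*2)%N by case: ti.
    by apply: linked_trans (linked_turn th1 ti).1 (linked_height th1 (ltnW im)).
  - by have := @linked_cap0 th r 0 th1 r0 rb; rewrite scale0r; apply=> //; lra.
  - apply: linked_trans (linked_height (k := (m.*2).-1) th1 _); last by lia.
    by apply: linked_cap1 => //; lra.
have /choice[C CP] : forall p, exists C, M p -> [/\ connected C, C `<=` M, C p & C p0].
  move=> p; have [Mp|nMp] := pselect (M p); last by exists set0.
  by have [C cC [CM Cp C0]] := lk p Mp; exists C.
have -> : M = \bigcup_(p in M) C p.
  apply/seteqP; split=> [p Mp|p [q Mq Cp]]; first by exists p => //; have [] := CP p Mp.
  by have [_ CM _ _] := CP q Mq; exact: CM.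
apply: bigcup_connected; last by move=> p Mp; have [] := CP p Mp.
by exists p0 => p Mp; have [] := CP p Mp.
Qed.

End Manifold.

(** * Charts of the tower as graphs *)

Section GraphIntro.
Variables (R : realType) (d n : nat).
Local Notation V := 'rV[R]_d.
Local Notation W := 'rV[R]_n.

Lemma has_graph_intro (M U : set W) (p : W) (V1 : set V) (phi : V -> W) (b : 'I_d -> W) (c : V) :
  open U -> U p -> open V1 -> (forall v, V1 v -> forall k, c2_at (fun x => phi x 0 k) v) ->
  (forall v k, V1 v -> dot (phi v) (b k) + c 0 k = v 0 k) ->
  (forall v, V1 v -> U (phi v) -> M (phi v)) ->
  (forall q, M q -> U q -> exists2 v, V1 v & phi v = q) -> has_graph d M p.
Proof.
move=> oU Up oV1 C2phi sec into onto.
exists U, (V1 `&` phi @^-1` U), phi, b, c; split=> //.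
- rewrite openE => v [V1v Uv]; apply: filterI; first exact: open_nbhs_nbhs.
  have [_ /(_ v V1v)[cphi _]] := C2_onP oV1 C2phi.
  by apply: cphi; exact: open_nbhs_nbhs.
- by move=> v [V1v _]; exact: C2phi.
- by move=> v k [V1v _]; exact: sec.
rewrite eqEsubset; split=> [_ [v [V1v Uv] <-]|q [Mq Uq]].
  by split; [exact: into|].
by have [v V1v vq] := onto q Mq Uq; exists v => //; split=> //=; rewrite vq.
Qed.

Lemma c2_continuous (f : V -> R) v : c2_at f v -> {for v, continuous f}.
Proof. by move=> [f1 [f2 hf]]; have [] := nbhs_singleton hf. Qed.

Lemma dot_unitv (v : V) k : dot v (unitv R k) = v 0 k.
Proof.
rewrite /dot (bigD1 k)//= big1 ?addr0 ?mxE ?eqxx ?mulr1// => i ik.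
by rewrite mxE (negPf ik) andbF mulr0.
Qed.

End GraphIntro.

Section RowGraphs.
Variables (R : realType) (d e : nat).
Local Notation X := 'rV[R]_d.
Local Notation Y := 'rV[R]_e.
Local Notation W := 'rV[R]_(d + e).
Implicit Types (M U : set W).

Lemma has_graph_over M U (p : W) (V1 : set X) (f : X -> R) (w u : Y) :
  open U -> U p -> open V1 -> (forall v, V1 v -> c2_at f v) ->
  (forall v, V1 v -> U (row_mx v (w + f v *: u)) -> M (row_mx v (w + f v *: u))) ->
  (forall q, M q -> U q -> V1 (lsubmx q) /\ rsubmx q = w + f (lsubmx q) *: u) -> has_graph d M p.
Proof.
move=> oU Up oV1 c2f into onto.
apply: (has_graph_intro (U := U) (V1 := V1) (phi := fun v => row_mx v (w + f v *: u))
  (b := fun k => row_mx (unitv R k) 0) (c := 0)) => //.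
- move=> v V1v k; case: (split_ordP k) => j ->.
    have -> : (fun x : X => row_mx x (w + f x *: u) 0 (lshift e j)) = (fun x => x 0 j).
      by apply/funext => x; rewrite row_mxEl.
    exact: c2_coord.
  have -> : (fun x : X => row_mx x (w + f x *: u) 0 (rshift d j)) = (fun x => cst (w 0 j) x + f x * cst (u 0 j) x).
    by apply/funext => x; rewrite row_mxEr !mxE.
  by apply: c2_add; [exact: c2_cst|apply: c2_mul; [exact: c2f|exact: c2_cst]].
- by move=> v k V1v; rewrite dot_row_mx dot0r mxE !addr0 dot_unitv.
move=> q Mq Uq; have [V1q yE] := onto q Mq Uq; exists (lsubmx q) => //.
by rewrite -yE hsubmxK.
Qed.

Definition upd (x : X) j t : X := \row_k (if k == j then t else x 0 k).
Definition rest j (x : X) : R := \sum_(k | k != j) x 0 k * x 0 k.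

Lemma dot_rest j (x : X) : dot x x = x 0 j ^+ 2 + rest j x.
Proof. by rewrite /dot (bigD1 j)//= expr2. Qed.

Lemma rest_upd j x t : rest j (upd x j t) = rest j x.
Proof. by apply: eq_bigr => k kj; rewrite mxE (negPf kj). Qed.

(** Where the tangent space is vertical the set is not a graph over [R^d]. A nonzero coordinate
    [x 0 j] is exchanged for the height [t]: it is recovered, with its sign [cs], as a square root
    of [g t] minus the squares of the other coordinates. *)
Lemma has_graph_side M U (p : W) (j : 'I_d) (A : set R) (g : R -> R) (w u : Y) (cs : R) :
  open U -> U p -> open A -> (forall v : X, A (v 0 j) -> c2_at (fun x => g (x 0 j)) v) ->
  dot u u = 1 -> cs ^+ 2 = 1 ->
  (forall (x : X) t, A t -> 0 < cs * x 0 j -> dot x x = g t -> U (row_mx x (w + t *: u)) -> M (row_mx x (w + t *: u))) ->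
  (forall q, M q -> U q -> exists t, [/\ A t, rsubmx q = w + t *: u, dot (lsubmx q) (lsubmx q) = g t &
      0 < cs * lsubmx q 0 j]) -> has_graph d M p.
Proof.
move=> oU Up oA c2g uu cs1 into onto.
pose F (v : X) := g (v 0 j) + - rest j v.
have c2F (v : X) : A (v 0 j) -> c2_at F v.
  move=> Av; apply: c2_add; first exact: c2g.
  apply: c2_opp; apply: c2_sum => k _; apply: c2_mul; exact: c2_coord.
pose V1 : set X := [set v : X | A (v 0 j) /\ 0 < F v].
have oV1 : open V1.
  rewrite openE => v [Av Fv]; apply: filterI.
    have cj : {for v, continuous (fun x : X => x 0 j)} by exact: c2_continuous (c2_coord j v).
    by apply: (cj A); exact: open_nbhs_nbhs.
  exact: (cvgr_gt _ (c2_continuous (c2F v Av))).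
pose phi (v : X) : W := row_mx (upd v j (cs * Num.sqrt (F v))) (w + v 0 j *: u).
have updE (x : X) t : upd x j t 0 j = t by rewrite mxE eqxx.
apply: (has_graph_intro (U := U) (V1 := V1) (phi := phi)
  (b := fun k => if k == j then row_mx 0 u else row_mx (unitv R k) 0)
  (c := \row_k (if k == j then - dot w u else 0))) => //.
- move=> v [Av Fv] k; case: (split_ordP k) => l ->.
    have [->|lj] := eqVneq l j.
      have -> : (fun x => phi x 0 (lshift e j)) = (fun x => cst cs x * Num.sqrt (F x)).
        by apply/funext => x; rewrite row_mxEl updE.
      by apply: c2_mul; [exact: c2_cst|apply: c2_sqrt => //; exact: c2F].
    have -> : (fun x => phi x 0 (lshift e l)) = (fun x => x 0 l).
      by apply/funext => x; rewrite row_mxEl mxE (negPf lj).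
    exact: c2_coord.
  have -> : (fun x => phi x 0 (rshift d l)) = (fun x => cst (w 0 l) x + x 0 j * cst (u 0 l) x).
    by apply/funext => x; rewrite row_mxEr !mxE.
  by apply: c2_add; [exact: c2_cst|apply: c2_mul; [exact: c2_coord|exact: c2_cst]].
- move=> v k [Av Fv]; rewrite mxE; case: eqVneq => [->|kj].
    by rewrite dot_row_mx dot0r dotDl dotZl uu; ring.
  by rewrite dot_row_mx dot0r dot_unitv mxE (negPf kj) !addr0.
- move=> v [Av Fv] Uv; apply: into => //; first by rewrite updE mulrA -expr2 cs1 mul1r sqrtr_gt0.
  rewrite (dot_rest j) updE rest_upd exprMn cs1 mul1r sqr_sqrtr ?(ltW Fv)//.
  by rewrite /F subrK.
move=> q Mq Uq; have [t [At yE xE cx]] := onto q Mq Uq.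
have FE : F (upd (lsubmx q) j t) = lsubmx q 0 j ^+ 2.
  by rewrite /F updE rest_upd -xE (dot_rest j) addrK.
exists (upd (lsubmx q) j t).
  split; rewrite ?updE// FE exprn_even_gt0//=; apply/eqP => x0.
  by move: cx; rewrite x0 mulr0 ltxx.
rewrite /phi FE sqrtr_sqr updE -yE -[RHS]hsubmxK; congr row_mx.
apply/rowP => k; rewrite !mxE; case: eqVneq => [->|//].
by move: cx; case: (sqr1_cases cs1) => ->; rewrite ?mul1r ?mulN1r ?oppr_gt0 mxE => cx;
  [rewrite gtr0_norm|rewrite ltr0_norm ?opprK].
Qed.

End RowGraphs.

Section Manifold.
Variables (R : realType) (d0 e : nat) (tw : tower R e) (eta delta : R).
Local Notation d := d0.+1.
Local Notation X := 'rV[R]_d.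
Local Notation Y := 'rV[R]_e.
Local Notation W := 'rV[R]_(d + e).
Local Notation h := (height tw).
Local Notation m := (half tw).
Local Notation b := (rad tw).
Local Notation b0 := (b0 tw).
Local Notation mid := (mid tw).
Local Notation dir := (dir tw).
Local Notation excess := (excess tw).
Local Notation profile := (profile tw).
Local Notation side := (side tw).
Local Notation curve := (curve tw eta delta).
Local Notation psi := (bump eta delta).
Implicit Types (i j k : nat) (r s t : R) (x : X) (y : Y) (p q : W).
Variable rho : R.
Hypothesis gb : good_bump eta delta rho.
Let delta0 : 0 < delta. Proof. by case: gb. Qed.
Local Notation M := (tower_set (d0 := d0) tw eta delta).

Lemma open_ltC (f : W -> R) c : continuous f -> open [set p | f p < c].
Proof. by move=> cf; apply: (@open_comp _ _ f [set t | t < c]) => [p _|]; [exact: cf|exact: open_lt]. Qed.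
Lemma open_gtC (f : W -> R) c : continuous f -> open [set p | c < f p].
Proof. by move=> cf; apply: (@open_comp _ _ f [set t | c < t]) => [p _|]; [exact: cf|exact: open_gt]. Qed.

Definition inside i : set W := [set p | if odd i then enorm (lsubmx p) < b0 else b0 < enorm (lsubmx p)].

Lemma open_inside i : open (inside i).
Proof.
rewrite /inside; case: (odd i).
  by apply: (open_ltC (f := fun p => enorm (lsubmx p))); exact: continuous_radius.
by apply: (open_gtC (f := fun p => enorm (lsubmx p))); exact: continuous_radius.
Qed.

Lemma inside_side i p : inside i p -> side i (enorm (lsubmx p)).
Proof. by rewrite /inside /side /=; case: (odd i) => /ltW. Qed.

Lemma inside_side_odd i j p : inside i p -> side j (enorm (lsubmx p)) -> odd i = odd j.
Proof.
rewrite /inside /side /=; case: (odd i); case: (odd j) => // h1 h2.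
  by have := lt_le_trans h1 h2; rewrite ltxx.
by have := le_lt_trans h2 h1; rewrite ltxx.
Qed.

Lemma cap_far i k (y0 y : Y) (z : R) r : (i.+1 < m.*2)%N -> odd i -> (k = 0 \/ k = (m.*2).-1)%N ->
  profile i r y0 z -> enorm (y - h k) <= 1 / 1000 -> enorm (y - y0) < 2 -> False.
Proof.
move=> im oi kE pz yk yy; have m1 := half2_gt1 tw.
have km : (k < m.*2)%N by case: kE => ->; lia.
have [k1 k2] : k <> i /\ k <> i.+1.
  have ol : odd (m.*2).-1 by have := odd_double m; case: (m.*2) m1 => // l _ /= /negbFE.
  case: kE => kE; rewrite kE; first by split=> E; [move: oi; rewrite -E|].
  by split=> E; [move: im; rewrite -E; lia|move: ol; rewrite E /= oi].
have := over_far (link_vertex km) (link_edge im) (over_vertex tw k) (over_profile pz) k1 k2 k1 k2.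
have := enorm_triangle y (h k) y0; rewrite (enormB (h k) y); move: yk yy; lra.
Qed.

Lemma psi_small r : enorm (h 0%N + psi r *: dir 0%N - h 0%N) <= 1 / 1000.
Proof.
rewrite addrC addKr enormZ enorm_dir ?half2_gt1// mulr1.
by case: gb => g1 g2 g3 g4 g5; have := psi_le g1 g2 g3 g4 g5 r; rewrite -natrX; lra.
Qed.

(** Turns on the same side have the same parity, hence disjoint edges, and are more than 21/10
    apart. Caps compete only with tunnels, over edges that avoid both end vertices. *)
Lemma turn_local i p q : (i.+1 < m.*2)%N -> inside i p -> turn tw i (enorm (lsubmx p)) (rsubmx p) ->
  M q -> inside i q -> enorm (rsubmx q - rsubmx p) < 2 -> turn tw i (enorm (lsubmx q)) (rsubmx q).
Proof.
move=> im ip tp Mq iq qp; case: (tp) => _ _ [z pz].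
case: Mq => [[j tj]|cc].
  have oij : odd i = odd j by case: (tj) => _ sj _; exact: inside_side_odd iq sj.
  have [ijE|ij] := eqVneq i j; first by rewrite ijE.
  exfalso.
  case: tj => jm sj [z' pz'].
  have n1 : i <> j by apply/eqP.
  have n2 : i <> j.+1 by move=> E; move: oij; rewrite E /=; case: (odd j).
  have n3 : i.+1 <> j by move=> E; move: oij; rewrite -E /=; case: (odd i).
  have n4 : i.+1 <> j.+1 by move=> [].
  have := over_far (link_edge im) (link_edge jm) (over_profile pz) (over_profile pz') n1 n2 n3 n4.
  by rewrite enormB; move: qp; lra.
have oi : odd i.
  move: iq; rewrite /inside /=; case: (odd i) => // b0q.
  by case: cc => -[qb _]; have := lt_le_trans b0q qb; rewrite ltxx.
exfalso; case: cc => -[qb qE].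
  by apply: (cap_far im oi (or_introl erefl) pz _ qp); rewrite qE; exact: psi_small.
have k0 : 0 <= 1 / 1000 :> R by lra.
by apply: (cap_far im oi (or_intror erefl) pz _ qp); rewrite qE subrr enorm0.
Qed.

Lemma sign_ex (z : R) : z != 0 -> exists2 c : R, c ^+ 2 = 1 & 0 < c * z.
Proof.
rewrite neq_lt => /orP[z0|z0]; first by exists (-1); rewrite ?sqrrN ?expr1n// mulN1r oppr_gt0.
by exists 1; rewrite ?expr1n// mul1r.
Qed.

Definition axis_coord i q : R := dot (rsubmx q - mid i) (dir i).

Lemma axis_coordE i r q z : (i.+1 < m.*2)%N -> profile i r (rsubmx q) z -> axis_coord i q = z.
Proof. by move=> im [yE _]; rewrite /axis_coord yE addrC addKr dotZl dot_dir// mulr1. Qed.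

Lemma c2_excess i (v : X) : 0 < enorm v -> c2_at (fun x => excess i (enorm x) ^+ 3) v.
Proof.
move=> v0; have vn0 : v != 0 by rewrite -enorm_gt0.
rewrite /excess; case: (odd i).
  apply: (@c2_comp _ _ (fun s => pos s ^+ 3)); first exact: smooth2_pos3.
  apply: (@c2_mul _ _ _ (cst (4 / 9))); last exact: c2_cst.
  apply: (@c2_add _ _ (cst (9 / 2))); first exact: c2_cst.
  by apply: c2_opp; exact: c2_enorm.
apply: (@c2_comp _ _ (fun s => pos s ^+ 3)); first exact: smooth2_pos3.
apply: (@c2_mul _ _ _ (cst (4 / 9))); last exact: c2_cst.
apply: (@c2_add _ _ _ (cst (- b))); first exact: c2_enorm.
exact: c2_cst.
Qed.

Lemma chart_axial i p z : (i.+1 < m.*2)%N -> inside i p -> turn tw i (enorm (lsubmx p)) (rsubmx p) ->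
  profile i (enorm (lsubmx p)) (rsubmx p) z -> z != 0 -> has_graph d M p.
Proof.
move=> im ip tp pz zn0; have [c c1 cz] := sign_ex zn0.
have cax : continuous (axis_coord i) by exact: continuous_along.
have ccax : continuous (fun q => c * axis_coord i q).
  by move=> q; apply: continuousM; [exact: cst_continuous|exact: cax].
pose U := inside i `&` [set q | enorm (rsubmx q - rsubmx p) < 2] `&` [set q | 0 < c * axis_coord i q].
pose V1 : set X := [set v | 0 < enorm v /\ 0 < 1 + - (excess i (enorm v) ^+ 3)].
have c2w v : 0 < enorm v -> c2_at (fun x => 1 + - (excess i (enorm x) ^+ 3)) v.
  move=> v0; apply: (@c2_add _ _ (cst 1)); first exact: c2_cst.
  by apply: c2_opp; exact: c2_excess.
apply: (has_graph_over (U := U) (V1 := V1)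
   (f := fun v => c * (3 / 2 * Num.sqrt (1 - excess i (enorm v) ^+ 3))) (w := mid i) (u := dir i)).
- apply: openI; last exact: open_gtC.
  by apply: openI; [exact: open_inside|apply: open_ltC; exact: continuous_offset].
- by split; [split; [|rewrite /= subrr enorm0]|rewrite /= (axis_coordE im pz)].
- rewrite openE => v [v0 w0]; apply: filterI.
    by apply: (cvgr_gt _ (@continuous_enorm R d v)).
  exact: (cvgr_gt _ (c2_continuous (c2w v v0))).
- move=> v [v0 w0]; apply: (@c2_mul _ _ (cst c)); first exact: c2_cst.
  apply: (@c2_mul _ _ (cst (3 / 2))); first exact: c2_cst.
  by apply: c2_sqrt => //; exact: c2w.
- move=> v [v0 w0] [[iv _] _]; rewrite tower_row; left; exists i.
  have := inside_side iv; rewrite row_mxKl => si; split=> //.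
  exists (c * (3 / 2 * Num.sqrt (1 - excess i (enorm v) ^+ 3))); apply: profile_sqrt => //.
  have u0 := excess_ge0 tw i (enorm v).
  by rewrite -(ler_pXn2r (n := 3))// ?nnegrE// expr1n; move: w0; rewrite subr_gt0 => /ltW.
move=> q Mq [[iq qp] ca]; have tq := turn_local im ip tp Mq iq qp.
case: (tq) => _ sq [z' pz']; have zE := axis_coordE im pz'.
rewrite /= zE in ca; have [yE pE] := pz'.
have wE : 1 - excess i (enorm (lsubmx q)) ^+ 3 = (2 / 3 * z') ^+ 2 by apply/eqP; rewrite subr_eq pE.
split.
  split; first by have [_ r8] := turn_bounds tq; lra.
  rewrite wE exprn_even_gt0//= mulf_neq0 ?mulf_neq0//; apply/eqP => z0.
  by move: ca; rewrite z0 mulr0 ltxx.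
rewrite wE sqrtr_sqr yE; congr (_ + _ *: _).
rewrite normrM (@gtr0_norm _ (2 / 3))//.
by move: ca; case: (sqr1_cases c1) => ->; rewrite ?mul1r ?mulN1r ?oppr_gt0 => ca;
  [rewrite gtr0_norm//; field|rewrite ltr0_norm//; field].
Qed.

Definition turn_radius i (t : R) : R :=
  (if odd i then 9 / 2 else b) + epsi R i * (9 / 4) * ((1 + - (2 / 3 * t) ^+ 2) `^ 3^-1).

Lemma cbrtK (w : R) : 0 <= w -> (w `^ 3^-1) ^+ 3 = w.
Proof. by move=> w0; rewrite -powR_mulrn ?powR_ge0// -powRrM mulVf// powRr1. Qed.

Lemma cbrt_le1 (w : R) : 0 <= w -> w <= 1 -> w `^ 3^-1 <= 1.
Proof. by move=> w0 w1; rewrite -(ler_pXn2r (n := 3)) ?nnegrE ?powR_ge0// expr1n cbrtK. Qed.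

Lemma excess_turn_radius i t : 0 < 1 + - (2 / 3 * t) ^+ 2 -> (i.+1 < m.*2)%N -> 0 <= turn_radius i t /\
  excess i (turn_radius i t) = (1 + - (2 / 3 * t) ^+ 2) `^ 3^-1.
Proof.
move=> w0 im; have w1 : 1 + - (2 / 3 * t) ^+ 2 <= 1 by rewrite gerDl oppr_le0 sqr_ge0.
have := cbrt_le1 (ltW w0) w1; have := powR_ge0 (1 + - (2 / 3 * t) ^+ 2) 3^-1.
rewrite /turn_radius /excess /epsi; move: (_ `^ _) => u u0 u1; have bb := rad_gt0 tw.
case: (odd i); split; try lra.
  by rewrite (_ : (9 / 2 - _) * _ = u) ?pos_id//; field.
by rewrite (_ : (_ - b) * _ = u) ?pos_id//; field.
Qed.

Lemma turn_radiusE i r y z : profile i r y z -> 0 < 1 + - (2 / 3 * z) ^+ 2 -> r = turn_radius i z.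
Proof.
move=> [_ pE] w0; have u0 := excess_ge0 tw i r.
have uE : (1 + - (2 / 3 * z) ^+ 2) `^ 3^-1 = excess i r.
  apply/eqP; rewrite -(@eqrXn2 _ 3) ?powR_ge0// cbrtK ?(ltW w0)//; apply/eqP; move: pE; lra.
have : 0 < excess i r by rewrite -uE powR_gt0.
rewrite /turn_radius uE /excess /epsi; case: (odd i).
  by case: (pos_cases ((9 / 2 - r) * (4 / 9))) => -[s0 ->]; rewrite ?ltxx// => _; field.
by case: (pos_cases ((r - b) * (4 / 9))) => -[s0 ->]; rewrite ?ltxx// => _; field.
Qed.

(** The remaining points of a turn are those of height 0, where the radius is a smooth function of
    the height. *)
Lemma chart_radial i p : (i.+1 < m.*2)%N -> inside i p -> turn tw i (enorm (lsubmx p)) (rsubmx p) ->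
  profile i (enorm (lsubmx p)) (rsubmx p) 0 -> has_graph d M p.
Proof.
move=> im ip tp pz.
have x0 : lsubmx p != 0 by have [_ r8] := turn_bounds tp; rewrite -enorm_gt0; lra.
have [j xj] : exists j : 'I_d, lsubmx p 0 j != 0.
  apply: contrapT => /forallNP nj; move/eqP: x0; apply; apply/rowP => k; rewrite [RHS]mxE.
  by have := nj k; move/negP; rewrite negbK => /eqP.
have [c c1 cx] := sign_ex xj.
have cax : continuous (axis_coord i) by exact: continuous_along.
pose A : set R := [set t | 0 < 1 + - (2 / 3 * t) ^+ 2].
have cw : continuous (fun t : R => 1 + - (2 / 3 * t) ^+ 2).
  move=> t; have c2 : {for t, continuous (fun t : R => 2 / 3 * t)}.
    by apply: continuousM; [exact: cst_continuous|exact: cvg_id].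
  have c3 : {for t, continuous (fun t : R => 1 - (2 / 3 * t) ^+ 2)}.
    by apply: continuousB; [exact: cst_continuous|exact: continuous_expr].
  exact: c3.
have oA : open A.
  apply: (@open_comp _ _ (fun t : R => 1 + - (2 / 3 * t) ^+ 2) [set t | 0 < t]) => [t _|].
    exact: cw.
  exact: open_gt.
have clx : continuous (fun q => c * lsubmx q 0 j).
  move=> q; apply: continuousM; first exact: cst_continuous.
  by apply: (@continuous_comp _ _ _ (fun q : W => lsubmx q) (fun x : X => x 0 j));
    [exact: continuous_lsub|exact: coord_continuous].
pose U := inside i `&` [set q | enorm (rsubmx q - rsubmx p) < 2] `&` (axis_coord i @^-1` A)
  `&` [set q | 0 < c * lsubmx q 0 j].
apply: (has_graph_side (U := U) (j := j) (A := A) (g := fun t => turn_radius i t * turn_radius i t)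
   (w := mid i) (u := dir i) (cs := c)) => //.
- apply: openI; last exact: open_gtC.
  apply: openI; last by apply: open_comp => // q _; exact: cax.
  by apply: openI; [exact: open_inside|apply: open_ltC; exact: continuous_offset].
- split=> //; split; first by split=> //=; rewrite subrr enorm0.
  by rewrite /A /= (axis_coordE im pz) mulr0 expr0n/= subr0.
- move=> v Av; have c2r : c2_at (fun x : X => turn_radius i (x 0 j)) v.
    apply: (@c2_add _ _ (cst (if odd i then 9 / 2 else b))); first exact: c2_cst.
    apply: (@c2_mul _ _ (cst (epsi R i * (9 / 4)))); first exact: c2_cst.
    apply: (@c2_comp _ _ (fun s => s `^ 3^-1)); first exact: smooth2_powR.
    apply: (@c2_add _ _ (cst 1)); first exact: c2_cst.
    apply: c2_opp; have c2t : c2_at (fun x : X => 2 / 3 * x 0 j) v.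
      by apply: (@c2_mul _ _ (cst (2 / 3))); [exact: c2_cst|exact: c2_coord].
    exact: (c2_mul c2t c2t).
  exact: (c2_mul c2r c2r).
- exact: dot_dir.
- move=> x t At cxj xE [[[ix _] _] _]; rewrite tower_row; left; exists i.
  have := inside_side ix; rewrite row_mxKl => si; split=> //; exists t; split=> //.
  have [r0 eE] := excess_turn_radius At im.
  have -> : enorm x = turn_radius i t.
    by apply/eqP; rewrite -(@eqrXn2 _ 2) ?enorm_ge0// enorm_sqr xE expr2.
  by rewrite eE cbrtK ?(ltW At)//; ring.
move=> q Mq [[[iq qp] Aq] cq]; have tq := turn_local im ip tp Mq iq qp.
case: (tq) => _ sq [z' pz']; have zE := axis_coordE im pz'.
rewrite /= zE in Aq; exists z'; split=> //; first by have [] := pz'.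
by rewrite -enorm_sqr (turn_radiusE pz' Aq) expr2.
Qed.

Lemma chart_turn i p : (i.+1 < m.*2)%N -> inside i p -> turn tw i (enorm (lsubmx p)) (rsubmx p) ->
  has_graph d M p.
Proof.
move=> im ip tp; case: (tp) => _ _ [z pz].
have [z0|zn0] := eqVneq z 0; last exact: chart_axial im ip tp pz zn0.
by rewrite z0 in pz; exact: chart_radial im ip tp pz.
Qed.

Lemma over_odd k j r y z : (k = 0 \/ k = (m.*2).-1)%N -> (j.+1 < m.*2)%N -> odd j -> profile j r y z ->
  enorm (y - h k) < 2 -> False.
Proof.
move=> kE jm oj pz yk; have k0 : 0 <= 1 / 1000 :> R by lra.
apply: (cap_far (y := h k) jm oj kE pz); first by rewrite subrr enorm0.
by rewrite enormB.
Qed.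

Lemma c2_psi (v : X) : c2_at (fun x => psi (enorm x)) v.
Proof.
apply: (@c2_near_eq _ _ (fun x => cst eta x * pos (1 + - (dot x x * (delta^-1) ^+ 2)) ^+ 3)).
  by near=> x; rewrite /bump exprMn enorm_sqr.
apply: c2_mul; first exact: c2_cst.
apply: (@c2_comp _ _ (fun s => pos s ^+ 3)); first exact: smooth2_pos3.
apply: (@c2_add _ _ (cst 1)); first exact: c2_cst.
apply: c2_opp; apply: (@c2_mul _ _ _ (cst ((delta^-1) ^+ 2))); [exact: c2_dot|exact: c2_cst].
Unshelve. all: by end_near. Qed.

Lemma chart_cap0 p : enorm (lsubmx p) < b0 -> cap0 tw eta delta (enorm (lsubmx p)) (rsubmx p) ->
  has_graph d M p.
Proof.
move=> pb [_ pE].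
pose U := [set q : W | enorm (lsubmx q) < b0] `&` [set q | enorm (rsubmx q - h 0%N) < 2].
apply: (has_graph_over (U := U) (V1 := setT) (f := fun v => psi (enorm v)) (w := h 0%N) (u := dir 0%N)).
- by apply: openI; apply: open_ltC; [exact: continuous_radius|exact: continuous_offset].
- by split=> //=; rewrite pE; have := psi_small (enorm (lsubmx p)); lra.
- exact: openT.
- by move=> v _; exact: c2_psi.
- by move=> v _ [+ _]; rewrite /= row_mxKl tower_row => vb; right; left; split=> //; exact: ltW.
move=> q Mq [qb q0]; split=> //; case: Mq => [[j tj]|[[_ //]|[_ qE]]]; exfalso.
  case: (tj) => jm sj [z' pz']; move: sj; rewrite /side; case: ifP => oj sj.
    exact: (over_odd (or_introl erefl) jm oj pz' q0).
  by have := lt_le_trans qb sj; rewrite ltxx.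
by move: q0; rewrite /= qE enormB; have := height0_last tw gb; lra.
Qed.

Lemma chart_cap1 p : enorm (lsubmx p) < b0 -> cap1 tw (enorm (lsubmx p)) (rsubmx p) -> has_graph d M p.
Proof.
move=> pb [_ pE].
pose U := [set q : W | enorm (lsubmx q) < b0] `&` [set q | enorm (rsubmx q - h (m.*2).-1) < 2].
apply: (has_graph_over (U := U) (V1 := setT) (f := cst 0) (w := h (m.*2).-1) (u := 0)).
- by apply: openI; apply: open_ltC; [exact: continuous_radius|exact: continuous_offset].
- by split=> //=; rewrite pE subrr enorm0.
- exact: openT.
- by move=> v _; exact: c2_cst.
- by move=> v _ [+ _]; rewrite /= row_mxKl tower_row scaler0 addr0 => vb; right; right; split=> //; exact: ltW.
move=> q Mq [qb q0]; rewrite scaler0 addr0; split=> //; case: Mq => [[j tj]|[[_ qE]|[_ //]]]; exfalso.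
  case: (tj) => jm sj [z' pz']; move: sj; rewrite /side; case: ifP => oj sj.
    exact: (over_odd (or_intror erefl) jm oj pz' q0).
  by have := lt_le_trans qb sj; rewrite ltxx.
have h1 := psi_small (enorm (lsubmx q)); have h2 := height0_last tw gb.
have := enorm_triangle (rsubmx q) (h 0%N) (h (m.*2).-1); rewrite (enormB (h 0%N) (rsubmx q)).
by rewrite -qE in h1; move: q0; rewrite /=; lra.
Qed.

Lemma flat_vertex r y : b0 - 1 / 16 < r -> r < b0 + 1 / 16 -> curve r y ->
  exists2 k, (k < m.*2)%N & y = h k.
Proof.
move=> r1 r2 cr; have b0g := b0_ge tw; have bE : b = 2 * b0 by rewrite /b0; field.
have db := delta_b0 tw gb; have m1 := half2_gt1 tw.
case: cr => [[i [im si [z pz]]]|[[_ ->]|[_ ->]]].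
- have e0 : excess i r = 0.
    have [oi|oi] := boolP (odd i); first by apply: excess_odd => //; have := odd_rad oi im; lra.
    by apply: excess_even => //; lra.
  by case: (profile_flat_inv e0 pz) => -[-> _]; [exists i; rewrite // ltnW|exists i.+1].
- by exists 0%N; rewrite ?(ltnW m1)// (@psi_out _ _ _ delta0) ?scale0r ?addr0//; lra.
by exists (m.*2).-1; rewrite //; lia.
Qed.

(** At the radius [b0] two pieces meet, and neither has a chart around the point by itself. There
    the tower is locally the flat disc. *)
Lemma chart_flat p : enorm (lsubmx p) = b0 -> M p -> has_graph d M p.
Proof.
move=> pb Mp; have b0g := b0_ge tw; have bE : b = 2 * b0 by rewrite /b0; field.
have db := delta_b0 tw gb.
have [k km pE] : exists2 k, (k < m.*2)%N & rsubmx p = h k by apply: flat_vertex Mp; rewrite pb; lra.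
pose U := [set q : W | b0 - 1 / 16 < enorm (lsubmx q)] `&` [set q : W | enorm (lsubmx q) < b0 + 1 / 16]
  `&` [set q | enorm (rsubmx q - h k) < 2].
apply: (has_graph_over (U := U) (V1 := setT) (f := cst 0) (w := h k) (u := 0)).
- apply: openI; last by apply: open_ltC; exact: continuous_offset.
  by apply: openI; [apply: open_gtC|apply: open_ltC]; exact: continuous_radius.
- by split; [rewrite /U/= pb; split; lra|rewrite /= pE subrr enorm0].
- exact: openT.
- by move=> v _; exact: c2_cst.
- move=> v _ [[]]; rewrite /= row_mxKl => v1 v2 _; rewrite tower_row scaler0 addr0.
  apply: (curve_flat gb) => //; [lra|lra|].
  by case: (rad_big tw) => [->|b14]; [left|right; lra].
move=> q Mq [[q1 q2] qk]; split=> //; rewrite scaler0 addr0.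
have [l lm qE] := flat_vertex q1 q2 Mq; rewrite qE; congr h; apply: (close_vertex lm km).
by move: qk; rewrite /= qE; lra.
Qed.

Lemma tower_graph p : M p -> has_graph d M p.
Proof.
move=> Mp; have [pb|pb|pb] := ltgtP (enorm (lsubmx p)) b0; last exact: chart_flat.
  case: (Mp) => [[i tp]|[c|c]]; [|exact: chart_cap0|exact: chart_cap1].
  case: (tp) => im si _; apply: (chart_turn im) => //; rewrite /inside/=.
  by move: si; rewrite /side; case: (odd i) => // /(lt_le_trans pb); rewrite ltxx.
case: (Mp) => [[i tp]|[[pb' _]|[pb' _]]]; last 2 first.
- by have := lt_le_trans pb pb'; rewrite ltxx.
- by have := lt_le_trans pb pb'; rewrite ltxx.
case: (tp) => im si _; apply: (chart_turn im) => //; rewrite /inside/=.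
by move: si; rewrite /side; case: (odd i) => // /(lt_le_trans pb); rewrite ltxx.
Qed.

End Manifold.

(** * Volume of a tower *)

Section HausdorffTools.
Variables (R : realType) (n d0 : nat).
Local Notation d := d0.+1.
Local Notation W := 'rV[R]_n.
Local Notation H := (@hausdorff R n d).
Implicit Types (A B M U : set W).

Lemma hausdorffU A B : (H (A `|` B) <= H A + H B)%E.
Proof. exact: (outer_measureU2 (@hausdorff R n d)). Qed.

Lemma hausdorff_bigcup_le (N : nat) (A : nat -> set W) (c : R) :
  (forall i, (i < N)%N -> (H (A i) <= c%:E)%E) -> (H (\bigcup_(i in `I_N) A i) <= (N%:R * c)%:E)%E.
Proof.
elim: N => [|N IH] hA; first by rewrite II0 bigcup_set0 hausdorff0 mul0r.
rewrite IIS bigcup_setU bigcup_set1; apply: le_trans (hausdorffU _ _) _.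
rewrite -natr1 mulrDl mul1r EFinD; apply: leeD; last exact: hA.
by apply: IH => i iN; apply: hA; exact: ltnW.
Qed.

Lemma hausdorff_borel_split A (B : set (borelR R n)) : measurable B -> H A = (H (A `&` B) + H (A `\` B))%E.
Proof. by move=> mB; rewrite setDE; exact: borel_caratheodory. Qed.

Lemma hausdorff_disjoint_ge (N : nat) M (B : nat -> set W) (c : R) : (forall i, open (B i)) ->
  (forall i j, (i < j)%N -> (j < N)%N -> B i `&` B j = set0) ->
  (forall i, (i < N)%N -> (c%:E <= H (M `&` B i))%E) -> ((N%:R * c)%:E <= H M)%E.
Proof.
move=> oB dB hB; suff h k : (k <= N)%N -> ((k%:R * c)%:E <= H (M `&` \bigcup_(i in `I_k) B i))%E.
  by apply: le_trans (h N (leqnn _)) _; apply: le_hausdorff => x [].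
elim: k => [_|k IH kN]; first by rewrite mul0r hausdorff_ge0.
rewrite (hausdorff_borel_split _ (open_borel (oB k))) -natr1 mulrDl mul1r EFinD addeC.
apply: leeD.
  apply: le_trans (hB k kN) _; apply: le_hausdorff => x [Mx Bx]; split=> //; split=> //.
  by exists k => //=.
apply: le_trans (IH (ltnW kN)) _; apply: le_hausdorff => x [Mx [i /= ik Bi]].
split; first by split=> //; exists i => //=; exact: ltnW.
by move=> Bk; have : (B i `&` B k) x by []; rewrite (dB i k ik kN).
Qed.

Lemma hausdorff_scale A (s : R) : 0 < s -> H ((fun x => s *: x) @` A) = ((s ^+ d)%:E * H A)%E.
Proof.
move=> s0; have sn x y : enorm (s *: x - s *: y) = s * enorm (x - y).
  by rewrite -scalerBr enormZ gtr0_norm.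
apply/eqP; rewrite eq_le; apply/andP; split.
  apply: (@hausdorff_expand _ _ _ _ s (fun x => s^-1 *: x)) => //.
    by move=> _ [x Ax <-]; rewrite scalerA mulVf ?scale1r// gt_eqF.
  move=> _ _ [x Ax <-] [y Ay <-]; rewrite !scalerA mulVf ?gt_eqF// !scale1r.
  by rewrite sn.
have h : (H A <= ((s^-1) ^+ d)%:E * H ((fun x => (s *: x : W)) @` A))%E.
  apply: (@hausdorff_expand _ _ _ _ _ (fun x => s *: x)); first by rewrite invr_gt0.
    by move=> x Ax; exists x.
  by move=> x y _ _; rewrite sn mulKf// gt_eqF.
have sd : 0 <= s ^+ d by rewrite exprn_ge0// ltW.
apply: le_trans (lee_wpmul2l _ h) _; first by rewrite lee_fin.
by rewrite muleA -EFinM -exprMn mulfV ?gt_eqF// expr1n mul1e.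
Qed.

(* The section of a graph chart is Lipschitz, so that the chart cannot shrink balls to null sets. *)
Lemma graph_positive M U (p : W) : M p -> has_graph d M p -> open U -> U p -> (0 < H (M `&` U))%E.
Proof.
move=> Mp gr oU Up.
have gr' : has_graph d (M `&` U) p.
  by apply: (has_graph_local (N := M) oU Up) => //; rewrite -setIA setIid.
case: gr' => [U' [V0 [phi [b [c [[oU' U'p] oV0 C2phi sec img]]]]]].
have [v V0v vp] : (phi @` V0) p by rewrite img.
have [r r0 rV] := (open_enormP V0).1 oV0 v V0v.
pose K := 1 + \sum_k enorm (b k).
have K0 : 0 < K by rewrite ltr_wpDr// sumr_ge0// => k _; exact: enorm_ge0.
have lip u w : V0 u -> V0 w -> enorm (u - w) <= d%:R * K * enorm (phi u - phi w).
  move=> Vu Vw; rewrite -mulrA; apply: (@enorm_le_coords R d0) => k; rewrite !mxE.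
  have -> : u 0 k - w 0 k = dot (phi u - phi w) (b k).
    by rewrite -(sec u k Vu) -(sec w k Vw) dotDl dotNl; ring.
  apply: le_trans (CauchySchwarz_abs _ _) _; rewrite mulrC ler_wpM2r ?enorm_ge0//.
  rewrite /K (bigD1 k)//= addrCA lerDl addr_ge0// sumr_ge0// => i _; exact: enorm_ge0.
have h : (hausdorff d (eball v (r / 2)) <= ((d%:R * K) ^+ d)%:E * H (M `&` U))%E.
  apply: (@hausdorff_expand _ _ _ _ _ phi); first by rewrite mulr_gt0.
    move=> u uv; have : (phi @` V0) (phi u) by exists u => //; apply: rV; move: uv; rewrite /eball/=; lra.
    by rewrite img => -[].
  by move=> u w uv wv; apply: lip; apply: rV; move: uv wv; rewrite /eball/=; lra.
rewrite lt0e hausdorff_ge0 andbT; apply/eqP => H0; move: h; rewrite H0 mule0.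
rewrite hausdorff_eball; last by rewrite divr_gt0.
rewrite lee_fin leNgt => /negP; apply; apply: mulr_gt0; last exact: vball_gt0.
by rewrite exprn_gt0// divr_gt0.
Qed.

End HausdorffTools.

Section Manifold.
Variables (R : realType) (d0 e : nat) (tw : tower R e) (eta delta : R).
Local Notation d := d0.+1.
Local Notation X := 'rV[R]_d.
Local Notation Y := 'rV[R]_e.
Local Notation W := 'rV[R]_(d + e).
Local Notation h := (height tw).
Local Notation m := (half tw).
Local Notation b := (rad tw).
Local Notation b0 := (b0 tw).
Local Notation mid := (mid tw).
Local Notation dir := (dir tw).
Local Notation excess := (excess tw).
Local Notation profile := (profile tw).
Local Notation side := (side tw).
Local Notation curve := (curve tw eta delta).
Local Notation psi := (bump eta delta).
Implicit Types (i j k : nat) (r s t : R) (x : X) (y : Y) (p q : W).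
Variable rho : R.
Hypothesis gb : good_bump eta delta rho.
Let delta0 : 0 < delta. Proof. by case: gb. Qed.
Local Notation M := (tower_set (d0 := d0) tw).
Local Notation H := (@hausdorff R (d + e) d).
Local Notation vB := (vball R d0).
Local Notation axis_coord := (axis_coord (d0 := d0) tw).

Lemma phi_lip (u u' : R) : 0 <= u -> 0 <= u' -> `|phi u' - phi u| <= 57 * `|u' - u|.
Proof.
move=> u0 u0'; have [s1|/ltW s1] := leP `|u' - u| 1; last first.
  have /andP[p0 p1] := phi_bounds u; have /andP[p0' p1'] := phi_bounds u'.
  by apply: (@le_trans _ _ 1); [rewrite ler_norml; apply/andP; split; lra|lra].
have t := phi_taylor u0 u0'; have d6 := dphi_le6 u0.
have -> : phi u' - phi u = (phi u' - phi u - dphi u * (u' - u)) + dphi u * (u' - u) by rewrite subrK.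
apply: le_trans (ler_normD _ _) _; rewrite (normrM (dphi u)).
have h1 := ler_wpM2r (normr_ge0 (u' - u)) d6.
have h2 : (u' - u) ^+ 2 <= `|u' - u| by rewrite -real_normK ?num_real// expr2 ler_piMl.
by move: t h1 h2; lra.
Qed.

Lemma eta_delta_le : 4096 * `|eta| <= delta.
Proof.
case: gb => r0 r1 d_gt0 dr ed; rewrite -(ler_pM2r r0); apply: le_trans ed _.
by rewrite expr2 ler_wpM2l ?(ltW d_gt0)//; lra.
Qed.

Lemma psi_lip r r' : 0 <= r -> 0 <= r' -> `|psi r - psi r'| <= `|r - r'|.
Proof.
move=> r0 r0'; rewrite !bumpE -mulrBr normrM.
have := phi_lip (divr_ge0 r0' (ltW delta0)) (divr_ge0 r0 (ltW delta0)).
move=> /(ler_wpM2l (normr_ge0 eta)) h1; apply: le_trans h1 _.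
rewrite -mulrBl normrM (@gtr0_norm _ (delta^-1)) ?invr_gt0//.
have -> : `|eta| * (57 * (`|r - r'| * delta^-1)) = (57 * `|eta| / delta) * `|r - r'| by ring.
rewrite ler_piMl// ler_pdivrMr// mul1r; have := eta_delta_le; have := normr_ge0 eta; lra.
Qed.

(** In polar form the squared distance is [(l - l') ^+ 2 + 2 * l * l' * (1 - q)], with [q] the
    cosine of the angle. Pushing both points outwards increases the second term, so only the radial
    one has to compensate for [dz]. *)
Lemma polar_expand (x x' : X) (l l' dz : R) : 0 < enorm x -> 0 < enorm x' ->
  enorm x <= l -> enorm x' <= l' -> (enorm x - enorm x') ^+ 2 + dz ^+ 2 <= (l - l') ^+ 2 ->
  enorm (x - x') ^+ 2 + dz ^+ 2 <= enorm ((l / enorm x) *: x - (l' / enorm x') *: x') ^+ 2.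
Proof.
move=> r0 r0' rl rl' hl.
have cs := CauchySchwarz x x'; rewrite !enorm_sqr !dotBB !(dotZl, dotZr) -!enorm_sqr.
move: (enorm x) (enorm x') (dot x x') r0 r0' rl rl' hl cs => r r' D r0 r0' rl rl' hl cs.
have [q [q1 DE]] : exists q : R, q <= 1 /\ D = r * r' * q.
  exists (D / (r * r')); rewrite ler_pdivrMr ?mulr_gt0// mul1r; split=> //.
  by rewrite mulrC divfK// gt_eqF// mulr_gt0.
have e1 : l / r * (l / r * r ^+ 2) = l ^+ 2 by field; rewrite gt_eqF.
have e2 : l' / r' * (l' / r' * r' ^+ 2) = l' ^+ 2 by field; rewrite gt_eqF.
have e3 : l / r * (l' / r' * D) = l * l' * q by rewrite DE; field; rewrite !gt_eqF.
have rr : r * r' <= l * l' by apply: ler_pM => //; exact: ltW.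
have := mulr_ge0 (_ : 0 <= l * l' - r * r') (_ : 0 <= 1 - q); rewrite !subr_ge0 => /(_ rr q1) h.
by rewrite e1 e2 e3 DE; move: h hl; lra.
Qed.

(** It gives the sign of the cross term when the height is added to the radius, so that the
    unrolling of a sheet is expanding. *)
Lemma profile_monotone i r r' y y' z z' (c : R) : c ^+ 2 = 1 -> profile i r y z -> profile i r' y' z' ->
  0 <= c * z -> 0 <= c * z' -> epsi R i * (r' - r) * (c * z' - c * z) <= 0.
Proof.
move=> c1; suff h r1 r2 y1 y2 z1 z2 : profile i r1 y1 z1 -> profile i r2 y2 z2 ->
    0 <= c * z1 -> 0 <= c * z2 -> 0 <= epsi R i * (r2 - r1) -> c * z2 <= c * z1.
  move=> pz pz' cz cz'; have [s0|/ltW s0] := leP 0 (epsi R i * (r' - r)).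
    by rewrite mulr_ge0_le0// subr_le0; exact: (h _ _ _ _ _ _ pz pz').
  rewrite mulr_le0_ge0// subr_ge0; apply: (h _ _ _ _ _ _ pz' pz) => //.
  by move: s0; lra.
move=> [_ e1] [_ e2] cz1 cz2 s0; have [t [E1 E2]] := excess_affine tw i r1 r2.
have ex : excess i r1 <= excess i r2.
  rewrite E1 E2; case: (pos_cases t) => -[t0 ->]; last exact: pos_ge0.
  by rewrite pos_id; lra.
have ex3 : excess i r1 ^+ 3 <= excess i r2 ^+ 3 by rewrite lerXn2r ?nnegrE ?excess_ge0.
rewrite -(ler_pXn2r (n := 2)) ?nnegrE// !exprMn c1 !mul1r; lra.
Qed.

Definition half_turn i (c : R) : set W :=
  [set p | turn tw i (enorm (lsubmx p)) (rsubmx p) /\ 0 <= c * axis_coord i p].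

Lemma enorm_split p q :
  enorm (p - q) ^+ 2 = enorm (lsubmx p - lsubmx q) ^+ 2 + enorm (rsubmx p - rsubmx q) ^+ 2.
Proof. by rewrite lsubmxB rsubmxB -enorm_row_mx hsubmxK. Qed.

(* Unrolls half of a rim into a ball: [x] is pushed radially to the norm
   [enorm x + 3/2 - epsi i * `|z|], which does not decrease distances. *)
Lemma half_upper i (c : R) : (i.+1 < m.*2)%N -> c ^+ 2 = 1 ->
  (H (half_turn i c) <= ((b + 15 / 4) ^+ d * vB)%:E)%E.
Proof.
move=> im c1; have bb := rad_gt0 tw; have L0 : 0 < b + 15 / 4 by lra.
rewrite -(hausdorff_eball 0 L0).
pose l p := enorm (lsubmx p) + (3 / 2 - epsi R i * (c * axis_coord i p)).
pose T p := (l p / enorm (lsubmx p)) *: lsubmx p.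
have e1 : `|epsi R i| = 1 by rewrite -(sqrtr_sqr (epsi R i)) epsi_sqr sqrtr1.
have half_data p : half_turn i c p -> exists z, [/\ axis_coord i p = z,
    profile i (enorm (lsubmx p)) (rsubmx p) z, 0 <= c * z, c * z <= 3 / 2 & 0 < enorm (lsubmx p)].
  move=> [tp cz]; case: (tp) => _ _ [z pz]; exists z; have zE := axis_coordE im pz.
  have [zb _] := profile_bounds pz; have [_ r8] := turn_bounds tp; rewrite zE in cz; split=> //; last by lra.
  by apply: le_trans (ler_norm _) _; rewrite normrM -(sqrtr_sqr c) c1 sqrtr1 mul1r.
have le_l p : half_turn i c p -> enorm (lsubmx p) <= l p.
  move=> hp; have [z [zE pz cz0 cz1 r0]] := half_data p hp; rewrite /l zE lerDl subr_ge0.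
  apply: le_trans (ler_norm _) _; rewrite normrM e1 mul1r ger0_norm//.
apply: (hausdorff_isometry _ (T := T)).
  move=> p hp; have [z [zE pz cz0 cz1 r0]] := half_data p hp; rewrite /eball/= subr0 /T enormZ.
  rewrite normrM normfV (gtr0_norm r0) divfK ?gt_eqF// ger0_norm; last first.
    by apply: le_trans (le_l p hp); exact: ltW.
  case: (hp) => tp _; have [rb _] := turn_bounds tp; rewrite /l zE.
  case: (tp) => _ sp _; move: sp; rewrite /side /epsi; case: ifP => oi sp; last by lra.
  by move: sp; rewrite /b0; lra.
move=> p q hp hq; have [z [zE pz cz0 cz1 r0]] := half_data p hp.
have [z' [zE' pz' cz0' cz1' r0']] := half_data q hq.
rewrite -(ler_pXn2r (n := 2)) ?nnegrE ?enorm_ge0// enorm_split.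
have -> : rsubmx p - rsubmx q = (z - z') *: dir i.
  by rewrite (proj1 pz) (proj1 pz'); apply/rowP => k; rewrite !mxE; ring.
rewrite enormZ enorm_dir// mulr1 real_normK ?num_real//.
apply: polar_expand => //; [exact: le_l|exact: le_l|].
have mono := profile_monotone c1 pz pz' cz0 cz0'.
rewrite /l zE zE'; have ep2 := epsi_sqr R i.
have -> : (z - z') ^+ 2 = epsi R i ^+ 2 * (c ^+ 2 * (z - z') ^+ 2) by rewrite ep2 c1 !mul1r.
by move: mono; lra.
Qed.

Lemma cap0_expand (A : set W) (s : R) : 0 < s ->
  (forall p, A p -> enorm (lsubmx p) <= s /\ rsubmx p = h 0%N + psi (enorm (lsubmx p)) *: dir 0%N) ->
  (H A <= ((2 * s) ^+ d * vB)%:E)%E.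
Proof.
move=> s0 hA; rewrite exprMn -mulrA EFinM -(hausdorff_eball 0 s0).
apply: (@hausdorff_expand _ _ _ _ 2 (fun p => lsubmx p)) => //.
  by move=> p Ap; rewrite /eball/= subr0; have [] := hA p Ap.
move=> p q Ap Aq; have [_ pE] := hA p Ap; have [_ qE] := hA q Aq.
rewrite -(ler_pXn2r (n := 2)) ?nnegrE ?mulr_ge0 ?enorm_ge0// enorm_split pE qE.
have -> : h 0%N + psi (enorm (lsubmx p)) *: dir 0%N - (h 0%N + psi (enorm (lsubmx q)) *: dir 0%N) =
    (psi (enorm (lsubmx p)) - psi (enorm (lsubmx q))) *: dir 0%N.
  by apply/rowP => k; rewrite !mxE; ring.
rewrite enormZ enorm_dir ?half2_gt1// mulr1.
have h1 := psi_lip (enorm_ge0 (lsubmx p)) (enorm_ge0 (lsubmx q)).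
have h2 := le_trans h1 (enorm_dist (lsubmx p) (lsubmx q)).
have h3 : `|psi (enorm (lsubmx p)) - psi (enorm (lsubmx q))| ^+ 2 <= enorm (lsubmx p - lsubmx q) ^+ 2.
  by rewrite lerXn2r ?nnegrE ?enorm_ge0.
by have := sqr_ge0 (enorm (lsubmx p - lsubmx q)); rewrite exprMn; move: h3; lra.
Qed.

Lemma cap1_upper : (H [set p | cap1 tw (enorm (lsubmx p)) (rsubmx p)] <= ((b + 15 / 4) ^+ d * vB)%:E)%E.
Proof.
have bb := rad_gt0 tw; have L0 : 0 < b + 15 / 4 by lra.
rewrite -(hausdorff_eball 0 L0); apply: (hausdorff_isometry _ (T := fun p => lsubmx p)).
  by move=> p [rb _]; rewrite /eball/= subr0; move: rb; rewrite /b0; lra.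
move=> p q [_ pE] [_ qE]; rewrite -(ler_pXn2r (n := 2)) ?nnegrE ?enorm_ge0// enorm_split pE qE.
by rewrite subrr enorm0 expr0n/= addr0.
Qed.

Lemma tower_upper : (H (M eta delta) <= (4 * m%:R * ((b + 15 / 4) ^+ d * vB))%:E)%E.
Proof.
have bb := rad_gt0 tw; have m1 := half2_gt1 tw; have m0 := half_gt0 tw.
set c := (b + 15 / 4) ^+ d * vB.
have c0 : 0 <= c by rewrite mulr_ge0 ?exprn_ge0 ?(ltW (vball_gt0 _ _))//; lra.
have sub : M eta delta `<=` (\bigcup_(i in `I_((m.*2).-1)) (half_turn i 1 `|` half_turn i (-1)))
   `|` ([set p | cap0 tw eta delta (enorm (lsubmx p)) (rsubmx p)] `|`
        [set p | cap1 tw (enorm (lsubmx p)) (rsubmx p)]).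
  move=> p [[i tp]|[cp|cp]]; [left|by right; left|by right; right].
  case: (tp) => im _ _; exists i => /=; first by lia.
  have [a0|/ltW a0] := leP 0 (axis_coord i p); [left|right]; split=> //.
    by rewrite mul1r.
  by rewrite mulN1r oppr_ge0.
apply: le_trans (@le_hausdorff R (d + e) d0 _ _ sub) _; apply: le_trans (hausdorffU _ _ _) _.
(* Two sheets for each of the [m.*2.-1] turns and two caps make [4 * m] pieces. *)
have -> : 4 * m%:R * c = (m.*2.-1)%:R * (c + c) + (c + c).
  have -> : (m.*2.-1)%:R = 2 * m%:R - 1 :> R.
    by rewrite -subn1 natrB; [rewrite -muln2 natrM mulrC|lia].
  ring.
rewrite EFinD; apply: leeD.
  apply: hausdorff_bigcup_le => i im; have im' : (i.+1 < m.*2)%N by lia.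
  apply: le_trans (hausdorffU _ _ _) _; rewrite EFinD; apply: leeD; apply: half_upper => //.
    by rewrite expr1n.
  by rewrite sqrrN expr1n.
apply: le_trans (hausdorffU _ _ _) _; rewrite EFinD; apply: leeD; last exact: cap1_upper.
have b00 : 0 < b0 by have := b0_ge tw; lra.
apply: le_trans (cap0_expand b00 _) _; first by move=> p [].
rewrite lee_fin ler_wpM2r ?(ltW (vball_gt0 _ _))// lerXn2r ?nnegrE//; rewrite /b0; lra.
Qed.

Lemma annulus_lower : (((b + 2) ^+ d * vB / 2)%:E <= hausdorff d [set x : X | (b0 <= enorm x)%R /\ (enorm x <= b + 2)%R])%E.
Proof.
have bb := rad_gt0 tw; have b2 : 0 < b + 2 by lra.
have b00 : 0 < b0 by have := b0_ge tw; lra.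
have sub : eball (0 : X) (b + 2) `<=` [set x : X | b0 <= enorm x /\ enorm x <= b + 2] `|` eball 0 b0.
  move=> x; rewrite /eball/= subr0 => xb; have [xb0|/ltW xb0] := leP (enorm x) b0; [by right|by left].
have := le_trans (@le_hausdorff R d d0 _ _ sub) (hausdorffU _ _ _); rewrite !hausdorff_eball// -leeBlDr//.
apply: le_trans; rewrite -EFinB lee_fin.
have : b0 ^+ d <= (b + 2) ^+ d / 2.
  apply: (@le_trans _ _ (((b + 2) / 2) ^+ d)).
    by rewrite lerXn2r ?nnegrE//; rewrite /b0; lra.
  rewrite exprMn ler_wpM2l ?exprn_ge0 ?(ltW b2)// exprS ler_piMr// exprn_ile1//; lra.
move=> /(ler_wpM2r (ltW (vball_gt0 R d0))); lra.
Qed.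

Lemma tower_lower : ((m%:R * ((b + 2) ^+ d * vB))%:E <= H (M eta delta))%E.
Proof.
have bb := rad_gt0 tw; have m1 := half2_gt1 tw.
have -> : m%:R * ((b + 2) ^+ d * vB) = (m.*2)%:R * ((b + 2) ^+ d * vB / 2).
  by rewrite -muln2 natrM; field.
apply: (hausdorff_disjoint_ge (B := fun k => [set p : W | enorm (rsubmx p - h k) < 3 / 2])).
- by move=> k; apply: open_ltC; exact: continuous_offset.
- move=> i j ij jm; apply/seteqP; split=> // p [/= pi pj].
  have ij' : i <> j by lia.
  have := height_sep (ltn_trans ij jm) jm ij'; have := enorm_triangle (rsubmx p) (h i) (h j).
  by rewrite (enormB (h i) (rsubmx p)); move: pi pj; lra.
move=> k km; apply: le_trans annulus_lower _.
(* Each disc borders exactly one rim. It is extended along its sheet up to the radius [b + 2], short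
   of the edge at [b + 9/4], and projects onto the annulus without increasing distances. *)
have [i [s [im oi s1 kE]]] : exists i (s : R), [/\ (i.+1 < m.*2)%N, ~~ odd i, s ^+ 2 = 1 &
    h k = mid i + (s * (3 / 2)) *: dir i].
  have [ok|ok] := boolP (odd k).
    case: k ok km => // i /= oi im; exists i, 1; rewrite expr1n mul1r mid_dirP; split=> //.
  exists k, (-1); rewrite sqrrN expr1n mulN1r scaleNr mid_dirN; split=> //.
  rewrite ltn_neqAle km andbT; apply/eqP => E.
  by move: ok; have := congr1 odd E; rewrite odd_double /= => /negbT; rewrite negbK => ->.
pose g r := 3 / 2 * Num.sqrt (1 - excess i r ^+ 3).
apply: (hausdorff_isometry _ (T := fun x : X => row_mx x (mid i + (s * g (enorm x)) *: dir i))); last first.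
  by move=> x x' _ _; rewrite row_mxB enorm_row_mxl.
move=> x [xb xb2]; have ex : excess i (enorm x) <= 8 / 9.
  by rewrite /excess (negPf oi); case: (pos_cases ((enorm x - b) * (4 / 9))) => -[w0 ->]; lra.
have e0 := excess_ge0 tw i (enorm x).
split.
  rewrite tower_row; left; exists i; split=> //; first by rewrite /side (negPf oi).
  by exists (s * g (enorm x)); apply: profile_sqrt => //; lra.
rewrite /= row_mxKr kE (_ : _ - _ = (s * (g (enorm x) - 3 / 2)) *: dir i); last first.
  by apply/rowP => j; rewrite !mxE; ring.
rewrite enormZ enorm_dir// mulr1 normrM -(sqrtr_sqr s) s1 sqrtr1 mul1r /g.
have e3 : excess i (enorm x) ^+ 3 <= (8 / 9) ^+ 3 by rewrite lerXn2r ?nnegrE.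
have e30 : 0 <= excess i (enorm x) ^+ 3 by rewrite exprn_ge0.
have w0 : 0 < 1 - excess i (enorm x) ^+ 3 by lra.
have w1 : 1 - excess i (enorm x) ^+ 3 <= 1 by lra.
have s0 : 0 < Num.sqrt (1 - excess i (enorm x) ^+ 3) by rewrite sqrtr_gt0.
have s2 := ler_wsqrtr w1; rewrite sqrtr1 in s2.
by rewrite ltr_norml; apply/andP; split; lra.
Qed.

(** The closed set on which opposite bumps may differ. Its image under the dilation is the
    complement of the set used in [common_answer]. *)
Definition bump_zone : set W := [set p | enorm (lsubmx p) <= delta] `&` [set p | enorm (rsubmx p - h 0%N) <= 1].

Lemma closed_bump_zone : closed bump_zone.
Proof.
apply: closedI; first by apply: (closed_leC (f := fun p => enorm (lsubmx p))); exact: continuous_radius.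
by apply: (closed_leC (f := fun p => enorm (rsubmx p - h 0%N))); exact: continuous_offset.
Qed.

Lemma psi_le1 r : enorm (psi r *: dir 0%N) <= 1.
Proof. by have := psi_small tw gb r; rewrite addrC addKr; lra. Qed.

Lemma tower_zone p : bump_zone p ->
  M eta delta p <-> rsubmx p = h 0%N + psi (enorm (lsubmx p)) *: dir 0%N.
Proof.
move=> [/= pd ph]; have db := delta_b0 tw gb; have dl := delta_lt gb; split; last first.
  by move=> pE; right; left; split=> //; lra.
case=> [[i tp]|[[_ //]|[_ pE]]]; exfalso.
  by have [_ r8] := turn_bounds tp; move: dl; rewrite -natrX; lra.
by move: ph; rewrite pE enormB; have := height0_last tw gb; lra.
Qed.

Lemma tower_off_zone : M eta delta `\` bump_zone = M 0 delta `\` bump_zone.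
Proof.
apply/seteqP; split=> p [Mp nz]; split=> //.
  case: Mp => [tp|[[pb pE]|cp]]; [by left| |by right; right].
  have [dp|pd] := leP delta (enorm (lsubmx p)).
    by right; left; split=> //; rewrite pE (@psi_out _ _ _ delta0)// bump0.
  exfalso; apply: nz; split; rewrite /=; first exact: ltW.
  by rewrite pE addrC addKr psi_le1.
case: Mp => [tp|[[pb pE]|cp]]; [by left| |by right; right].
rewrite bump0 scale0r addr0 in pE.
have [dp|pd] := leP delta (enorm (lsubmx p)).
  by right; left; split=> //; rewrite pE (@psi_out _ _ _ delta0)// scale0r addr0.
exfalso; apply: nz; split; rewrite /=; first exact: ltW.
by rewrite pE subrr enorm0.
Qed.

Lemma zone_upper : (H (M eta delta `&` bump_zone) <= ((2 * delta) ^+ d * vB)%:E)%E.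
Proof. by apply: cap0_expand => // p [Mp zp]; split; [case: zp|apply/tower_zone]. Qed.

Lemma hausdorff_tower : H (M eta delta) = (H (M eta delta `&` bump_zone) + H (M 0 delta `\` bump_zone))%E.
Proof. by rewrite -tower_off_zone; apply: hausdorff_borel_split; apply: closed_borel; exact: closed_bump_zone. Qed.

End Manifold.

(** * Volumes of towers with bumps of different heights *)

Section Manifold.
Variables (R : realType) (d0 e : nat) (tw : tower R e) (eta delta : R).
Local Notation d := d0.+1.
Local Notation X := 'rV[R]_d.
Local Notation Y := 'rV[R]_e.
Local Notation W := 'rV[R]_(d + e).
Local Notation h := (height tw).
Local Notation m := (half tw).
Local Notation b := (rad tw).
Local Notation b0 := (b0 tw).
Local Notation mid := (mid tw).
Local Notation dir := (dir tw).
Local Notation excess := (excess tw).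
Local Notation profile := (profile tw).
Local Notation side := (side tw).
Local Notation curve := (curve tw eta delta).
Local Notation psi := (bump eta delta).
Implicit Types (i j k : nat) (r s t : R) (x : X) (y : Y) (p q : W).
Local Notation M := (tower_set (d0 := d0) tw).
Local Notation H := (@hausdorff R (d + e) d).
Local Notation vB := (vball R d0).
Local Notation zone := (bump_zone (d0 := d0) tw delta).

Lemma good_bump_le rho eta' : `|eta'| <= `|eta| -> good_bump eta delta rho -> good_bump eta' delta rho.
Proof.
move=> le [g1 g2 g3 g4 g5]; split=> //; apply: le_trans g5.
apply: ler_wpM2r; first exact: ltW.
by apply: ler_wpM2l le; rewrite ler0n.
Qed.

(** Replacing the bump by a higher one over the same point is an expanding map. Applied both ways it
    shows that opposite bumps have the same volume, hence that the two uniform densities are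
    equal. *)
Lemma zone_le rho eta' : `|eta'| <= `|eta| -> good_bump eta delta rho ->
  (H (M eta' delta `&` zone) <= H (M eta delta `&` zone))%E.
Proof.
move=> le gb; have gb' := good_bump_le le gb.
have dn : enorm (dir 0%N) = 1 by rewrite enorm_dir ?half2_gt1.
pose T p : W := row_mx (lsubmx p) (h 0%N + psi (enorm (lsubmx p)) *: dir 0%N).
apply: (hausdorff_isometry _ (T := T)).
  move=> p [Mp [pd ph]]; have zT : zone (T p).
    split; rewrite /= /T ?row_mxKl ?row_mxKr// addrC addKr; exact: (psi_le1 tw gb).
  by split=> //; apply/(tower_zone gb zT); rewrite /T row_mxKl row_mxKr.
move=> p q [Mp zp] [Mq zq]; have pE := (tower_zone gb' zp).1 Mp; have qE := (tower_zone gb' zq).1 Mq.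
rewrite -(ler_pXn2r (n := 2)) ?nnegrE ?enorm_ge0// enorm_split pE qE /T row_mxB enorm_row_mx lerD2l.
have vE (a c : R) : enorm (h 0%N + a *: dir 0%N - (h 0%N + c *: dir 0%N)) = `|a - c|.
  rewrite (_ : _ - _ = (a - c) *: dir 0%N); first by rewrite enormZ dn mulr1.
  by apply/rowP => k; rewrite !mxE; ring.
rewrite !vE !real_normK ?num_real// !bumpE -!mulrBr !exprMn.
rewrite ler_wpM2r ?sqr_ge0//.
by rewrite -[eta' ^+ 2]real_normK ?num_real// -[eta ^+ 2]real_normK ?num_real// lerXn2r ?nnegrE.
Qed.

End Manifold.

Section Manifold2.
Variables (R : realType) (d0 e : nat) (tw : tower R e) (eta delta : R).
Local Notation d := d0.+1.
Local Notation X := 'rV[R]_d.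
Local Notation Y := 'rV[R]_e.
Local Notation W := 'rV[R]_(d + e).
Local Notation h := (height tw).
Local Notation m := (half tw).
Local Notation b := (rad tw).
Local Notation b0 := (b0 tw).
Local Notation mid := (mid tw).
Local Notation dir := (dir tw).
Local Notation excess := (excess tw).
Local Notation profile := (profile tw).
Local Notation side := (side tw).
Local Notation curve := (curve tw eta delta).
Local Notation psi := (bump eta delta).
Implicit Types (i j k : nat) (r s t : R) (x : X) (y : Y) (p q : W).
Local Notation M := (tower_set (d0 := d0) tw).
Local Notation H := (@hausdorff R (d + e) d).
Local Notation vB := (vball R d0).
Local Notation zone := (bump_zone (d0 := d0) tw delta).

Lemma zone_sym rho : good_bump eta delta rho -> (H (M eta delta `&` zone) <= H (M (- eta) delta `&` zone))%E.
Proof.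
move=> gb; have gbN : good_bump (- eta) delta rho by apply: (good_bump_le _ gb); rewrite normrN.
by apply: (@zone_le R d0 e tw _ delta rho _ _ gbN); rewrite normrN.
Qed.

Lemma tower_flatE delta' : M 0 delta = M 0 delta'.
Proof.
apply/seteqP; split=> p; (case=> [tp|[[pb pE]|cp]]; [by left| |by right; right]);
  by right; left; split=> //; rewrite pE !bump0.
Qed.

(** The bump at most doubles the volume [v0] of the tower without bump. The dilation can therefore
    be chosen from [v0], before the bump. *)
Lemma tower_volume rho (v0 : R) : good_bump eta delta rho -> H (M 0 delta) = v0%:E ->
  exists2 v, [/\ 0 < v0, v0 <= v & v <= 2 * v0] & H (M eta delta) = v%:E /\ H (M (- eta) delta) = v%:E.
Proof.
move=> gb v0E; have gbN : good_bump (- eta) delta rho by apply: (good_bump_le _ gb); rewrite normrN.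
have gb0 : good_bump 0 delta rho by apply: (good_bump_le _ gb); rewrite normr0.
have vB0 := vball_gt0 R d0; have bb := rad_gt0 tw; have dl := delta_lt gb.
have m0 : 1 <= m%:R :> R by rewrite ler1n half_gt0.
have zN : H (M (- eta) delta `&` zone) = H (M eta delta `&` zone).
  apply/eqP; rewrite eq_le (@zone_le R d0 e tw _ delta rho _ _ gb) ?normrN//=.
  exact: (zone_sym gb).
have hz := zone_upper d0 tw gb; have lo := tower_lower d0 tw gb0; rewrite v0E lee_fin in lo.
have v0b : (2 * delta) ^+ d * vB <= v0.
  apply: le_trans lo; rewrite -[leLHS]mul1r; apply: ler_pM => //; first by rewrite mulr_ge0 ?exprn_ge0 ?mulr_ge0 ?(ltW vB0)//; case: gb => _ _ /ltW.
  rewrite ler_wpM2r ?(ltW vB0)// lerXn2r ?nnegrE//; first by rewrite mulr_ge0//; case: gb => _ _ /ltW.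
  - by lra.
  by move: dl; rewrite -natrX; lra.
have v00 : 0 < v0.
  by apply: lt_le_trans lo; rewrite mulr_gt0 ?mulr_gt0 ?exprn_gt0//; lra.
have E := hausdorff_tower d0 tw gb; have EN := hausdorff_tower d0 tw gbN; have E0 := hausdorff_tower d0 tw gb0.
rewrite zN in EN; rewrite v0E in E0.
have zf : H (M eta delta `&` zone) \is a fin_num.
  by rewrite ge0_fin_numE ?hausdorff_ge0//; apply: le_lt_trans hz _; rewrite ltry.
have z0 : (H (M 0 delta `&` zone) <= H (M eta delta `&` zone))%E.
  by apply: (@zone_le R d0 e tw _ delta rho _ _ gb); rewrite normr0.
have cf : H (M 0 delta `\` zone) \is a fin_num.
  rewrite ge0_fin_numE ?hausdorff_ge0//; apply: (@le_lt_trans _ _ v0%:E); last by rewrite ltry.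
  by rewrite E0 leeDr// hausdorff_ge0.
have z0f : H (M 0 delta `&` zone) \is a fin_num.
  by rewrite ge0_fin_numE ?hausdorff_ge0//; apply: le_lt_trans z0 _; rewrite -ge0_fin_numE ?hausdorff_ge0.
move: E EN E0 hz z0 zf cf z0f (hausdorff_ge0 d0 (M 0 delta `&` zone)).
move: (H (M eta delta `&` zone)) (H (M 0 delta `\` zone)) (H (M 0 delta `&` zone)) => [z| |] [c| |] [w| |] //.
rewrite -!EFinD => -> -> [v0cw]; rewrite !lee_fin => hz z0 _ _ _ w0.
by exists (z + c) => //; split; lra.
Qed.

(** It makes the top of one bump the witness point of the two-point bound: the other tower is at or
    below the level of the disc there, and its remaining pieces are farther than 1/8. *)
Lemma tower_apart q : 0 < eta -> eta <= 1 / 8 -> M (- eta) delta q ->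
  eta <= enorm (q - row_mx 0 (h 0%N + eta *: dir 0%N)).
Proof.
move=> e0 e8; rewrite -(hsubmxK q) tower_row row_mxB subr0; move: (lsubmx q) (rsubmx q) => x y.
have dn : enorm (dir 0%N) = 1 by rewrite enorm_dir ?half2_gt1.
case=> [[i tp]|[[_ yE]|[_ yE]]].
- by apply: le_trans (enorm_row_mxl _ _); have [_ r8] := turn_bounds tp; lra.
- apply: le_trans (enorm_row_mxr _ _); rewrite yE.
  rewrite (_ : _ - _ = (bump (- eta) delta (enorm x) - eta) *: dir 0%N); last first.
    by apply/rowP => k; rewrite !mxE; ring.
  rewrite enormZ dn mulr1 /bump mulNr -opprD normrN.
  apply: le_trans (ler_norm _); rewrite lerDr mulr_ge0 ?(ltW e0)//.
  by rewrite exprn_ge0 ?pos_ge0.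
apply: le_trans (enorm_row_mxr _ _); rewrite yE.
have m1 := half2_gt1 tw; have h3 : 3 <= enorm (h 0%N - h (m.*2).-1) by apply: height_sep; lia.
have h4 := enorm_triangle (h 0%N + eta *: dir 0%N) (h 0%N) (h (m.*2).-1).
have h5 : enorm (h 0%N - (h 0%N + eta *: dir 0%N)) = eta.
  by rewrite opprD addNKr enormN enormZ dn mulr1 gtr0_norm.
rewrite h5 in h4; rewrite enormB; lra.
Qed.

Lemma tower_top : M eta delta (row_mx 0 (h 0%N + eta *: dir 0%N)).
Proof.
rewrite tower_row enorm0; right; left; split; first by have := b0_ge tw; lra.
by rewrite /bump mul0r expr0n/= subr0 pos_id// expr1n mulr1.
Qed.

Lemma tower_norm (Hb : R) p : `|eta| <= 1 -> (forall k, (k < m.*2)%N -> enorm (h k) <= Hb) ->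
  M eta delta p -> enorm p <= (b + 9 / 4) + (Hb + 1).
Proof.
move=> eta1 hb Mp; have [rb yb] := curve_bounds eta1 hb Mp.
have E : enorm p ^+ 2 = enorm (lsubmx p) ^+ 2 + enorm (rsubmx p) ^+ 2 by rewrite -{1}(hsubmxK p) enorm_row_mx.
have := enorm_ge0 (lsubmx p); have := enorm_ge0 (rsubmx p) => y0 x0.
apply: (@le_trans _ _ (enorm (lsubmx p) + enorm (rsubmx p))); last exact: lerD.
rewrite -(ler_pXn2r (n := 2)) ?nnegrE ?enorm_ge0 ?addr_ge0// E sqrrD.
by rewrite addrAC lerDl mulrn_wge0// mulr_ge0.
Qed.

End Manifold2.

(** * Pairs of towers and choice of the parameters *)

Section Pair.
Variables (R : realType) (d0 e : nat) (tw : tower R e).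
Local Notation d := d0.+1.
Local Notation W := 'rV[R]_(d + e).
Local Notation M := (tower_set (d0 := d0) tw).
Local Notation H := (@hausdorff R (d + e) d).
Local Notation vB := (vball R d0).

Lemma scaled_tower_model (rch Rb fmin fmax L s eta delta v : R) :
  0 < s -> 0 <= L -> good_bump eta delta (rch / s) -> H (M eta delta) = v%:E -> 0 < v ->
  fmin <= (s ^+ d * v)^-1 <= fmax -> (forall p, M eta delta p -> s * enorm p <= Rb) ->
  exists D : probability (borelR R (d + e)) R, [/\ model d rch fmin fmax L Rb D,
    supp D = (fun x => s *: x) @` M eta delta &
    forall A, measurable A -> D A = (((s ^+ d * v)^-1)%:E * H (A `&` (fun x => s *: x) @` M eta delta))%E].
Proof.
move=> s0 L0 gb vE v0 fv MR; have db := delta_b0 tw gb; have dl : 0 < delta by case: gb.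
have eta1 : `|eta| <= 1.
  by have := eta_delta_le gb; have := delta_lt gb; have := normr_ge0 eta; rewrite -natrX; lra.
have sr : s * (rch / s) = rch by rewrite mulrCA divff ?mulr1// gt_eqF.
apply: (@uniform_model R (d + e) d0 rch fmin fmax L Rb (s ^+ d * v) _
  (s *: (row_mx 0 (height tw 0%N + eta *: dir tw 0%N) : W))) => //.
- rewrite -sr; apply: manifold_class_scale => //.
  + exact: tower_compact.
  + by apply: tower_connected; split=> //; lra.
  + by move=> p; exact: (tower_graph gb).
  + exact: tower_reach.
- by move=> _ [p Mp <-]; rewrite /eball/= subr0 enormZ gtr0_norm//; exact: MR.
- by rewrite mulr_gt0 ?exprn_gt0.
- by rewrite hausdorff_scale// vE.
move=> _ [p Mp <-] U oU Up; apply: graph_positive Up => //; first by exists p.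
by apply: has_graph_scale => //; exact: (tower_graph gb).
Qed.

(** A bump admissible for the reach 1 is shrunk by [s], for the reach [1 / s]; the later dilation
    restores its size. *)
Lemma good_bump_scale (eta t s : R) : good_bump eta t 1 -> 1 <= s -> good_bump (eta / s) (t / s) s^-1.
Proof.
move=> [_ _ t0 t1 te] s1; have s0 : 0 < s by apply: lt_le_trans s1.
split; [by rewrite invr_gt0|by rewrite invf_le1|exact: divr_gt0| |].
  by rewrite mulrC ler_wpM2l ?invr_ge0 ?(ltW s0)//; move: t1; rewrite mul1r.
rewrite normrM (gtr0_norm (_ : 0 < s^-1)) ?invr_gt0// exprMn.
rewrite [leLHS](_ : _ = 4096 * `|eta| * 1 * s^-1 ^+ 2); last by ring.
by rewrite ler_wpM2r// sqr_ge0.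
Qed.

Lemma tower_pair (rch Rb fmin fmax L tau alpha eps t E s v0 Hb : R)
    (dO : measure_display) (Om : measurableType dO) (P : probability Om R) (A : Om -> det_alg R (d + e)) :
  0 < rch -> 0 < fmin -> fmin <= fmax / 96 -> 0 <= L -> alpha < 1 / 2 -> 1 <= s ->
  0 < E -> good_bump E t 1 ->
  (forall k, (k < (half tw).*2)%N -> enorm (height tw k) <= Hb) ->
  s * rch * (rad tw + 9 / 4 + (Hb + 1)) <= Rb ->
  H (M 0 1) = v0%:E ->
  1 <= 96 * (fmin * rch ^+ d * (s ^+ d * v0)) -> 2 * (fmin * rch ^+ d * (s ^+ d * v0)) <= 1 ->
  96 * (fmin * rch ^+ d * ((2 * t) ^+ d * vB)) <= tau ->
  2 * eps < rch * E ->
  ~ sq_estimates (model d rch fmin fmax L Rb) tau eps alpha P A.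
Proof.
move=> rch0 f0 ff L0 a2 s1 E0 gt hb MR v0E vlo vup tauP epsP.
have t0 : 0 < t by case: gt.
have s0 : 0 < s by lra.
have S0 : 0 < s * rch by rewrite mulr_gt0.
pose delta := t / s; pose eta := E / s.
have eta0 : 0 < eta by exact: divr_gt0.
have gb : good_bump eta delta (rch / (s * rch)).
  have -> : rch / (s * rch) = s^-1 by rewrite invfM mulrCA divff ?mulr1// gt_eqF.
  exact: good_bump_scale.
have gbN : good_bump (- eta) delta (rch / (s * rch)) by apply: (good_bump_le _ gb); rewrite normrN.
rewrite (tower_flatE _ _ _ delta) in v0E.
have [v [v00 v0v v2] [vE vNE]] := tower_volume gb v0E.
have vpos : 0 < v by lra.
have sd0 : 0 < s ^+ d by rewrite exprn_gt0.
have rd0 : 0 < rch ^+ d by rewrite exprn_gt0.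
have fr0 : 0 < fmin * rch ^+ d by rewrite mulr_gt0.
(* The density is the inverse volume. It is at least [fmin] as [2 * v0] bounds the volume, and at
   most [96 * fmin], hence at most [fmax]. *)
have fv : fmin <= ((s * rch) ^+ d * v)^-1 <= fmax.
  have V0 : 0 < (s * rch) ^+ d * v by rewrite mulr_gt0 ?exprn_gt0.
  have vv0 := ler_wpM2l (ltW (mulr_gt0 fr0 sd0)) v0v; have vv2 := ler_wpM2l (ltW (mulr_gt0 fr0 sd0)) v2.
  apply/andP; split; rewrite -(ler_pM2r V0) mulVf ?gt_eqF//.
    by rewrite exprMn; lra_using vv2 vup.
  by have h1 := ler_wpM2r (ltW V0) ff; rewrite exprMn in h1 *; lra_using h1 vlo vv0.
have MR' eta' p : `|eta'| <= 1 -> M eta' delta p -> s * rch * enorm p <= Rb.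
  move=> e1 Mp; apply: le_trans MR; rewrite ler_pM2l//.
  exact: tower_norm e1 hb Mp.
have eta1 : `|eta| <= 1.
  by have := eta_delta_le gb; have := delta_lt gb; have := normr_ge0 eta; rewrite -natrX; lra.
have [D1 [D1m D1s D1E]] := scaled_tower_model S0 L0 gb vE vpos fv (fun p => MR' eta p eta1).
have etaN1 : `|- eta| <= 1 by rewrite normrN.
have [D2 [D2m D2s D2E]] := scaled_tower_model S0 L0 gbN vNE vpos fv (fun p => MR' (- eta) p etaN1).
pose zone := bump_zone (d0 := d0) tw delta; pose Z : set W := (fun x => (s * rch) *: x) @` zone.
have SK (x : W) : (s * rch) *: ((s * rch)^-1 *: x) = x by rewrite scalerA mulfV ?scale1r// gt_eqF.
have SK' (x : W) : (s * rch)^-1 *: ((s * rch) *: x) = x by rewrite scalerA mulVf ?scale1r// gt_eqF.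
have Sinj (x y : W) : (s * rch) *: x = (s * rch) *: y -> x = y by move=> xy; rewrite -(SK' x) xy SK'.
have mZ : measurable (Z : set (borelR R (d + e))).
  apply: closed_borel; have -> : Z = (fun x : W => (s * rch)^-1 *: x) @^-1` zone.
    apply/seteqP; split=> [_ [x zx <-]|x zx] /=; first by rewrite SK'.
    by exists ((s * rch)^-1 *: x); rewrite ?SK.
  apply: closed_comp => [x _|]; last exact: closed_bump_zone.
  apply: (@lipschitz_continuous _ _ _ (s * rch)^-1) => y z.
  by rewrite -scalerBr enormZ gtr0_norm// invr_gt0.
have off eta' B : good_bump eta' delta (rch / (s * rch)) -> B `<=` ~` Z ->
    B `&` (fun x => (s * rch) *: x) @` M eta' delta = B `&` (fun x => (s * rch) *: x) @` M 0 delta.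
  move=> gb' BZ; have off := tower_off_zone d0 tw gb'.
  apply/seteqP; split=> u [Bu [x Mx xu]]; split=> //; exists x => //.
    have : (M eta' delta `\` zone) x by split=> // zx; apply: (BZ u Bu); exists x.
    by rewrite off => -[].
  have : (M 0 delta `\` zone) x by split=> // zx; apply: (BZ u Bu); exists x.
  by rewrite -off => -[].
(* The mass of the bump is its volume divided by [v]. The factors [s ^+ d] combine so that [tauP],
   which does not mention [s], is enough. *)
have small eta' : good_bump eta' delta (rch / (s * rch)) ->
    ((((s * rch) ^+ d * v)^-1)%:E * H (~` ~` Z `&` (fun x => (s * rch) *: x) @` M eta' delta) <= tau%:E)%E.
  move=> gb'; rewrite setCK.
  have -> : Z `&` (fun x => (s * rch) *: x) @` M eta' delta = (fun x => (s * rch) *: x) @` (M eta' delta `&` zone).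
    apply/seteqP; split=> [_ [[x zx <-] [y My /Sinj xy]]|_ [x [Mx zx] <-]].
      by exists x => //; split=> //; rewrite -xy.
    by split; exists x.
  rewrite hausdorff_scale// muleA -EFinM.
  have -> : ((s * rch) ^+ d * v)^-1 * (s * rch) ^+ d = v^-1.
    by rewrite invfM mulrAC mulVf ?mul1r// gt_eqF ?exprn_gt0.
  apply: le_trans (lee_wpmul2l _ (zone_upper d0 tw gb')) _; first by rewrite lee_fin invr_ge0 ltW.
  rewrite -EFinM lee_fin ler_pdivrMl//.
  have -> : (2 * delta) ^+ d = (2 * t) ^+ d / s ^+ d by rewrite /delta mulrA expr_div_n.
  rewrite mulrAC ler_pdivrMr//.
  set X := (2 * t) ^+ d * vB in tauP *.
  have X0 : 0 <= X by rewrite mulr_ge0 ?exprn_ge0 ?mulr_ge0 ?(ltW t0) ?(ltW (vball_gt0 _ _)).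
  have vv0 := ler_wpM2l (ltW (mulr_gt0 fr0 sd0)) v0v.
  have one : 1 <= 96 * (fmin * rch ^+ d * (s ^+ d * v)) by lra_using vlo vv0.
  apply: (@le_trans _ _ (96 * (fmin * rch ^+ d * X) * (s ^+ d * v))).
    by have h1 := ler_wpM2l X0 one; lra_using h1.
  have sv0 : 0 <= s ^+ d * v by rewrite mulr_ge0// ltW.
  by have h1 := ler_wpM2r sv0 tauP; lra_using h1.
pose p0 : W := row_mx 0 (height tw 0%N + eta *: dir tw 0%N).
apply: (@two_point_bound R (d + e) _ tau eps alpha _ Om P A D1 D2 ((s * rch) *: p0) a2 D1m D2m).
- apply: (@common_answer R (d + e) D1 D2 (~` Z)).
  + exact: measurableC.
  + by move=> B mB BZ; rewrite D1E// D2E// !off.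
  + by rewrite D1E; [exact: small|do 2 apply: measurableC].
  + by rewrite D2E; [exact: small|do 2 apply: measurableC].
- rewrite D1s (@edistE _ _ _ _ ((s * rch) *: p0)) ?subrr ?enorm0//.
    by exists p0 => //; exact: tower_top.
  by move=> x _; exact: enorm_ge0.
rewrite D2s; apply: (@lt_le_trans _ _ (s * rch * eta)%:E).
  rewrite lte_fin (_ : s * rch * eta = rch * E)//.
  by rewrite /eta; field; rewrite gt_eqF.
apply: le_ereal_inf_tmp => _ [_ [q Mq <-] <-]; rewrite lee_fin -scalerBr enormZ gtr0_norm// ler_pM2l//.
apply: (tower_apart eta0 _ Mq).
by have h1 := eta_delta_le gb; have h2 := delta_lt gb; rewrite (gtr0_norm eta0) -natrX in h1 h2; lra_using h1 h2 eta0.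
Qed.

End Pair.

Lemma even_between (a m : nat) : ~~ odd a -> (m.*2 <= a)%N -> (a < m.*2.+2)%N -> a = m.*2.
Proof.
move=> oa; have := odd_double_half a; rewrite (negPf oa) add0n => <-.
by rewrite leq_double; lia.
Qed.

(** * Choice of the path, of the inner radius and of the dilation *)

Section ParameterChoice.
Variables (R : realType) (d0 e : nat).
Local Notation d := d0.+1.
Local Notation w := (vball R d0).
Local Notation om := (omega R d).

Lemma snake_tower (j N m : nat) (b : R) : (0 < m)%N -> (m.*2 <= N ^ j)%N -> (0 < N)%N -> (j <= e)%N ->
  1 / 4 <= b -> m = 1%N \/ 14 <= b -> exists tw : tower R e, [/\ half tw = m, rad tw = b &
    forall k, (k < (half tw).*2)%N -> enorm (height tw k) <= 3 * (N%:R * Num.sqrt j%:R)].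
Proof.
move=> m0 mN N0 je b14 mb; have [h [hs hc hn]] := @lattice_snake R e j N 3 (ltr0n R 3) N0 je.
have lt k : (k < m.*2)%N -> (k < N ^ j)%N by move=> km; apply: leq_trans mN.
exists (@Tower R e h m b m0 b14 mb (fun i i' im i'm => hs i i' (lt _ im) (lt _ i'm)) (fun i im => hc i (lt _ im))).
by split=> //= k km; apply: hn; exact: lt.
Qed.

Lemma choose_scale (q v r x : R) : 0 < q -> 0 < v -> 0 < r -> r <= x -> 2 * (q * v) <= 1 ->
  r ^+ d <= 96 * (q * x ^+ d * v) -> exists s, [/\ 1 <= s, s * r <= x,
    1 <= 96 * (q * (s ^+ d * v)) & 2 * (q * (s ^+ d * v)) <= 1].
Proof.
move=> q0 v0 r0 rx qv rd; have [big|/ltW small] := leP 1 (96 * (q * v)).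
  by exists 1; rewrite !expr1n !mul1r.
pose c := 96 * (q * v); have c0 : 0 < c by rewrite mulr_gt0// mulr_gt0.
pose s := c^-1 `^ d%:R^-1; have s0 : 0 <= s by exact: powR_ge0.
have sd : s ^+ d = c^-1.
  by rewrite /s -powR_mulrn ?powR_ge0// -powRrM mulVf ?pnatr_eq0// powRr1// invr_ge0 ltW.
have s1 : 1 <= s by rewrite -(ler_pXn2r (n := d)) ?nnegrE// expr1n sd invf_ge1.
have x0 : 0 <= x by apply: le_trans rx; exact: ltW.
have E : q * (s ^+ d * v) = 1 / 96.
  by rewrite sd /c; field; rewrite !gt_eqF.
exists s; split=> //; [|by rewrite E; lra|by rewrite E; lra].
rewrite -(ler_pXn2r (n := d)) ?nnegrE ?mulr_ge0 ?(ltW r0)// exprMn sd ler_pdivrMl//.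
by apply: le_trans rd _; rewrite /c le_eqVlt; apply/orP; left; apply/eqP; ring.
Qed.

Lemma omega_vball : om <= 2 ^+ d * w.
Proof. by have := kappa_le_vball R d0; rewrite ler_pdivrMr ?exprn_gt0// mulrC. Qed.

Lemma natr_le_exp2 : d%:R <= 2 ^+ d :> R.
Proof. by rewrite -natrX ler_nat ltnW// ltn_expl. Qed.

Lemma sigma_vball (q : R) : 0 <= q -> 36 * 8 ^+ d * sigma_sphere R d * q <= 36 * 32 ^+ d * (w * q).
Proof.
move=> q0; rewrite /sigma_sphere; have h1 := omega_vball; have h2 := natr_le_exp2.
have om0 := omega_gt0 R d; have w0 := vball_gt0 R d0.
have h : d%:R * om <= 2 ^+ d * (2 ^+ d * w) by apply: ler_pM => //; exact: ltW.
have -> : 36 * 32 ^+ d * (w * q) = 36 * 8 ^+ d * (2 ^+ d * (2 ^+ d * w)) * q.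
  have -> : 32 ^+ d = 8 ^+ d * 2 ^+ d * 2 ^+ d :> R by rewrite -!exprMn; congr (_ ^+ _); ring.
  ring.
by rewrite ler_wpM2r// ler_wpM2l// mulr_ge0// exprn_ge0.
Qed.

(** The smallest tower, with two discs and inner radius 1/4, has [rad + 15/4 = 4]; its volume never
    exceeds the allowed one. *)
Lemma small_volume (q : R) : 0 <= q -> 36 * 8 ^+ d * sigma_sphere R d * q <= 1 -> 8 * (q * (4 ^+ d * w)) <= 1.
Proof.
move=> q0; apply: le_trans; rewrite /sigma_sphere; have h1 := vball_le R d0; have om0 := omega_gt0 R d.
have d1 : 1 <= d%:R :> R by rewrite ler1n.
have h2 : 4 ^+ d * w <= 8 ^+ d * om.
  apply: (@le_trans _ _ (4 ^+ d * (2 ^+ d * om))); first by rewrite ler_wpM2l// exprn_ge0.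
  by rewrite mulrA -exprMn (_ : 4 * 2 = 8)//; ring.
have h3 : 8 ^+ d * om <= 8 ^+ d * (d%:R * om).
  by rewrite ler_wpM2l ?exprn_ge0// ler_peMl// ltW.
have h4 := ler_wpM2l q0 (le_trans h2 h3); have h5 : 0 <= q * (8 ^+ d * (d%:R * om)).
  by rewrite mulr_ge0// mulr_ge0 ?exprn_ge0// mulr_ge0// ltW.
by move: h4 h5; lra.
Qed.

Lemma tower_params (q x : R) : 0 < q -> 144 <= x -> (0 < e)%N ->
  (exists k : nat, [/\ (1 <= k)%N, (k <= d + e)%N &
     (192 * Num.sqrt (k%:R) / x) ^+ k <= 36 * 8 ^+ d * sigma_sphere R d * q]) ->
  36 * 8 ^+ d * sigma_sphere R d * q <= 1 ->
  exists (tw : tower R e) (Hb : R), [/\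
    (forall k, (k < (half tw).*2)%N -> enorm (height tw k) <= Hb) /\ 0 <= Hb,
    2 * (q * (4 * (half tw)%:R * ((rad tw + 15 / 4) ^+ d * w))) <= 1,
    rad tw + 9 / 4 + (Hb + 1) <= x &
    (rad tw + 9 / 4 + (Hb + 1)) ^+ d <= 96 * (q * x ^+ d * ((half tw)%:R * ((rad tw + 2) ^+ d * w)))].
Proof.
move=> q0 x144 e0 [k [k1 ke hk]] h1; have w0 := vball_gt0 R d0.
have x0 : 0 < x by apply: lt_le_trans x144; rewrite ltr0n.
set T := 36 * 8 ^+ d * _ * q in hk h1; have TP := sigma_vball (ltW q0); rewrite -/T in TP.
have powM (a c : R) : 0 <= a -> a <= c -> a ^+ d <= c ^+ d.
  by move=> a0 ac; rewrite lerXn2r ?nnegrE//; apply: le_trans ac.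
(* The radius [rad + 15/4] of a tower with [rad = x / 10]. The hypothesis [144 <= x] gives both
   [rad >= 14], required for tunnels, and [L <= 10/79 * x]. *)
pose L := x / 10 + 15 / 4.
have x14 : 14 <= x / 10 by lra.
have Lx : L <= 10 / 79 * x by rewrite /L; lra.
clear x144; have L0 : 0 < L by rewrite /L; lra.
have k192 : 0 < 192 :> R by rewrite ltr0n.
pose P := w * q * x ^+ d; have P0 : 0 < P by rewrite mulr_gt0 ?exprn_gt0// mulr_gt0.
pose y := 192 * Num.sqrt k%:R / x; rewrite -/y in hk.
have sk1 : 1 <= Num.sqrt k%:R :> R by rewrite -{1}sqrtr1 ler_wsqrtr// ler1n.
have yx : 192 / x <= y.
  by apply: ler_wpM2r; [rewrite invr_ge0 ltW|exact: ler_peMr (ltW k192) sk1].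
have y0 : 0 < y by exact: lt_le_trans (divr_gt0 k192 x0) yx.
have yxd : (192 / x) ^+ d <= y ^+ d by exact: powM (divr_ge0 (ltW k192) (ltW x0)) yx.
have y1 : y <= 1.
  rewrite leNgt; apply/negP => y1; have k0 : k != 0%N by rewrite -lt0n.
  have := exprn_egt1 k y1; rewrite (negPf k0) /= => y2.
  by have := lt_le_trans y2 (le_trans hk h1); rewrite ltxx.
have base i (c : R) : 0 < c -> k = (d + i)%N -> 1 <= y ^+ i * c -> 6 ^+ d <= 36 * (P * c).
  move=> c0 kE yc; have h2 : (192 / x) ^+ d * y ^+ i <= 36 * 32 ^+ d * (w * q).
    apply: le_trans TP; apply: le_trans hk; rewrite kE exprD; apply: ler_wpM2r yxd.
    by rewrite exprn_ge0// ltW.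
  have e1 : (192 / x) ^+ d = 32 ^+ d * 6 ^+ d / x ^+ d.
    by rewrite expr_div_n -exprMn; congr (_ ^+ _ / _); ring.
  have h3 : 6 ^+ d * y ^+ i <= 36 * P.
    have c32 : 0 < 32 ^+ d :> R by rewrite exprn_gt0// ltr0n.
    rewrite -(ler_pM2l c32); move: h2; rewrite e1 mulrAC ler_pdivrMr ?exprn_gt0//.
    by rewrite /P; move: (32 ^+ d) (6 ^+ d) (y ^+ i) (x ^+ d) => a1 a2 a3 a4 h2; lra_using h2.
  have s6 : 0 <= 6 ^+ d :> R by rewrite exprn_ge0// ler0n.
  apply: (@le_trans _ _ (6 ^+ d * (y ^+ i * c))); first by rewrite ler_peMr.
  by have := ler_wpM2r (ltW c0) h3; rewrite -!mulrA.
have volP (c : R) : 0 <= c -> 1 <= c * (q * (L ^+ d * w)) -> (79 / 10) ^+ d <= c * P.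
  move=> c0 h2; have h3 : L ^+ d <= (10 / 79) ^+ d * x ^+ d by rewrite -exprMn powM// ltW.
  have h4 : 1 <= (10 / 79) ^+ d * (c * P).
    apply: le_trans h2 _; have := ler_wpM2l (mulr_ge0 c0 (mulr_ge0 (ltW q0) (ltW w0))) h3.
    by rewrite /P; lra.
  have s79 : 0 <= (79 / 10) ^+ d :> R by rewrite exprn_ge0// divr_ge0// ler0n.
  have e1 : (79 / 10) ^+ d * (10 / 79) ^+ d = 1 :> R.
    by rewrite -exprMn (_ : _ * _ = 1) ?expr1n//; field.
  by have := ler_wpM2l s79 h4; rewrite mulr1 mulrA e1 mul1r.
have s94 : 0 <= (9 / 4) ^+ d :> R by rewrite exprn_ge0// divr_ge0.
(* Two regimes. If [k <= d], or if already two discs of radius [x / 10] have too large a volume, the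
   smallest tower is dilated. Otherwise wide discs are stacked along a path in dimension [k - d]. *)
have [smallcase|[dk volL]] : ((k <= d)%N \/ 1 <= 8 * (q * (L ^+ d * w))) \/
    ((d < k)%N /\ 8 * (q * (L ^+ d * w)) <= 1).
  have [kd|dk] := leqP k d; first by left; left.
  by have [v1|/ltW v1] := leP 1 (8 * (q * (L ^+ d * w))); [left; right|right].
- have [tw [mE bE hb]] := @snake_tower 1 2 1 (1 / 4) isT isT isT e0 (lexx _) (or_introl erefl).
  exists tw, 6; rewrite mE bE; rewrite mE sqrtr1 mulr1 in hb; split.
  + split=> [i im|//]; by apply: le_trans (hb i im) _; lra.
  + rewrite (_ : 1 / 4 + 15 / 4 = 4); last by field.
    by have h2 := small_volume (ltW q0) h1; lra_using h2.
  + lra.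
  rewrite (_ : 1 / 4 + 9 / 4 + (6 + 1) = 19 / 2); last by field.
  rewrite (_ : 1 / 4 + 2 = 9 / 4); last by field.
  have key : (38 / 9) ^+ d <= 96 * P.
    case: smallcase => [kd|v1].
      have yd : y ^+ (d - k) <= 1 by rewrite exprn_ile1// ltW.
      have h2 : 6 ^+ d <= 36 * (P * 1).
        have hk' : y ^+ d <= T by apply: le_trans hk; rewrite -(subnK kd) exprD ler_piMl ?exprn_ge0// ltW.
        have h3 : (192 / x) ^+ d <= 36 * 32 ^+ d * (w * q).
          by apply: le_trans TP; apply: le_trans hk'; exact: yxd.
        have e1 : (192 / x) ^+ d = 32 ^+ d * 6 ^+ d / x ^+ d.
          by rewrite expr_div_n -exprMn; congr (_ ^+ _ / _); ring.
        have c32 : 0 < 32 ^+ d :> R by rewrite exprn_gt0// ltr0n.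
        rewrite -(ler_pM2l c32); move: h3; rewrite e1 ler_pdivrMr ?exprn_gt0// => h3.
        by rewrite /P; move: (32 ^+ d) (6 ^+ d) (x ^+ d) h3 => a1 a2 a3 h3; lra_using h3.
      have h3 : (38 / 9) ^+ d <= 6 ^+ d :> R by apply: powM; clear_props; lra.
      by lra_using h2 h3 P0.
    have h2 := volP 8 (ler0n R 8) v1.
    have h3 : (38 / 9) ^+ d <= (79 / 10) ^+ d :> R by apply: powM; clear_props; lra.
    by lra_using h2 h3 P0.
  have e1 : (19 / 2) ^+ d = (38 / 9) ^+ d * (9 / 4) ^+ d :> R.
    by rewrite -exprMn; congr (_ ^+ _); field.
  by rewrite e1; have h2 := ler_wpM2r s94 key; rewrite /P in h2; lra_using h2.
clear yx yxd; pose j := (k - d)%N; have j0 : (0 < j)%N by rewrite subn_gt0.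
have je : (j <= e)%N by rewrite leq_subLR.
have kE : k = (d + j)%N by rewrite subnKC// ltnW.
pose X := x / (192 * Num.sqrt k%:R).
have s0 : 0 < Num.sqrt k%:R :> R by apply: lt_le_trans sk1.
have Xy : y * X = 1 by rewrite /y /X; field; rewrite !gt_eqF.
have X1 : 1 <= X.
  have X00 : 0 < X by exact: divr_gt0 x0 (mulr_gt0 k192 s0).
  by rewrite -Xy ler_piMl// ltW.
clear TP k192 hk h1 y1 sk1 s94.
pose Nc := (Num.truncn X).+1.
have /andP[Nc1 Nc2] : X <= Nc%:R <= X + 1.
  have X00 : 0 <= X by apply: le_trans X1.
  have /andP[t1 t2] := truncn_itv X00; rewrite /Nc (ltW t2)/= -natr1 lerD2r//.
(* An even side makes the number of lattice points even, so that the whole path can be used by an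
   even number of discs. *)
pose N := (2 * Nc)%N; have N0 : (0 < N)%N by rewrite muln_gt0.
have N4 : N%:R <= 4 * X by rewrite /N natrM; lra.
have N2 : (1 < N ^ j)%N.
  by apply: leq_trans (leq_pexp2l N0 j0); rewrite expn1 /N mulnS.
(* The number of discs is maximal subject to the length of the path and to the bound on the volume;
   [m = 1] is admissible in this regime. *)
pose Pm m := (0 < m)%N && (m.*2 <= N ^ j)%N && (8 * (m%:R * (q * (L ^+ d * w))) <= 1).
have exm : exists m, Pm m by exists 1%N; rewrite /Pm /= N2 mul1r.
have bm m : Pm m -> (m <= N ^ j)%N by move=> /andP[/andP[_ h2] _]; apply: leq_trans h2; rewrite -addnn leq_addr.
clear volL; case: (ex_maxnP exm bm) => m /andP[/andP[m0 mN] mv] mmax.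
have m1 : 1 <= m%:R :> R by rewrite ler1n.
have x10 : 1 / 4 <= x / 10 by lra_using x14.
have [tw [mE bE hb]] := @snake_tower j N m (x / 10) m0 mN N0 je x10 (or_intror x14).
have sj : Num.sqrt j%:R <= Num.sqrt k%:R :> R by rewrite ler_wsqrtr// ler_nat leq_subr.
(* The constant 192 is 3 times 4 times 16: the step of the path, the rounding in [N <= 4 * X], and
   the share 1/16 of the ball left to the heights. *)
have Hx : 3 * (N%:R * Num.sqrt j%:R) <= x / 16.
  have sj0 := sqrtr_ge0 (j%:R : R).
  have h2 : N%:R * Num.sqrt j%:R <= 4 * X * Num.sqrt k%:R by apply: ler_pM.
  have h3 : X * Num.sqrt k%:R = x / 192 by rewrite /X; field; rewrite gt_eqF.
  by rewrite -mulrA h3 in h2; lra_using h2.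
exists tw, (x / 16); rewrite mE bE; rewrite mE in hb; split.
- by split=> [i im|]; [apply: le_trans (hb i im) _|lra].
- by rewrite -/L; lra_using mv.
- by lra_using x14.
clear Hx mv hb Nc2 N4 mE bE x10 sj.
have pow26 : 2 ^+ d <= 6 ^+ d :> R by apply: powM; rewrite ?ler_nat ?ler0n.
(* By maximality of [m], either the path is exhausted, and the inequality satisfied by [k] makes it
   long, or one more pair of discs would exceed the volume bound, and [m] is at least half of what
   is allowed. *)
have key : 2 ^+ d <= 96 * (P * m%:R).
  have m00 : 0 < m%:R :> R by rewrite ltr0n.
  have Pm0 : 0 < P * m%:R by rewrite mulr_gt0.
  have : ~~ Pm m.+1 by apply/negP => /mmax; rewrite ltnn.
  rewrite /Pm /= negb_and => /orP[|].
    rewrite -ltnNge doubleS => Nm.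
    have NE : (N ^ j = m.*2)%N.
      apply: even_between => //.
      by rewrite oddX /N oddM /= orbF -lt0n j0.
    have Xm : X ^+ j <= m%:R.
      have h2 : (2 * X) ^+ j <= (m.*2)%:R.
        rewrite -NE natrX; apply: lerXn2r; [|by rewrite nnegrE ler0n|by rewrite /N natrM ler_wpM2l].
        by rewrite nnegrE; exact: mulr_ge0 (ler0n R 2) (le_trans ler01 X1).
      have h3 : 2 <= 2 ^+ j :> R by rewrite -{1}(expr1 2) ler_weXn2l// ler1n.
      have Xj : 0 <= X ^+ j by exact: exprn_ge0 (le_trans ler01 X1).
      have h4 := ler_wpM2r Xj h3; rewrite exprMn -muln2 natrM in h2; lra_using h2 h4.
    have yc : 1 <= y ^+ j * m%:R.
      apply: (@le_trans _ _ (y ^+ j * X ^+ j)); first by rewrite -exprMn Xy expr1n.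
      by rewrite ler_wpM2l// exprn_ge0// ltW.
    have := base j m%:R m00 kE yc; clear yc Xm NE Lx L0 X1 Nc1 q0 w0 x0 P0 y0.
    by move=> h2; lra_using h2 pow26 Pm0.
  rewrite -ltNge => /ltW v1; have h2 : 1 <= 16 * m%:R * (q * (L ^+ d * w)).
    have v0 : 0 <= q * (L ^+ d * w) by rewrite mulr_ge0 ?(ltW q0)// mulr_ge0 ?exprn_ge0 ?ltW.
    apply: le_trans v1 _; rewrite mulrA ler_wpM2r// -natr1; lra_using m1.
  have h3 := volP (16 * m%:R) (mulr_ge0 (ler0n R 16) (ltW m00)) h2.
  have h4 : 2 ^+ d <= (79 / 10) ^+ d :> R by apply: powM; clear_props; lra.
  by lra_using h4 Pm0 h3.
have x100 : 0 <= x / 10 by apply: le_trans x14; rewrite ler0n.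
have xd : 0 <= (x / 10) ^+ d by rewrite exprn_ge0.
apply: (@le_trans _ _ (2 ^+ d * (x / 10) ^+ d)).
  by rewrite -exprMn; apply: powM; lra_using x100 x14.
apply: (@le_trans _ _ (96 * (P * m%:R) * (x / 10) ^+ d)); first by rewrite ler_wpM2r.
have : (x / 10) ^+ d <= (x / 10 + 2) ^+ d by apply: powM => //; rewrite lerDl ler0n.
have Pm0 : 0 <= P * m%:R by rewrite mulr_ge0// ltW.
by move=> /(ler_wpM2l Pm0) h2; rewrite /P in h2 *; lra_using h2.
Qed.

End ParameterChoice.

(** * Numerical constants of the bump and conclusion *)

Lemma ler_root_pow (R : realType) (d : nat) (m a : R) : (0 < d)%N -> 0 <= a -> 0 <= m -> m <= a `^ (2 / d%:R) ->
  Num.sqrt m ^+ d <= a.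
Proof.
move=> d0 a0 m0 ma; rewrite -(ler_pXn2r (n := 2)) ?nnegrE ?exprn_ge0 ?sqrtr_ge0//.
rewrite exprAC sqr_sqrtr//; apply: (@le_trans _ _ ((a `^ (2 / d%:R)) ^+ d)).
  by rewrite lerXn2r ?nnegrE ?powR_ge0.
rewrite -powR_mulrn ?powR_ge0// -powRrM divfK ?pnatr_eq0 -?lt0n//.
by rewrite powR_mulrn.
Qed.

(** The constant [2 ^+ 31] is 2 times [(2 ^+ 9) ^+ 2] times [2 ^+ 12]: the two-point factor, a power
    of 2 above 400, and the ratio 4096 of [t ^+ 2] to the height. *)
Lemma eps_bound (R : realType) (r m eps : R) : 0 < r -> 0 < m -> eps < r / 2 ^+ 31 * m ->
  2 * eps < r * ((Num.sqrt m / 400) ^+ 2 / 4096).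
Proof.
move=> r0 m0 em; have k4 : 0 < 4096 :> R by rewrite ltr0n.
have e12 : 4096 = 2 ^+ 12 :> R by ring.
have e31 : 2 ^+ 31 = 2 * (2 ^+ 9) ^+ 2 * 4096 :> R by rewrite e12 -exprM -exprS -exprD.
have h2 : 2 * eps < r * m / ((2 ^+ 9) ^+ 2 * 4096).
  apply: (@lt_le_trans _ _ (2 * (r / 2 ^+ 31 * m))); first by rewrite ltr_pM2l.
  rewrite e31 le_eqVlt; apply/orP; left; apply/eqP; move: k4; move: (4096 : R) => k k0.
  by field; rewrite gt_eqF.
apply: lt_le_trans h2 _; rewrite expr_div_n sqr_sqrtr ?(ltW m0)//.
have -> : r * (m / 400 ^+ 2 / 4096) = r * m / (400 ^+ 2 * 4096).
  by move: k4; move: (4096 : R) => k k0; field; rewrite gt_eqF.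
have p (k : R) : 0 < k -> 0 < k ^+ 2 * 4096 by move=> k0; exact: mulr_gt0 (exprn_gt0 2 k0) k4.
have p9 : 0 < 2 ^+ 9 :> R by exact: exprn_gt0.
rewrite ler_pM2l; last exact: mulr_gt0.
rewrite lef_pV2 ?posrE; [|exact: p|by apply: p; rewrite ltr0n].
rewrite ler_pM2r// lerXn2r ?nnegrE ?ler0n ?(ltW p9)//.
by rewrite -natrX ler_nat.
Qed.

Lemma good_bump_sqr (R : realType) (t : R) : 0 < t -> t <= 1 / 12800 -> good_bump (t ^+ 2 / 4096) t 1.
Proof.
move=> t0 t1; have k4 : 0 < 4096 :> R by rewrite ltr0n.
split=> //; rewrite gtr0_norm; last by rewrite divr_gt0// exprn_gt0.
rewrite mulr1 mulrC (divfK (lt0r_neq0 k4)); exact: lexx.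
Qed.

Lemma tower_flat_volume (R : realType) (d0 e : nat) (tw : tower R e) :
  exists v : R, [/\ hausdorff d0.+1 (tower_set (d0 := d0) tw 0 1) = v%:E,
    (half tw)%:R * ((rad tw + 2) ^+ d0.+1 * vball R d0) <= v &
    v <= 4 * (half tw)%:R * ((rad tw + 15 / 4) ^+ d0.+1 * vball R d0)].
Proof.
have gb0 : good_bump 0 (1 / 12800) (1 : R).
  split; [exact: ltr01|exact: lexx|by rewrite mul1r invr_gt0 ltr0n|exact: lexx|].
  by rewrite normr0 mulr0 mul0r sqr_ge0.
have up := tower_upper d0 tw gb0; have lo := tower_lower d0 tw gb0; clear gb0.
rewrite (tower_flatE _ _ _ 1) in up lo.
have fin : hausdorff d0.+1 (tower_set (d0 := d0) tw 0 1) \is a fin_num.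
  by rewrite ge0_fin_numE ?hausdorff_ge0//; apply: le_lt_trans up _; rewrite ltry.
exists (fine (hausdorff d0.+1 (tower_set (d0 := d0) tw 0 1))).
by rewrite -!lee_fin fineK.
Qed.

(** The first term of the minimum bounds [sqrt m] by 1/32, and 32 times 400 is the 12800 of
    [good_bump]. *)
Lemma good_bump_sqrt (R : realType) (d : nat) (m : R) : (0 < d)%N -> 0 < m ->
  m <= 1 / (2 ^+ 10 * d%:R ^+ 2) ->
  good_bump ((Num.sqrt m / 400) ^+ 2 / 4096) (Num.sqrt m / 400) 1.
Proof.
move=> d_gt0 m0 md; have sm : Num.sqrt m <= 1 / 32.
  rewrite -(ler_pXn2r (n := 2)) ?nnegrE ?sqrtr_ge0 ?divr_ge0// sqr_sqrtr ?(ltW m0)//.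
  have d1 : 1 <= d%:R :> R by rewrite ler1n.
  apply: le_trans md _; rewrite !mul1r exprVn lef_pV2 ?posrE ?mulr_gt0 ?exprn_gt0 ?ltr0n//.
  have -> : 32 ^+ 2 = 2 ^+ 10 :> R by rewrite (_ : 32 = 2 ^+ 5) -?exprM//; ring.
  by rewrite ler_peMr ?exprn_ge0// exprn_ege1.
have k4 : 0 < 400 :> R by rewrite ltr0n.
have s0 : 0 < Num.sqrt m by rewrite sqrtr_gt0.
by apply: good_bump_sqr (divr_gt0 s0 k4) _; move: sm; lra.
Qed.

(** The constant 400 is 4 times 100: one 2 from the Lipschitz bound of the cap, one from [vball_le],
    and 100 to beat the 96. *)
Lemma bump_mass (R : realType) (d0 : nat) (m a : R) : 0 < a -> 0 < m ->
  m <= a `^ (2 / d0.+1%:R) ->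
  96 * ((2 * (Num.sqrt m / 400)) ^+ d0.+1 * vball R d0) <= a * omega R d0.+1.
Proof.
move=> a0 m0 ma; have om0 := omega_gt0 R d0.+1.
have sda : Num.sqrt m ^+ d0.+1 <= a by apply: ler_root_pow => //; exact: ltW.
have [k [k0 -> k4]] : exists k : R, [/\ 0 < k, 400 = k & 2 * 2 / k = 100^-1].
  by exists 400; split; [rewrite ltr0n| |field].
move: (Num.sqrt m) (sqrtr_ge0 m) sda => r r0 ra.
have h1 : (2 * (r / k)) ^+ d0.+1 * vball R d0 <= (100^-1 * r) ^+ d0.+1 * omega R d0.+1.
  apply: (@le_trans _ _ ((2 * (r / k)) ^+ d0.+1 * (2 ^+ d0.+1 * omega R d0.+1))).
    apply: ler_wpM2l; last exact: vball_le.
    by apply: exprn_ge0; apply: mulr_ge0; [rewrite ler0n|exact: divr_ge0 r0 (ltW k0)].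
  rewrite [leLHS]mulrA -[X in X * _ <= _]exprMn -k4 (_ : 2 * (r / k) * 2 = 2 * 2 / k * r); first exact: lexx.
  by field; rewrite gt_eqF.
have h2 : 100^-1 ^+ d0.+1 <= 100^-1 :> R.
  rewrite exprS; apply: ler_piMr; first by rewrite invr_ge0 ler0n.
  by apply: exprn_ile1; [rewrite invr_ge0 ler0n|rewrite invf_le1 ?ltr0n// ler1n].
have h3 : (100^-1 * r) ^+ d0.+1 <= 100^-1 * a.
  rewrite exprMn; apply: ler_pM; [|exact: exprn_ge0|exact: h2|exact: ra].
  by apply: exprn_ge0; rewrite invr_ge0 ler0n.
have h4 := ler_wpM2r (ltW om0) h3; have h5 := mulr_gt0 a0 om0.
by move: h1 h4 h5; move: (_ ^+ d0.+1 * vball R d0) (_ ^+ d0.+1 * omega R d0.+1) => u v; lra.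
Qed.

Theorem theorem5p5 (R : realType) (n d : nat)
    (rch Rb fmin fmax L tau alpha eps : R) :
  (1 <= d)%N -> (d < n)%N ->
  0 < rch -> 144 * rch <= Rb ->
  0 < fmin -> fmin <= fmax / 96 ->
  0 <= L -> 0 < tau -> alpha < 1 / 2 ->
  (* min_{1<=k<=n} (192 rch sqrt k / Rb)^k <= 36 8^d sigma_{d-1} fmin rch^d *)
  (exists k : nat, [/\ (1 <= k)%N, (k <= n)%N &
     (192 * rch * Num.sqrt (k%:R) / Rb) ^+ k
       <= 36 * 8 ^+ d * sigma_sphere R d * fmin * rch ^+ d]) ->
  36 * 8 ^+ d * sigma_sphere R d * fmin * rch ^+ d <= 1 ->
  eps < rch / 2 ^+ 31 *
          Num.min (1 / (2 ^+ 10 * (d%:R) ^+ 2))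
                  ((tau / (omega R d * fmin * rch ^+ d)) `^ (2 / d%:R)) ->
  forall (dO : measure_display) (Om : measurableType dO)
         (P : probability Om R) (A : Om -> det_alg R n),
    ~ sq_estimates (model d rch fmin fmax L Rb) tau eps alpha P A.
Proof.
move=> d1 dn rch0 Rb144 f0 ff L0 tau0 a2 hk h1 epsm dO Om P A.
have [e nE] : exists e, n = (d + e)%N by exists (n - d)%N; rewrite subnKC// ltnW.
have e0 : (0 < e)%N by move: dn; rewrite nE -{1}(addn0 d) ltn_add2l.
case: d d1 => // d0 _ in nE h1 hk epsm dn *; rewrite nE in A hk *.
(* Lengths are measured in units of [rch]: [q] is then the lower bound of the density and [x] the
   radius of the bounding ball. *)
set d := d0.+1 in h1 hk epsm A *; clear dn; pose q := fmin * rch ^+ d.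
have om0 := omega_gt0 R d; have w0 := vball_gt0 R d0.
have q0 : 0 < q by rewrite mulr_gt0// exprn_gt0.
pose x := Rb / rch; have x144 : 144 <= x by rewrite ler_pdivlMr.
have h1' : 36 * 8 ^+ d * sigma_sphere R d * q <= 1 by rewrite /q mulrA.
have hk' : exists k : nat, [/\ (1 <= k)%N, (k <= d + e)%N &
     (192 * Num.sqrt (k%:R) / x) ^+ k <= 36 * 8 ^+ d * sigma_sphere R d * q].
  case: hk => k [k1 kn hk]; exists k; split=> //; rewrite /q [leRHS]mulrA.
  rewrite (_ : 192 * Num.sqrt k%:R / x = 192 * rch * Num.sqrt k%:R / Rb)//.
  by rewrite /x invf_div mulrA; congr (_ / _); ring.
have [tw [Hb [[hb Hb0] va rb rd]]] := tower_params q0 x144 e0 hk' h1'.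
have [v0 [v0E lo up]] := tower_flat_volume d0 tw.
have bb := rad_gt0 tw; have m1 : 1 <= (half tw)%:R :> R by rewrite ler1n half_gt0.
have v00 : 0 < v0.
  by apply: lt_le_trans lo; rewrite !mulr_gt0 ?exprn_gt0 ?addr_gt0// ltr0n half_gt0.
have r0 : 0 < rad tw + 9 / 4 + (Hb + 1).
  by apply: addr_gt0; [apply: addr_gt0; [exact: bb|rewrite divr_gt0]|rewrite ltr_wpDl].
have qv : 2 * (q * v0) <= 1.
  by apply: le_trans va; rewrite ler_wpM2l// ler_wpM2l// ltW.
have xd0 : 0 < x ^+ d by rewrite exprn_gt0//; apply: lt_le_trans x144; rewrite ltr0n.
have rd' : (rad tw + 9 / 4 + (Hb + 1)) ^+ d <= 96 * (q * x ^+ d * v0).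
  apply: le_trans rd _; rewrite ler_wpM2l ?ler0n// ler_wpM2l//.
  by rewrite mulr_ge0// ltW.
have [s [s1 sr slo sup]] := choose_scale q0 v00 r0 rb qv rd'.
set mn := Num.min _ _ in epsm.
pose a := tau / (omega R d * fmin * rch ^+ d).
have a0 : 0 < a by rewrite divr_gt0// !mulr_gt0// exprn_gt0.
have mn0 : 0 < mn.
  rewrite lt_min powR_gt0// andbT; apply: divr_gt0; first exact: ltr01.
  by apply: mulr_gt0; apply: exprn_gt0; rewrite ltr0n.
have mnd : mn <= 1 / (2 ^+ 10 * d%:R ^+ 2) by rewrite ge_min lexx.
have mna : mn <= a `^ (2 / d%:R) by rewrite ge_min lexx orbT.
(* The bump has width [sqrt mn / 400] and height [width ^+ 2 / 4096], in units of [rch]. *)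
have gt := good_bump_sqrt (ltn0Sn d0) mn0 mnd.
have epsE := eps_bound rch0 mn0 epsm.
have tauP : 96 * (fmin * rch ^+ d * ((2 * (Num.sqrt mn / 400)) ^+ d * vball R d0)) <= tau.
  have D0 : omega R d * fmin * rch ^+ d != 0 by rewrite !mulf_neq0 ?expf_neq0 ?gt_eqF.
  have -> : tau = q * (a * omega R d).
    by rewrite [RHS]mulrCA /q [_ * omega R d]mulrC [omega R d * _]mulrA /a divfK.
  by rewrite -/q mulrCA ler_pM2l// bump_mass.
have E0 : 0 < (Num.sqrt mn / 400) ^+ 2 / 4096.
  have k4 : 0 < 4096 :> R by rewrite ltr0n.
  by case: (gt) => _ _ t0 _ _; exact: divr_gt0 (exprn_gt0 2 t0) k4.
apply: (@tower_pair R d0 e tw rch Rb fmin fmax L tau alpha eps (Num.sqrt mn / 400) _ s v0 Hb _ Om P A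
  rch0 f0 ff L0 a2 s1 E0 gt hb) => //.
by move: sr; rewrite /x ler_pdivlMr// mulrAC.
Qed.
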